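(* Let $v>1$ be an integer, let $F$ be an absolutely continuous distribution function of a non-negative random variable $X$ with $E(X)<\infty$, and let $X_1,X_2,\dots$ be i.i.d. with distribution function $F$. Let $$\theta=GIM(v)=\frac{E\big(\max(X_1,\dots,X_v)-\min(X_1,\dots,X_v)\big)}{E\big(\max(X_1,\dots,X_v)+\min(X_1,\dots,X_v)\big)},$$ $$\psi(x_1,\dots,x_v;\theta)=\theta\big(\max(x_1,\dots,x_v)+\min(x_1,\dots,x_v)\big)-\big(\max(x_1,\dots,x_v)-\min(x_1,\dots,x_v)\big).$$ Let $g(x)=E\big(\psi(X_1,\dots,X_v;\theta)\mid X_1=x\big)$ and $\sigma_g^2=\mathrm{Var}(g(X))$. Suppose that $E\big(\psi(X_1,\dots,X_v;\theta)\big)<\infty$ and $\sigma_g^2>0$. Let $\log R(\theta)$ be the jackknife empirical log-likelihood ratio based on $X_1,\dots,X_n$, evaluated at $\theta=GIM(v)$. Then, as $n\to\infty$, $-2\log R(\theta)$ converges in distribution to a $\chi^2$ random variable with one degree of freedom.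
   Context: Let $S_n=\binom{n}{v}^{-1}\sum_{1\le i_1<\cdots<i_v\le n}\psi(X_{i_1},\dots,X_{i_v};\theta)$, and for $1\le k\le n$ let $S_{n-1,k}$ be the same statistic computed from the $n-1$ observations $X_1,\dots,X_{k-1},X_{k+1},\dots,X_n$. The jackknife pseudo-values are $\widehat V_k=nS_n-(n-1)S_{n-1,k}$, $k=1,\dots,n$. The jackknife empirical likelihood is $\sup\{\prod_{k=1}^n p_k:\ \sum_{k=1}^n p_k=1,\ \sum_{k=1}^n p_k\widehat V_k=0\}$, the supremum being over probabilities $p_1,\dots,p_n$; without the last constraint the product is maximised at $p_k=1/n$, and $R(\theta)$ is the ratio of the constrained to the unconstrained maximum. By Lagrange multipliers, $\log R(\theta)=-\sum_{k=1}^n\log(1+\lambda\widehat V_k)$, where $\lambda$ is the solution of $\frac1n\sum_{k=1}^n\frac{\widehat V_k}{1+\lambda\widehat V_k}=0$, provided $\min_{1\le k\le n}\widehat V_k<0<\max_{1\le k\le n}\widehat V_k$. *)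

(* Defs.v *)
From HB Require Import structures.
From mathcomp Require Import all_boot all_order all_algebra.
From mathcomp Require Import all_classical all_reals all_analysis.
From mathcomp Require Import measurable_realfun.

Set Implicit Arguments.
Unset Strict Implicit.
Unset Printing Implicit Defensive.

Import Order.TTheory GRing.Theory Num.Theory.
Import numFieldNormedType.Exports.

Local Open Scope classical_set_scope.
Local Open Scope ring_scope.

Section probability_notions.
Context {d : measure_display} {T : measurableType d} {R : realType}.
Variable P : probability T R.

Definition mutually_independent (Xs : nat -> {RV P >-> R}) : Prop :=
  forall (J : seq nat) (B : nat -> set R), uniq J ->
    (forall j, measurable (B j)) ->
    P (\bigcap_(j in [set` J]) (Xs j @^-1` B j)) =
    (\prod_(j <- J) P (Xs j @^-1` B j))%E.

(* [g] is a version of [x |-> E(Y | Z = x)]; it is unique only up to null sets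
   of the law of [Z]. *)
Definition is_cond_expectation (Y : T -> R) (Z : {RV P >-> R})
    (g : R -> R) : Prop :=
  [/\ P.-integrable [set: T] (EFin \o Y),
      measurable_fun [set: R] g,
      (distribution P Z).-integrable [set: R] (EFin \o g) &
      forall B : set R, measurable B ->
        (\int[P]_(w in Z @^-1` B) (Y w)%:E =
         \int[distribution P Z]_(x in B) (g x)%:E)%E].

(* The [Y n] may take the value [+oo]; as the limit [mu] is a probability on
   the real line, this is harmless.  The quantifier ranges over the continuity
   points of the distribution function of [mu]. *)
Definition cvg_in_distribution (Y : nat -> T -> \bar R)
    (mu : probability R R) : Prop :=
  (forall n, measurable_fun [set: T] (Y n)) /\
  (forall x : R, mu [set x] = 0%E ->
     (P [set w | Y n w <= x%:E]%E @[n --> \oo] --> mu `]-oo, x]%classic)%E).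

End probability_notions.

(* Absolute continuity of a distribution function, in the sense that it is the
   indefinite integral of a density. *)
Definition abs_continuous_df {R : realType} (F : R -> R) : Prop :=
  exists f : R -> R, [/\ measurable_fun [set: R] f, forall x, 0 <= f x &
    forall x, ((F x)%:E = \int[lebesgue_measure]_(t in `]-oo, x]) (f t)%:E)%E].

Definition sqr_fun {R : realType} (z : measurableTypeR R) : R := (z : R) ^+ 2.

Lemma measurable_sqr_fun {R : realType} :
  measurable_fun [set: measurableTypeR R] (@sqr_fun R).
Proof. exact: (@exprn_measurable R setT 2). Qed.

HB.instance Definition _ (R : realType) :=
  isMeasurableFun.Build _ _ (measurableTypeR R) R (@sqr_fun R)
    (@measurable_sqr_fun R).

(* The chi-square law with one degree of freedom: the law of the square of a
   standard normal variable. *)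
Definition chi_square1 (R : realType) : probability R R :=
  distribution (normal_prob (0 : R) 1) (@sqr_fun R).

Section gini.
Context {R : realType}.

(* The default value [head 0 s] belongs to [s] when [s] is nonempty, so these
   are the true maximum and minimum of the entries of [s]. *)
Definition smax (s : seq R) : R := \big[Order.max/head 0 s]_(x <- s) x.
Definition smin (s : seq R) : R := \big[Order.min/head 0 s]_(x <- s) x.

Definition psi (theta : R) (s : seq R) : R :=
  theta * (smax s + smin s) - (smax s - smin s).

(* The values at [w] of the first [v] variables; [Xs 0, Xs 1, ...] stand for
   X_1, X_2, .... *)
Definition first_obs {T : Type} (Xs : nat -> T -> R) (v : nat) (w : T) : seq R :=
  [seq Xs i w | i <- iota 0 v].

Definition GIM {d : measure_display} {T : measurableType d}
    (P : probability T R) (Xs : nat -> T -> R) (v : nat) : R :=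
  fine 'E_P[fun w => smax (first_obs Xs v w) - smin (first_obs Xs v w)] /
  fine 'E_P[fun w => smax (first_obs Xs v w) + smin (first_obs Xs v w)].

End gini.

Section jackknife_empirical_likelihood.
Context {R : realType}.

(* [enum A] lists the elements i_1 < ... < i_v of [A] in increasing order. *)
Definition Ustat (v : nat) (h : seq R -> R) (n : nat) (x : 'I_n -> R) : R :=
  ('C(n, v)%:R)^-1 *
  \sum_(A : {set 'I_n} | #|A| == v) h [seq x i | i <- enum A].

(* [x \o lift k] is the sample [x] with its [k]-th observation deleted. *)
Definition pseudo_value (v : nat) (h : seq R -> R) (n : nat) (x : 'I_n -> R)
    (k : 'I_n) : R :=
  n%:R * Ustat v h x - n.-1%:R * Ustat v h (x \o lift k).

Definition prob_weights (n : nat) : set ('I_n -> R) :=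
  [set p | (forall k, 0 <= p k) /\ \sum_k p k = 1].

(* [sup set0 = 0], which is the usual convention for the empirical likelihood
   when the constraints are infeasible. *)
Definition EL_ratio (n : nat) (V : 'I_n -> R) : R :=
  sup [set \prod_k p k | p in
        @prob_weights n `&` [set p | \sum_k p k * V k = 0]] /
  sup [set \prod_k p k | p in @prob_weights n].

(* Extended-real logarithm: [log 0 = -oo]. *)
Definition JEL_logratio (v : nat) (h : seq R -> R) (n : nat) (x : 'I_n -> R) :
    \bar R :=
  lne (EL_ratio (pseudo_value v h x))%:E.

End jackknife_empirical_likelihood.

(* Main.v *)
(* The statistic [S_n] is a U-statistic whose kernel has mean zero by the choice
   of [theta].  With [G (x) = E(psi | X_1 = x)] it is asymptotic to its Hajek
   projection [(v / n) * \sum_k G (X_k)], and the pseudo-value [V_k] is close to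
   [v * G (X_k)], both with a squared error controlled by the number of common
   indices of two [v]-subsets.  Square integrability of [X] is not assumed: it
   follows from that of [G], because [psi] is affine in a large argument.

   On the likelihood side, duality identifies the ratio with the infimum over
   feasible [l] of [\prod_k (1 + l * V_k)^-1].  A second order expansion of the
   concave dual objective gives [- 2 log R = n S_n^2 / (n^-1 \sum_k V_k^2)] up to
   a factor close to one as soon as [max |V_k|] is small compared with [sqrt n].
   The denominator tends to [v^2 sigma_g^2] by the weak law of large numbers and
   the numerator is governed by the central limit theorem, which is obtained by
   Lindeberg's replacement method. *)

Require Import Defs.
From HB Require Import structures.
From mathcomp Require Import all_boot all_order all_algebra.
From mathcomp Require Import all_classical all_reals all_analysis.
From mathcomp Require Import measurable_realfun.
From mathcomp Require Import ring lra zify.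

Import Order.TTheory GRing.Theory Num.Theory.
Import numFieldNormedType.Exports.

Local Open Scope classical_set_scope.
Local Open Scope ring_scope.

Set Implicit Arguments.
Unset Strict Implicit.
Unset Printing Implicit Defensive.

(** * Empirical likelihood and its dual *)

Section EL.
Context {R : realType}.
Implicit Types (n : nat).

(** The equation for the multiplier has a root only when the pseudo-values take both signs, and the
    root is random without closed form. Its asymptotics are therefore avoided: every feasible
    multiplier bounds the ratio from above by the arithmetic-geometric mean inequality, and this
    bound is tight up to an arbitrarily small excess, whatever the signs. The same fact yields the
    measurability of the ratio, and its positivity once the pseudo-values are controlled.

    The conditional expectation [g] is known only up to null sets; it is exchanged for an explicit
    continuous version, for which independence arguments reduce to Fubini. The observations share
    the law of the non-negative [X] but may be negative on a null set, hence the work with means of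
    negative parts. The slope of [psi] in a large argument is [theta - 1], so the square
    integrability argument breaks down at [theta = 1]; there [psi] is twice a minimum of mean zero,
    hence null, against the positive variance. *)

Lemma ln1Dx_taylor2 (x : R) : `|x| <= 2^-1 ->
  `|ln (1 + x) - (x - x ^+ 2 / 2)| <= 2 * `|x| ^+ 3.
Proof.
move=> hx.
pose H (y : R) := ln (1 + y) - (y - 2^-1 *: y ^+ 2).
pose dH (y : R) := (1 + y)^-1 - (1 - y).
have dHE (y : R) : `|y| <= 2^-1 -> is_derive y 1 H (dH y).
  rewrite ler_norml => /andP[y1 y2].
  have y0 : 0 < 1 + y by lra.
  have h1 : is_derive (1 + y) 1 (@ln R) (1 + y)^-1 by exact: is_derive1_ln.
  have h2 : is_derive y 1 (fun z : R => 1 + z) 1.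
    by apply: is_derive_eq; rewrite add0r mulr1.
  have h3 : is_derive y 1 (fun z : R => ln (1 + z)) (1 + y)^-1.
    have := @is_derive1_comp R (@ln R) (fun z : R => 1 + z) y _ _ h1 h2.
    by rewrite mulr1.
  rewrite /H /dH; apply: is_derive_eq.
  by rewrite /GRing.scale /=; field; lra.
have key (c : R) : `|c| <= `|x| -> `|dH c * x| <= 2 * `|x| ^+ 3.
  move=> cx.
  have c2 : `|c| <= 2^-1 by exact: le_trans cx hx.
  have c0 : 2^-1 <= 1 + c by move: c2; rewrite ler_norml => /andP[]; lra.
  have -> : dH c = c ^+ 2 / (1 + c) by rewrite /dH; field; lra.
  have i0 : 0 <= (1 + c)^-1 by rewrite invr_ge0; lra.
  have i2 : (1 + c)^-1 <= 2 by rewrite -[leRHS]invrK lef_pV2// ?posrE ?invr_gt0//; lra.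
  rewrite 2!normrM normrX (ger0_norm i0) [_ ^+ 3]exprSr mulrA ler_wpM2r// mulrC.
  by rewrite ler_pM// ?sqr_ge0// ler_sqr// nnegrE.
have H0 : H 0 = 0 by rewrite /H addr0 ln1 expr0n /= scaler0 !subr0.
have cH (a b : R) : -2^-1 <= a -> b <= 2^-1 -> {within `[a, b], continuous H}.
  move=> a1 b1; apply: derivable_within_continuous => y.
  rewrite in_itv /= => /andP[ay yb].
  by apply: ex_derive; apply: dHE; rewrite ler_norml; apply/andP; split; lra.
move: hx; rewrite ler_norml => /andP[x1 x2].
have hE : ln (1 + x) - (x - x ^+ 2 / 2) = H x by rewrite /H /GRing.scale /=; field.
have hd (a b : R) : -2^-1 <= a -> b <= 2^-1 -> forall y, y \in `]a, b[ -> is_derive y 1 H (dH y).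
  move=> a1 b1 y; rewrite in_itv /= => /andP[y1 y2].
  by apply: dHE; rewrite ler_norml; apply/andP; split; lra.
rewrite hE; have [x0|x0] := leP 0 x.
  have [c] := @MVT_segment R H dH 0 x x0 (hd 0 x ltac:(lra) x2) (cH 0 x ltac:(lra) x2).
  rewrite in_itv /= H0 !subr0 => /andP[c1 c2] ->.
  by rewrite key// !ger0_norm.
have [c] := @MVT_segment R H dH x 0 (ltW x0) (hd x 0 x1 ltac:(lra)) (cH x 0 x1 ltac:(lra)).
rewrite in_itv /= H0 !sub0r => /andP[c1 c2] E.
rewrite -normrN E mulrN normrN key//.
by rewrite !ler0_norm ?lerN2// ltW.
Qed.

Definition EL_dual_feasible n (V : 'I_n -> R) (l : R) := forall k, 0 < 1 + l * V k.

(** The exponential of the negated dual objective [\sum_k ln (1 + l * V k)], which is concave in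
    [l]. The product form is compared directly with products of weights, so a ratio equal to zero
    needs no logarithm. *)
Definition EL_dual n (V : 'I_n -> R) (l : R) := \prod_k (1 + l * V k)^-1.

Lemma EL_dual_gt0 n (V : 'I_n -> R) l : EL_dual_feasible V l -> 0 < EL_dual V l.
Proof. by move=> h; apply: prodr_gt0 => k _; rewrite invr_gt0. Qed.

Lemma prod_le_AGM n (a : 'I_n -> R) : (0 < n)%N -> (forall k, 0 <= a k) ->
  \prod_k a k <= ((\sum_k a k) / n%:R) ^+ n.
Proof.
move=> n0 a0; have := @leif_AGM R _ xpredT a; rewrite /= card_ord => h.
by have /h[] : {in xpredT, forall i, 0 <= a i} by [].
Qed.

Lemma sup_prob_weights n : (0 < n)%N ->
  sup [set \prod_k p k | p in @prob_weights R n] = (n%:R ^+ n)^-1.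
Proof.
move=> n0; have nR : (n%:R : R) != 0 by rewrite pnatr_eq0 -lt0n.
apply/eqP; rewrite eq_le; apply/andP; split.
  apply: ge_sup.
    exists (\prod_(k < n) n%:R^-1); exists (fun=> n%:R^-1) => //; split => //.
    by rewrite sumr_const card_ord -[_ *+ n]mulr_natr mulVf.
  move=> _ [p [p0 p1] <-]; apply: le_trans (prod_le_AGM n0 p0) _.
  by rewrite p1 div1r exprVn.
apply: ub_le_sup.
  exists (n%:R ^+ n)^-1 => _ [p [p0 p1] <-].
  by apply: le_trans (prod_le_AGM n0 p0) _; rewrite p1 div1r exprVn.
exists (fun=> n%:R^-1).
  by split => //; rewrite sumr_const card_ord -[_ *+ n]mulr_natr mulVf.
by rewrite prodr_const card_ord exprVn.
Qed.

Let EL_set n (V : 'I_n -> R) := [set \prod_k p k | p in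
        @prob_weights R n `&` [set p | \sum_k p k * V k = 0]].

Let EL_set_ub n (V : 'I_n -> R) : (0 < n)%N -> ubound (EL_set V) (n%:R ^+ n)^-1.
Proof.
move=> n0 _ [p [[p0 p1] _] <-].
by apply: le_trans (prod_le_AGM n0 p0) _; rewrite p1 div1r exprVn.
Qed.

Lemma EL_ratio_ge0 n (V : 'I_n -> R) : (0 < n)%N -> 0 <= EL_ratio V.
Proof.
move=> n0; rewrite /EL_ratio sup_prob_weights// divr_ge0//.
have [h|/set0P[x Sx]] := eqVneq (EL_set V) set0; first by rewrite [X in sup X]h sup0.
apply: (@le_trans _ _ x).
  by case: Sx => p [[p0 _] _] <-; apply: prodr_ge0.
by apply: ub_le_sup => //; exists (n%:R ^+ n)^-1; exact: EL_set_ub.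
Qed.

(** Weak duality. Under both constraints the numbers [(1 + l * V k) * p k] sum to one, so their
    product is at most [n ^- n]. An empty constraint set gives the supremum zero, which is harmless
    because the dual value is positive. *)
Lemma EL_ratio_le_dual n (V : 'I_n -> R) l : (0 < n)%N ->
  EL_dual_feasible V l -> EL_ratio V <= EL_dual V l.
Proof.
move=> n0 hl; rewrite /EL_ratio sup_prob_weights// invrK.
have nn : 0 < (n%:R : R) ^+ n by rewrite exprn_gt0// ltr0n.
rewrite -ler_pdivlMr//.
have [h|hS] := eqVneq (EL_set V) set0.
  by rewrite [X in sup X]h sup0 divr_ge0// ltW// EL_dual_gt0.
apply: ge_sup; first exact/set0P.
move=> _ [p [[p0 p1] pV] <-].
have P0 : 0 < \prod_k (1 + l * V k) by apply: prodr_gt0.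
rewrite ler_pdivlMr// /EL_dual prodfV -[leRHS]mul1r ler_pdivlMr// mulrAC mulrC -ler_pdivlMl//.
rewrite mulr1 mulrC -big_split /=.
apply: (@le_trans _ _ (((\sum_k (1 + l * V k) * p k) / n%:R) ^+ n)).
  by apply: prod_le_AGM => // k; rewrite mulr_ge0// ltW.
rewrite (_ : \sum_k _ = 1) ?div1r ?exprVn//.
transitivity (\sum_k p k + l * \sum_k p k * V k); last by rewrite p1 pV mulr0 addr0.
by rewrite mulr_sumr -big_split; apply: eq_bigr => k _ /=; ring.
Qed.

(** At a root of the score the weights [(1 + l * V k)^-1 / n] attain the dual value. They sum to one
    because [1 / (1 + l * V k) = 1 - l * (V k / (1 + l * V k))]. *)
Lemma EL_ratio_ge_dual n (V : 'I_n -> R) l : (0 < n)%N ->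
  EL_dual_feasible V l -> \sum_k V k / (1 + l * V k) = 0 ->
  EL_dual V l <= EL_ratio V.
Proof.
move=> n0 hl h0; rewrite /EL_ratio sup_prob_weights// invrK.
have nn : 0 < (n%:R : R) ^+ n by rewrite exprn_gt0// ltr0n.
rewrite -ler_pdivrMr//; apply: ub_le_sup; first by exists (n%:R ^+ n)^-1; exact: EL_set_ub.
exists (fun k => (1 + l * V k)^-1 / n%:R); last first.
  by rewrite big_split /= prodr_const card_ord exprVn.
split; first split.
- by move=> k; rewrite divr_ge0// invr_ge0 ltW.
- rewrite -mulr_suml.
  have -> : \sum_k (1 + l * V k)^-1 = \sum_(k < n) (1 - l * (V k / (1 + l * V k))).
    by apply: eq_bigr => k _; field; rewrite gt_eqF.
  rewrite sumrB -mulr_sumr h0 mulr0 subr0 sumr_const card_ord divff//.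
  by rewrite pnatr_eq0 -lt0n.
- rewrite /=; transitivity ((\sum_k V k / (1 + l * V k)) / n%:R); last by rewrite h0 mul0r.
  by rewrite mulr_suml; apply: eq_bigr => k _; ring.
Qed.

(** Sign of the score close to the negative end of the feasible interval. The denominator at the
    largest value [V j] equals [eta], so its term is [V j / eta]; negative values have denominators
    at least one, so they cost at most the sum of the absolute values. The other end follows by
    changing the sign of [V]. *)
Lemma EL_score_ge0 n (V : 'I_n -> R) j (eta : R) : 0 < V j -> (forall k, V k <= V j) ->
  0 < eta <= 1 -> eta * (\sum_k `|V k|) <= V j ->
  (forall k, eta <= 1 - (1 - eta) / V j * V k) /\
  0 <= \sum_k V k / (1 - (1 - eta) / V j * V k).
Proof.
move=> Vj hj /andP[e0 e1] hB.
have h1 k : eta <= 1 - (1 - eta) / V j * V k.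
  have : V k / V j <= 1 by rewrite ler_pdivrMr// mul1r.
  by rewrite -mulrA [_^-1 * _]mulrC => h; nra.
split => //; rewrite (bigD1 j) //=.
have -> : 1 - (1 - eta) / V j * V j = eta by field; rewrite gt_eqF.
rewrite (@le_trans _ _ (V j / eta - \sum_(k | k != j) `|V k|))//.
  rewrite subr_ge0 ler_pdivlMr// mulrC; apply: le_trans hB.
  by rewrite ler_pM2l// [X in _ <= X](bigD1 j) //= lerDr.
rewrite lerD2l -sumrN; apply: ler_sum => k _.
have := h1 k; set q := 1 - _ => hq; have q0 : 0 < q by exact: lt_le_trans hq.
have [Vk|Vk] := leP 0 (V k).
  by rewrite (@le_trans _ _ 0) ?oppr_le0// divr_ge0// ltW.
rewrite ltr0_norm// opprK ler_pdivlMr//.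
suff : 1 <= q by nra.
rewrite /q lerBrDr gerDl; apply: mulr_ge0_le0; last exact: ltW.
by rewrite divr_ge0 ?subr_ge0// ltW.
Qed.

Lemma EL_multiplier_exists n (V : 'I_n -> R) i j : V i < 0 -> 0 < V j ->
  exists2 l, EL_dual_feasible V l & \sum_k V k / (1 + l * V k) = 0.
Proof.
move=> Vi Vj.
have [i1 hi1] : exists i1, forall k, V i1 <= V k.
  by case: (@arg_minP _ R _ i xpredT V isT) => i1 _ h; exists i1 => k; exact: h.
have [j1 hj1] : exists j1, forall k, V k <= V j1.
  by case: (@arg_maxP _ R _ j xpredT V isT) => j1 _ h; exists j1 => k; exact: h.
have {}Vi : V i1 < 0 by apply: le_lt_trans Vi.
have {}Vj : 0 < V j1 by apply: lt_le_trans Vj _.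
pose B := \sum_k `|V k|.
have B0 : 0 < B.
  by rewrite /B (bigD1 j1) //= ltr_pwDl ?sumr_ge0// normr_gt0 gt_eqF.
pose m := Num.min (V j1) (- V i1).
have m0 : 0 < m by rewrite lt_min Vj oppr_gt0.
(* The same margin is used at both ends: [m] is the smaller of the two extreme magnitudes, so
   [eta * B] is at most each of them. *)
pose eta := m / B.
have e0 : 0 < eta by exact: divr_gt0.
have e1 : eta <= 1.
  rewrite ler_pdivrMr// mul1r (@le_trans _ _ (V j1))// ?ge_min ?lexx//.
  by rewrite -[V j1]gtr0_norm// /B (bigD1 j1) //= lerDl sumr_ge0.
have eB1 : eta * B <= V j1 by rewrite divfK ?gt_eqF// ge_min lexx.
have eB2 : eta * B <= - V i1 by rewrite divfK ?gt_eqF// ge_min lexx orbT.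
have [f1 s1] := @EL_score_ge0 _ V j1 eta Vj hj1 (introT andP (conj e0 e1)) eB1.
have [f2 s2] : (forall k, eta <= 1 - (1 - eta) / (- V i1) * - V k) /\
  0 <= \sum_k (- V k) / (1 - (1 - eta) / (- V i1) * - V k).
  apply: (@EL_score_ge0 _ (fun k => - V k) i1 eta) => //=; rewrite ?oppr_gt0 ?e0//.
  - by move=> k; rewrite lerN2.
  - by under eq_bigr do rewrite normrN.
pose l1 := - ((1 - eta) / V j1); pose l2 := (1 - eta) / (- V i1).
have l1N : l1 <= 0 by rewrite oppr_le0 divr_ge0 ?subr_ge0// ltW.
have l2P : 0 <= l2 by rewrite divr_ge0 ?subr_ge0// ltW// oppr_gt0.
have feas l : l1 <= l <= l2 -> EL_dual_feasible V l.
  move=> /andP[h1 h2] k; apply: (lt_le_trans e0).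
  have [Vk|Vk] := leP 0 (V k).
    by apply: (le_trans (f1 k)); rewrite lerD2l -mulNr ler_wpM2r.
  apply: (le_trans (f2 k)); rewrite lerD2l mulrN opprK.
  by rewrite ler_wnM2r// ltW.
have cont : {within `[l1, l2], continuous (fun l => \sum_k V k / (1 + l * V k))}.
  apply: derivable_within_continuous => l; rewrite in_itv /= => /feas hl.
  have -> : (fun l : R => \sum_k V k / (1 + l * V k)) = \sum_(k < n) (fun l => V k / (1 + l * V k)).
    by apply/funext => z; rewrite fct_sumE.
  apply: derivable_sum => k; apply: derivableM; first exact: derivable_cst.
  apply: derivableV; first by rewrite gt_eqF.
  apply: derivableD; first exact: derivable_cst.
  by apply: derivableM; [exact: derivable_id|exact: derivable_cst].
have [| |l] := @IVT R _ l1 l2 0 _ cont; first exact: le_trans l1N l2P.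
  apply/andP; split.
    rewrite ge_min; apply/orP; right; rewrite -oppr_ge0 -sumrN.
    by under eq_bigr do rewrite -mulNr -[l2 * _]opprK -mulrN.
  rewrite le_max; apply/orP; left.
  by under eq_bigr do rewrite mulNr.
by rewrite in_itv /= => /feas hl h0; exists l.
Qed.

(** Only near-optimality is claimed, since the infimum of the dual need not be attained: if the
    values are non-negative and not all zero, the ratio is zero and the dual decreases to zero as
    [l] grows. *)
Lemma EL_dual_close n (V : 'I_n -> R) (c : R) : (0 < n)%N -> EL_ratio V < c ->
  exists2 l, EL_dual_feasible V l & EL_dual V l < c.
Proof.
(* Changing the signs of [V] and [l] together affects neither the ratio nor the dual, so some value
   may be assumed positive unless all vanish. *)
wlog Vpos : V / (exists i, 0 < V i) \/ (forall i, V i = 0).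
  move=> H n0 hc.
  have [[i Vi]|h] := pselect (exists i, 0 < V i); first by apply: H => //; left; exists i.
  have hN i : V i <= 0 by rewrite leNgt; apply/negP => ?; apply: h; exists i.
  have EN : EL_ratio (fun k => - V k) = EL_ratio V.
    have E (p : 'I_n -> R) : \sum_k p k * - V k = - \sum_k p k * V k.
      by rewrite -sumrN; apply: eq_bigr => k _; rewrite mulrN.
    rewrite /EL_ratio; congr (sup _ / _); apply/seteqP; split => x [p [p1 p2] <-];
      exists p => //; split => //=; move: p2 => /=; rewrite E.
      by move=> /eqP; rewrite oppr_eq0 => /eqP.
    by move=> ->; rewrite oppr0.
  have [||l hl1 hl2] := H (fun k => - V k) _ n0; last 2 first.
    - by rewrite EN.
    - exists (- l); first by move=> k; have := hl1 k; rewrite mulrN mulNr.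
      by move: hl2; rewrite /EL_dual; under eq_bigr do rewrite mulrN -mulNr.
  have [[i Vi]|h'] := pselect (exists i, 0 < - V i); first by left; exists i.
  right => i; apply/eqP; rewrite eq_le oppr_le0 oppr_ge0 hN andbT.
  by rewrite leNgt; apply/negP => Vi; apply: h'; exists i; rewrite oppr_gt0.
move=> n0 hc.
case: Vpos => [[j Vj]|V0]; last first.
  have f0 : EL_dual_feasible V 0 by move=> k; rewrite mul0r addr0.
  exists 0 => //; apply: le_lt_trans hc; apply: EL_ratio_ge_dual => //.
  by rewrite big1// => k _; rewrite V0 mul0r.
have [[i Vi]|h] := pselect (exists i, V i < 0).
  have [l hl1 hl2] := EL_multiplier_exists Vi Vj.
  by exists l => //; apply: le_lt_trans hc; exact: EL_ratio_ge_dual.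
have VP i : 0 <= V i by rewrite leNgt; apply/negP => ?; apply: h; exists i.
have c0 : 0 < c by apply: le_lt_trans hc; exact: EL_ratio_ge0.
(* The factor at [j] becomes [(1 + c^-1)^-1], which is below [c], and the other factors are at most
   one. *)
pose l := (c^-1) / V j.
have l0 : 0 < l by rewrite divr_gt0// invr_gt0.
have hl k : 1 <= 1 + l * V k by rewrite lerDl mulr_ge0// ltW.
have fl : EL_dual_feasible V l by move=> k; apply: lt_le_trans (hl k).
exists l => //; rewrite /EL_dual (bigD1 j)//=.
apply: (@le_lt_trans _ _ (1 + l * V j)^-1).
  rewrite ler_piMr//; first by rewrite invr_ge0 ltW// fl.
  by apply: prodr_ile1 => k _; rewrite invr_ge0 ltW ?fl//= invf_le1 ?fl.
rewrite /l divfK ?gt_eqF// -[ltRHS]invrK ltf_pV2 ?posrE ?invr_gt0//.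
  by rewrite ltrDr.
by rewrite addr_gt0// invr_gt0.
Qed.

Lemma ln_EL_dual n (V : 'I_n -> R) l : EL_dual_feasible V l ->
  ln (EL_dual V l) = - \sum_k ln (1 + l * V k).
Proof.
move=> hl; rewrite /EL_dual -sumrN.
suff : 0 < \prod_k (1 + l * V k)^-1 /\ ln (\prod_k (1 + l * V k)^-1) = \sum_k - ln (1 + l * V k) by case.
elim/big_ind2 : _ => [|x1 x2 y1 y2 [h1 <-] [h2 <-]|k _].
- by rewrite ln1 ltr01.
- by rewrite mulr_gt0// lnM.
- by rewrite invr_gt0 lnV ?posrE ?hl.
Qed.

Lemma ln_concave01 (t y : R) : 0 <= t <= 1 -> 0 < 1 + y -> t * ln (1 + y) <= ln (1 + t * y).
Proof.
move=> /andP[t0 t1] y0.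
have := @concave_ln R (Itv01 t0 t1) (1 + y) 1 y0 ltr01.
rewrite !convRE /unstable.onem /= ln1 mulr0 addr0.
by rewrite (_ : t * (1 + y) + _ = 1 + t * y)//; ring.
Qed.

(* Concavity of the dual objective confines its supremum to a neighbourhood of
   the origin, where it is a quadratic up to a relative error. *)
Lemma EL_dual_quadratic_bounds n (V : 'I_n -> R) (S V2 m e : R) : (0 < n)%N ->
  S = (\sum_k V k) / n%:R -> V2 = (\sum_k V k ^+ 2) / n%:R -> 0 < V2 ->
  0 < m -> (forall k, `|V k| <= m) -> 0 < e <= 8^-1 -> `|S| * m <= e / 4 * V2 ->
  (exists2 l, EL_dual_feasible V l & n%:R * S ^+ 2 / V2 * (2^-1 - 2 * e) <= \sum_k ln (1 + l * V k)) /\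
  (forall l, EL_dual_feasible V l -> \sum_k ln (1 + l * V k) <= n%:R * S ^+ 2 / V2 / (2 - 8 * e)).
Proof.
move=> n0 SE V2E V20 m0 Vm /andP[e0 e1] hS.
have nR : (0 : R) < n%:R by rewrite ltr0n.
pose f l := \sum_k ln (1 + l * V k).
have quad l : `|l| * m <= e ->
  EL_dual_feasible V l /\ `|f l - n%:R * (l * S - l ^+ 2 * V2 / 2)| <= 2 * e * l ^+ 2 * n%:R * V2.
  move=> le.
  have lV k : `|l * V k| <= e by rewrite normrM; apply: le_trans le; rewrite ler_wpM2l.
  split.
    by move=> k; move: (lV k); rewrite ler_norml => /andP[h _]; lra.
  have E2 : \sum_k (l * V k) ^+ 2 = l ^+ 2 * \sum_k V k ^+ 2.
    by rewrite mulr_sumr; apply: eq_bigr => k _; rewrite exprMn.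
  have -> : n%:R * (l * S - l ^+ 2 * V2 / 2) = \sum_k (l * V k - (l * V k) ^+ 2 / 2).
    by rewrite SE V2E sumrB -mulr_sumr -mulr_suml E2; field; rewrite gt_eqF.
  have -> : 2 * e * l ^+ 2 * n%:R * V2 = \sum_k 2 * e * (l * V k) ^+ 2.
    by rewrite -!mulr_sumr E2 V2E; field; rewrite gt_eqF.
  rewrite -sumrB; apply: le_trans (ler_norm_sum _ _ _) _; apply: ler_sum => k _.
  apply: le_trans (ln1Dx_taylor2 _) _; first by apply: le_trans (lV k) _; lra.
  rewrite exprS real_normK ?num_real// mulrA ler_wpM2r ?sqr_ge0//.
  by rewrite ler_wpM2l.
set A := n%:R * S ^+ 2 / V2.
have A0 : 0 <= A by rewrite divr_ge0 ?(ltW V20)// mulr_ge0 ?sqr_ge0// ltW.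
split.
  (* [S / V2] maximises the quadratic approximation, and the assumption on [S] places it where the
     approximation is valid. *)
  have hl : `|S / V2| * m <= e.
    rewrite normrM normfV (gtr0_norm V20) mulrAC ler_pdivrMr//.
    by apply: le_trans hS _; rewrite ler_wpM2r ?(ltW V20)//; lra.
  have [h1 h2] := quad _ hl.
  exists (S / V2) => //; rewrite -/(f _).
  have E1 : n%:R * (S / V2 * S - (S / V2) ^+ 2 * V2 / 2) = A / 2.
    by rewrite /A; field; rewrite gt_eqF.
  have E2 : 2 * e * (S / V2) ^+ 2 * n%:R * V2 = 2 * e * A.
    by rewrite /A; field; rewrite gt_eqF.
  by move: h2; rewrite E1 E2 ler_norml => /andP[h2 _]; lra.
(* The quadratic coefficient [2^-1], lowered by the Taylor error. The maximum of
   [l * S - a * l ^+ 2 * V2] is [S ^+ 2 / (4 * a * V2)], and [4 * a = 2 - 8 * e]. *)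
pose a := 2^-1 - 2 * e.
have a4 : 4^-1 <= a by rewrite /a; lra.
have qub l : `|l| * m <= e -> f l <= n%:R * (l * S - a * l ^+ 2 * V2).
  move=> /quad[_]; rewrite ler_norml => /andP[_].
  have -> : n%:R * (l * S - a * l ^+ 2 * V2) = n%:R * (l * S - l ^+ 2 * V2 / 2) + 2 * e * l ^+ 2 * n%:R * V2.
    by rewrite /a; field.
  lra.
move=> l fl; rewrite -/(f l).
have [lm|lm] := leP (`|l| * m) e.
  apply: le_trans (qub _ lm) _.
  have -> : A / (2 - 8 * e) = n%:R * (S ^+ 2 / (4 * a * V2)).
    by rewrite /A /a; field; rewrite ?gt_eqF//=; lra.
  rewrite ler_pM2l// ler_pdivlMr; last by rewrite !mulr_gt0//; lra.
  rewrite -subr_ge0 (_ : _ - _ = (S - 2 * a * V2 * l) ^+ 2) ?sqr_ge0//; ring.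
apply: (@le_trans _ _ 0); last by rewrite divr_ge0//; lra.
have l0 : 0 < `|l| * m by exact: lt_trans lm.
(* A multiplier out of range is shrunk towards the origin until it reaches the boundary, where the
   quadratic bound is non-positive by the assumption on [S]. Concavity gives [t * f l <= f (t * l)],
   so [f l] is non-positive too. *)
pose t := e / (`|l| * m).
have t0 : 0 < t by exact: divr_gt0.
have t1 : t <= 1 by rewrite ler_pdivrMr// mul1r ltW.
rewrite -(pmulr_rle0 _ t0).
apply: (@le_trans _ _ (f (t * l))).
  rewrite mulr_sumr; apply: ler_sum => k _; rewrite -mulrA ln_concave01// ?fl//.
  by rewrite (ltW t0).
have tlm : `|t * l| * m = e.
  by rewrite normrM (gtr0_norm t0) -mulrA divfK// gt_eqF.
have tl : `|t * l| = e / m by rewrite -tlm mulfK// gt_eqF.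
apply: le_trans (qub _ _) _; first by rewrite tlm.
rewrite pmulr_rle0// subr_le0; apply: (@le_trans _ _ (e / m * `|S|)).
  by rewrite -tl -normrM ler_norm.
rewrite -[(t * l) ^+ 2]real_normK ?num_real// tl.
rewrite (_ : a * _ * _ = e / m * (a * e * V2 / m)); last by field; rewrite gt_eqF.
rewrite ler_pM2l ?divr_gt0// ler_pdivlMr//; apply: le_trans hS _.
by rewrite ler_pM2r//; nra.
Qed.

(** The upper bound on the dual objective holds at every feasible multiplier, so near-optimality of
    the dual forces the ratio above a positive exponential. That the constraints can be met is thus
    a consequence, obtained without looking at the signs of [V]. *)
Lemma EL_ratio_bounds n (V : 'I_n -> R) (S V2 m e : R) : (0 < n)%N ->
  S = (\sum_k V k) / n%:R -> V2 = (\sum_k V k ^+ 2) / n%:R -> 0 < V2 ->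
  0 < m -> (forall k, `|V k| <= m) -> 0 < e <= 8^-1 -> `|S| * m <= e / 4 * V2 ->
  [/\ 0 < EL_ratio V,
    n%:R * S ^+ 2 / V2 * (1 - 4 * e) <= - 2 * ln (EL_ratio V) &
    - 2 * ln (EL_ratio V) <= n%:R * S ^+ 2 / V2 / (1 - 4 * e)].
Proof.
move=> n0 SE V2E V20 m0 Vm e01 hS.
have [[l fl hl] hub] := EL_dual_quadratic_bounds n0 SE V2E V20 m0 Vm e01 hS.
move: (e01) => /andP[e0 e1].
set A := n%:R * S ^+ 2 / V2 in hl hub *.
have hge : expR (- (A / (2 - 8 * e))) <= EL_ratio V.
  rewrite leNgt; apply/negP => /(EL_dual_close n0)[l' fl'].
  rewrite -[X in X < _]lnK ?posrE ?EL_dual_gt0// ltr_expR ln_EL_dual// ltrN2.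
  by rewrite ltNge hub.
have EL0 : 0 < EL_ratio V by apply: lt_le_trans hge; exact: expR_gt0.
split => //.
  have : ln (EL_ratio V) <= ln (EL_dual V l).
    by rewrite ler_ln ?posrE ?EL_dual_gt0// EL_ratio_le_dual.
  by rewrite ln_EL_dual//; lra.
have : - (A / (2 - 8 * e)) <= ln (EL_ratio V).
  by rewrite -[leLHS]expRK ler_ln ?posrE ?expR_gt0.
have -> : A / (1 - 4 * e) = 2 * (A / (2 - 8 * e)) by field; lra.
lra.
Qed.

(* Rational multipliers make the sublevel sets of the ratio countable unions. *)
Lemma EL_dual_close_rat n (V : 'I_n -> R) (c : R) : (0 < n)%N -> EL_ratio V < c ->
  exists2 q : rat, EL_dual_feasible V (ratr q) & EL_dual V (ratr q) < c.
Proof.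
move=> n0 /(EL_dual_close n0)[l fl hl].
have cf (k : 'I_n) : (1 + x * V k) @[x --> l] --> 1 + l * V k.
  by apply: cvgD; [exact: cvg_cst|apply: cvgM; [exact: cvg_id|exact: cvg_cst]].
have cd : EL_dual V x @[x --> l] --> EL_dual V l.
  apply: cvg_big => [|k _]; first exact: mul_continuous.
  by apply: cvgV; [rewrite gt_eqF|].
have : \forall x \near l, EL_dual_feasible V x /\ EL_dual V x < c.
  near=> x; split; last by near: x; exact: (cvgr_lt _ cd).
  by near: x; apply: filter_forall => k; exact: (cvgr_gt _ (cf k)).
move=> /nbhs_ballP[e /= e0 he].
have [q] := @rat_in_itvoo R l (l + e) ltac:(by rewrite ltrDl).
rewrite in_itv /= => /andP[q1 q2].
have [|h1 h2] := he (ratr q); last by exists q.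
by rewrite /ball /= ltr0_norm; lra.
Unshelve. all: by end_near. Qed.

Lemma measurable_EL_ratio d (T : measurableType d) n (V : T -> 'I_n -> R) :
  (forall k, measurable_fun setT (fun w => V w k)) ->
  measurable_fun setT (fun w => EL_ratio (V w)).
Proof.
move=> mV.
have [n0|n0] := posnP n.
  (* Without observations the weights cannot sum to one, and the supremum is that of the empty
     set. *)
  have -> : (fun w => EL_ratio (V w)) = cst 0; last exact: measurable_cst.
  apply/funext => w; rewrite /EL_ratio (_ : _ `&` _ = set0) ?image_set0 ?sup0 ?mul0r//.
  apply/seteqP; split => // p [[_ +] _]; move: (V w) p; rewrite n0 => _ p.
  by rewrite big_ord0 => /esym/eqP; rewrite oner_eq0.
apply: (measurability (@RGenInftyO.G R)); first exact: RGenInftyO.measurableE.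
move=> _ [_ [c ->] <-]; rewrite setTI.
have mq (q : rat) k : measurable_fun setT (fun w => 1 + ratr q * V w k).
  by apply: measurable_funD => //; apply: measurable_funM.
(* One inclusion is the existence of rational near-optimal multipliers, the other is weak duality;
   the dual inequality is cleared of its inverse. *)
have -> : (fun w => EL_ratio (V w)) @^-1` `]-oo, c[%classic =
    \bigcup_(q : rat) ([set w | 1 < c * \prod_k (1 + ratr q * V w k)] `&`
      \bigcap_(k in [set: 'I_n]) [set w | 0 < 1 + ratr q * V w k]).
  apply/seteqP; split => w /=; rewrite in_itv /=.
    move=> /(EL_dual_close_rat n0)[q h1 h2]; exists q => //; split => /=; last by move=> k _; exact: h1.
    move: h2; rewrite /EL_dual prodfV => h2.
    have P0 : 0 < \prod_k (1 + ratr q * V w k) by apply: prodr_gt0.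
    by rewrite -ltr_pdivrMr// div1r.
  move=> [q _ [/= h1 h2]].
  have f1 : EL_dual_feasible (V w) (ratr q) by move=> k; exact: h2.
  apply: le_lt_trans (EL_ratio_le_dual n0 f1) _.
  have P0 : 0 < \prod_k (1 + ratr q * V w k) by apply: prodr_gt0.
  by rewrite /EL_dual prodfV -div1r ltr_pdivrMr.
apply: bigcupT_measurable_rat => q; apply: measurableI.
  rewrite -[X in measurable X]setTI.
  apply: (@measurable_fun_ltr _ _ _ setT (cst 1) (fun w => c * \prod_k (1 + ratr q * V w k)) _ _ measurableT [set true]) => //.
  by apply: measurable_funM => //; apply: measurable_prod => k _; exact: mq.
apply: fin_bigcap_measurable => [|k _]; first exact: finite_finset.
rewrite -[X in measurable X]setTI.
by apply: (@measurable_fun_ltr _ _ _ setT (cst 0) (fun w => 1 + ratr q * V w k) _ _ measurableT [set true]).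
Qed.

Lemma lneE_ge0 (x : R) : 0 <= x -> lne x%:E = if x == 0 then -oo%E else (ln x)%:E.
Proof.
by move=> x0; rewrite /lne le_eqVlt [x < 0]ltNge x0 orbF.
Qed.

Lemma measurable_lne_ge0 d (T : measurableType d) (f : T -> R) :
  (forall w, 0 <= f w) -> measurable_fun setT f ->
  measurable_fun setT (fun w => lne (f w)%:E).
Proof.
move=> f0 mf.
have -> : (fun w => lne (f w)%:E) = fun w => if f w == 0 then -oo%E else (ln (f w))%:E.
  by apply/funext => w; rewrite lneE_ge0.
apply: measurable_fun_ifT => //.
- by apply: measurable_fun_eqr.
- by apply/measurable_EFinP; apply: measurableT_comp => //; exact: measurable_ln.
Qed.

End EL.

(** * Overlaps of subsets and pseudo-values *)

Section counting.

(** Removing [D] is a bijection onto the subsets of its complement of size [v - #|D|]. *)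
Lemma card_sets_containing n v (D : {set 'I_n}) : (#|D| <= v)%N ->
  #|[set A : {set 'I_n} | (#|A| == v) && (D \subset A)]%SET| = 'C(n - #|D|, v - #|D|).
Proof.
move=> Dv.
have -> : [set A : {set 'I_n} | (#|A| == v) && (D \subset A)]%SET =
    ((fun B => D :|: B) @: [set B : {set 'I_n} | B \subset ~: D & #|B| == (v - #|D|)%N])%SET.
  apply/setP => A; rewrite inE; apply/andP/imsetP => [[/eqP Av DA]|[B]].
    exists (A :\: D)%SET.
      by rewrite inE finset.setDE finset.subsetIr /= -finset.setDE cardsD (finset.setIidPr DA) Av.
    by rewrite -[LHS](finset.setID A D) (finset.setIidPr DA).
  rewrite inE => /andP[BD /eqP Bv] ->; rewrite finset.subsetUl cardsU Bv.
  have -> : (D :&: B)%SET = finset.set0.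
    apply/setP => x; rewrite !inE; apply/negbTE/negP => /andP[xD /(fintype.subsetP BD)].
    by rewrite inE xD.
  by rewrite cards0 subn0 subnKC.
rewrite card_in_imset.
  by rewrite cards_draws cardsCs finset.setCK card_ord.
move=> B1 B2; rewrite !inE => /andP[h1 _] /andP[h2 _] /setP E; apply/setP => x.
have := E x; rewrite !inE; case: (boolP (x \in D)) => //= xD _.
by apply/idP/idP => [/(fintype.subsetP h1)|/(fintype.subsetP h2)]; rewrite inE xD.
Qed.

Lemma sum_sets1 n v (i : 'I_n) : (0 < v)%N ->
  (\sum_(A : {set 'I_n} | #|A| == v) (i \in A) = 'C(n.-1, v.-1))%N.
Proof.
move=> v0; have := @card_sets_containing n v [set i]%SET; rewrite cards1 !subn1 => <- //.
rewrite -sum1dep_card big_mkcondr; apply: eq_bigr => A _.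
by rewrite finset.sub1set; case: (i \in A).
Qed.

Lemma sum_sets2 n v (i j : 'I_n) : (1 < v)%N -> i != j ->
  (\sum_(A : {set 'I_n} | #|A| == v) (i \in A) * (j \in A) = 'C(n.-2, v.-2))%N.
Proof.
move=> v0 ij; have := @card_sets_containing n v [set i; j]%SET; rewrite cards2 ij !subn2 => <- //.
rewrite -sum1dep_card big_mkcondr; apply: eq_bigr => A _.
by rewrite finset.subUset !finset.sub1set; case: (i \in A); case: (j \in A).
Qed.

Lemma card_setI_sum n (A B : {set 'I_n}) :
  (#|A :&: B| = \sum_i (i \in A) * (i \in B))%N.
Proof.
rewrite -sum1_card big_mkcond; apply: eq_bigr => i _.
by rewrite inE; case: (i \in A); case: (i \in B).
Qed.

(** Ordered pairs of distinct common elements. This factorial count vanishes for overlaps of size at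
    most one, so it isolates the overlaps that the projection does not explain. *)
Lemma card_setI_pairs n (A B : {set 'I_n}) :
  (#|A :&: B| * (#|A :&: B|).-1 =
   \sum_i \sum_(j | j != i) (i \in A) * (j \in A) * ((i \in B) * (j \in B)))%N.
Proof.
rewrite -[X in (X * _)%N]sum1_card big_distrl /= big_mkcond; apply: eq_bigr => i _.
case: ifP => [iAB|]; last first.
  rewrite inE => h; rewrite big1// => j _; move: h.
  by case: (i \in A); case: (i \in B) => //; rewrite ?muln0.
rewrite mul1n (cardsD1 i) iAB add1n /= -sum1_card big_mkcond [RHS]big_mkcond.
apply: eq_bigr => j _; move: iAB; rewrite !inE => /andP[-> ->]; rewrite !mul1n.
by case: (j != i); case: (j \in A); case: (j \in B).
Qed.

Lemma sum_card_setI n v : (0 < v)%N ->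
  (\sum_(A : {set 'I_n} | #|A| == v) \sum_(B : {set 'I_n} | #|B| == v) #|A :&: B|
   = n * 'C(n.-1, v.-1) ^ 2)%N.
Proof.
move=> v0; under eq_bigr do under eq_bigr do rewrite card_setI_sum.
under eq_bigr do rewrite exchange_big /=.
rewrite exchange_big /= -[X in (X * _)%N]card_ord -sum_nat_const; apply: eq_bigr => i _.
under eq_bigr do rewrite -big_distrr /= sum_sets1//.
by rewrite -big_distrl /= sum_sets1// mulnn.
Qed.

Lemma sum_card_setI_pairs n v : (1 < v)%N ->
  (\sum_(A : {set 'I_n} | #|A| == v) \sum_(B : {set 'I_n} | #|B| == v) #|A :&: B| * (#|A :&: B|).-1
   = n * n.-1 * 'C(n.-2, v.-2) ^ 2)%N.
Proof.
move=> v1; under eq_bigr do under eq_bigr do rewrite card_setI_pairs.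
under eq_bigr do rewrite exchange_big /=.
rewrite exchange_big /= -mulnA -[X in (X * _)%N]card_ord -sum_nat_const; apply: eq_bigr => i _.
under eq_bigr do rewrite exchange_big /=.
rewrite exchange_big /= [X in (X * _)%N](_ : n.-1 = #|[set~ i]%SET|); last by rewrite cardsC1 card_ord.
rewrite -sum_nat_const; apply: eq_big => [j|j ji]; first by rewrite !inE.
under eq_bigr do rewrite -big_distrr /= sum_sets2 1?eq_sym//.
by rewrite -big_distrl /= sum_sets2 1?eq_sym// mulnn.
Qed.

(** Both subsets share [k]; the predecessor counts the further common elements. *)
Lemma sum_card_setI_through n v (k : 'I_n) : (1 < v)%N ->
  (\sum_(A : {set 'I_n} | (#|A| == v) && (k \in A)) \sum_(B : {set 'I_n} | (#|B| == v) && (k \in B)) (#|A :&: B|).-1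
   = n.-1 * 'C(n.-2, v.-2) ^ 2)%N.
Proof.
move=> v1.
transitivity (\sum_(A : {set 'I_n} | #|A| == v) \sum_(B : {set 'I_n} | #|B| == v)
   \sum_(j | j != k) (k \in A) * (j \in A) * ((k \in B) * (j \in B)))%N.
  rewrite big_mkcondr; apply: eq_bigr => A _; case: ifP => [kA|kA]; last first.
    by rewrite big1// => B _; rewrite big1// => j _; rewrite mul0n.
  rewrite big_mkcondr; apply: eq_bigr => B _; case: ifP => [kB|kB]; last first.
    by rewrite big1// => j _; rewrite mul0n muln0.
  rewrite (cardsD1 k) inE kA kB add1n /= -sum1_card big_mkcond [RHS]big_mkcond.
  apply: eq_bigr => j _; rewrite !inE !mul1n.
  by case: (j != k); case: (j \in A); case: (j \in B).
under eq_bigr do rewrite exchange_big /=.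
rewrite exchange_big /= [X in (X * _)%N](_ : n.-1 = #|[set~ k]%SET|); last by rewrite cardsC1 card_ord.
rewrite -sum_nat_const; apply: eq_big => [j|j ji]; first by rewrite !inE.
under eq_bigr do rewrite -big_distrr /= sum_sets2 1?eq_sym//.
by rewrite -big_distrl /= sum_sets2 1?eq_sym// mulnn.
Qed.

End counting.

(** * Pseudo-values as combinations of kernel sums *)

Section pseudo.
Context {R : realType}.
Variables (v : nat) (h : seq R -> R).
Hypothesis hsym : forall s t, perm_eq s t -> h s = h t.

Definition Ukernel n (x : 'I_n -> R) (A : {set 'I_n}) := h [seq x i | i <- enum A].

Definition Usum n (x : 'I_n -> R) := \sum_(A : {set 'I_n} | #|A| == v) Ukernel x A.

(** The part of the kernel sum that is lost when observation [k] is deleted. *)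
Definition Usum_through n (x : 'I_n -> R) k :=
  \sum_(A : {set 'I_n} | (#|A| == v) && (k \in A)) Ukernel x A.

(** The subsets of the reduced sample are carried by [lift k] onto those avoiding [k]. Symmetry of
    [h] makes the order in which [enum] lists the image immaterial. *)
Lemma Usum_lift n (x : 'I_n.+1 -> R) k :
  Usum (x \o lift k) = Usum x - Usum_through x k.
Proof.
rewrite [in RHS]/Usum (bigID (fun A : {set 'I_n.+1} => k \in A)) /= addrAC subrr add0r.
rewrite (reindex_onto (fun A : {set 'I_n} => lift k @: A) (fun B => lift k @^-1: B)) /=; last first.
  move=> B /andP[_ kB]; apply/setP => i; apply/imsetP/idP => [[j + ->]|iB]; first by rewrite inE.
  case: (unliftP k i) => [j Ej|Ei]; last by rewrite -Ei iB in kB.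
  by exists j => //; rewrite inE -Ej.
apply: eq_big => [A|A _].
  rewrite card_imset; last exact: lift_inj.
  rewrite (_ : k \notin _); last by apply/imsetP => -[j _ /eqP]; rewrite (negbTE (neq_lift _ _)).
  rewrite andbT (_ : _ == A) ?andbT//; apply/eqP/setP => i.
  by rewrite inE mem_imset//; exact: lift_inj.
apply: hsym; rewrite [X in perm_eq X _](_ : _ = map x (map (lift k) (enum A))); last by rewrite -map_comp.
apply: perm_map; apply: uniq_perm; rewrite ?map_inj_uniq ?enum_uniq//; first exact: lift_inj.
move=> i; rewrite mem_enum; apply/mapP/imsetP => -[j]; first by rewrite mem_enum; exists j.
by move=> jA ->; exists j => //; rewrite mem_enum.
Qed.

Lemma sum_Usum_through n (x : 'I_n -> R) : \sum_k Usum_through x k = v%:R * Usum x.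
Proof.
rewrite /Usum_through; under eq_bigr do rewrite big_mkcondr /=.
rewrite exchange_big /= /Usum mulr_sumr; apply: eq_bigr => A /eqP Av.
by rewrite -big_mkcond /= sumr_const Av mulr_natl.
Qed.

(** The identity [n.+1 * 'C(n, v) = (n.+1 - v) * 'C(n.+1, v)] puts the full and the reduced
    statistic over the common denominator ['C(n, v)]. *)
Lemma pseudo_valueE n (x : 'I_n.+1 -> R) k : (v <= n)%N ->
  pseudo_value v h x k =
  (n%:R * Usum_through x k - (v%:R - 1) * Usum x) / 'C(n, v)%:R.
Proof.
move=> vn; rewrite /pseudo_value /Ustat -/(Ukernel _ _) -!/(Usum _) Usum_lift.
have C1 : 'C(n, v)%:R != 0 :> R by rewrite pnatr_eq0 -lt0n bin_gt0.
have C2 : 'C(n.+1, v)%:R != 0 :> R by rewrite pnatr_eq0 -lt0n bin_gt0 ltnW// ltnS.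
have E : n.+1%:R * 'C(n, v)%:R = (n.+1%:R - v%:R) * 'C(n.+1, v)%:R :> R.
  by rewrite -natrB ?(leq_trans vn)// -!natrM; congr (_%:R); rewrite -mul_bin_down.
have -> : n.+1%:R * ('C(n.+1, v)%:R^-1 * Usum x) = (n.+1%:R - v%:R) * Usum x / 'C(n, v)%:R.
  apply: (mulIf C1); rewrite divfK// mulrAC -mulrA mulrA.
  rewrite (_ : n.+1%:R * _ * _ = n.+1%:R * 'C(n, v)%:R * (Usum x / 'C(n.+1, v)%:R)); last by ring.
  by rewrite E; field.
by rewrite /= -natr1; field.
Qed.

(** The pseudo-values average exactly to the statistic because each [v]-subset is counted once for
    each of its elements; no bias term enters the numerator of the expansion. *)
Lemma mean_pseudo_value n (x : 'I_n.+1 -> R) : (v <= n)%N ->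
  (\sum_k pseudo_value v h x k) / n.+1%:R = Ustat v h x.
Proof.
move=> vn; under eq_bigr do rewrite pseudo_valueE//.
have C1 : 'C(n, v)%:R != 0 :> R by rewrite pnatr_eq0 -lt0n bin_gt0.
have C2 : 'C(n.+1, v)%:R != 0 :> R by rewrite pnatr_eq0 -lt0n bin_gt0 ltnW// ltnS.
have E : n.+1%:R * 'C(n, v)%:R = (n.+1%:R - v%:R) * 'C(n.+1, v)%:R :> R.
  by rewrite -natrB ?(leq_trans vn)// -!natrM; congr (_%:R); rewrite -mul_bin_down.
have N0 : n.+1%:R != 0 :> R by rewrite pnatr_eq0.
rewrite -mulr_suml sumrB -mulr_sumr sum_Usum_through sumr_const card_ord.
rewrite -[_ *+ n.+1]mulr_natl /Ustat -/(Usum x).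
have -> : 'C(n.+1, v)%:R^-1 = (n.+1%:R - v%:R) / (n.+1%:R * 'C(n, v)%:R) :> R.
  by apply: (mulIf C2); rewrite mulVf// mulrAC -E divff// mulf_neq0.
by move: N0; rewrite -natr1 => N0; field; rewrite N0 C1.
Qed.

End pseudo.

(** * Expectation and independence *)

Lemma measurable_preimage d1 d2 (T1 : measurableType d1) (T2 : measurableType d2) (f : T1 -> T2) B :
  measurable_fun [set: T1] f -> measurable B -> measurable (f @^-1` B).
Proof. by move=> mf mB; rewrite -[X in measurable X]setTI; exact: mf. Qed.

Section sublevel_sets.
Context {d : measure_display} {T : measurableType d} {R : realType} (f : T -> R).
Hypothesis mf : measurable_fun [set: T] f.

Lemma measurable_sublevel c : measurable [set w | f w <= c].
Proof.
have := measurable_preimage mf (measurable_itv `]-oo, c]).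
by congr (measurable _); apply/seteqP; split => w /=; rewrite in_itv.
Qed.

Lemma measurable_strict_sublevel c : measurable [set w | f w < c].
Proof.
have := measurable_preimage mf (measurable_itv `]-oo, c[).
by congr (measurable _); apply/seteqP; split => w /=; rewrite in_itv.
Qed.

Lemma measurable_superlevel c : measurable [set w | c <= f w].
Proof.
have := measurable_preimage mf (measurable_itv `[c, +oo[).
by congr (measurable _); apply/seteqP; split => w /=; rewrite in_itv /= andbT.
Qed.

End sublevel_sets.

Section L1L2.
Context {d : measure_display} {T : measurableType d} {R : realType}.
Variable mu : probability T R.
Implicit Types (f g : T -> R) (c : R).

Definition L1 f : Prop := mu.-integrable [set: T] (EFin \o f).
Definition L2 f : Prop := measurable_fun [set: T] f /\ L1 (fun x => f x ^+ 2).
(** The expectation as a real number. It represents the extended integral only for integrable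
    functions, hence the [L1] side conditions of the linearity rules. *)
Definition Ex f : R := Rintegral mu [set: T] f.

Lemma L1_measurable f : L1 f -> measurable_fun [set: T] f.
Proof. by move=> /integrableP[/measurable_EFinP]. Qed.

Lemma L1_ext f g : f =1 g -> L1 f -> L1 g.
Proof. by move=> /funext ->. Qed.

Lemma L1_dom f g : measurable_fun [set: T] f -> (forall x, `|f x| <= g x) -> L1 g -> L1 f.
Proof.
move=> mf fg; apply: le_integrable => //; first exact/measurable_EFinP.
by move=> x _ /=; rewrite lee_fin; apply: le_trans (fg x) _; exact: ler_norm.
Qed.

Lemma L1_cst c : L1 (cst c).
Proof. by apply: finite_measure_integrable_cst. Qed.

Lemma L1_bounded f c : measurable_fun [set: T] f -> (forall x, `|f x| <= c) -> L1 f.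
Proof. by move=> mf fc; apply: (L1_dom mf fc); exact: L1_cst. Qed.

Lemma L1D f g : L1 f -> L1 g -> L1 (fun x => f x + g x).
Proof. by move=> lf lg; have := integrableD measurableT lf lg. Qed.

Lemma L1Z c f : L1 f -> L1 (fun x => c * f x).
Proof. by move=> lf; have := integrableZl measurableT c lf. Qed.

Lemma L1B f g : L1 f -> L1 g -> L1 (fun x => f x - g x).
Proof. by move=> lf lg; have := integrableB measurableT lf lg. Qed.

Lemma L1_norm f : L1 f -> L1 (fun x => `|f x|).
Proof.
move=> lf; apply: (L1_dom (g := fun x => `|f x|)) => [|x|].
- by apply: measurableT_comp => //; exact: L1_measurable.
- by rewrite normr_id.
- by have := integrable_abse lf.
Qed.

Lemma L1_sum (I : Type) (s : seq I) (Q : pred I) (f : I -> T -> R) : (forall i, Q i -> L1 (f i)) ->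
  L1 (fun x => \sum_(i <- s | Q i) f i x).
Proof.
move=> lf; elim: s => [|i s IH].
  by apply: (L1_ext _ (L1_cst 0)) => x; rewrite /= big_nil.
case: (boolP (Q i)) => Qi.
  by apply: (L1_ext _ (L1D (lf i Qi) IH)) => x; rewrite /= big_cons Qi.
by apply: (L1_ext _ IH) => x; rewrite /= big_cons (negbTE Qi).
Qed.

Lemma Ex_cst c : Ex (cst c) = c.
Proof. by rewrite /Ex /Rintegral /= integral_cst//= probability_setT mule1. Qed.

Lemma ExD f g : L1 f -> L1 g -> Ex (fun x => f x + g x) = Ex f + Ex g.
Proof. by move=> lf lg; rewrite /Ex RintegralD. Qed.

Lemma ExB f g : L1 f -> L1 g -> Ex (fun x => f x - g x) = Ex f - Ex g.
Proof. by move=> lf lg; rewrite /Ex RintegralB. Qed.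

Lemma ExZ c f : L1 f -> Ex (fun x => c * f x) = c * Ex f.
Proof. by move=> lf; rewrite /Ex RintegralZl. Qed.

Lemma Ex_sum (I : Type) (s : seq I) (Q : pred I) (f : I -> T -> R) : (forall i, Q i -> L1 (f i)) ->
  Ex (fun x => \sum_(i <- s | Q i) f i x) = \sum_(i <- s | Q i) Ex (f i).
Proof.
move=> lf; elim: s => [|i s IH].
  by rewrite big_nil -[RHS](Ex_cst 0); congr Ex; apply/funext => x; rewrite big_nil.
rewrite big_cons -IH; case: (boolP (Q i)) => Qi.
  have ls := L1_sum s lf; rewrite -(ExD (lf i Qi) ls).
  by congr Ex; apply/funext => x; rewrite big_cons Qi.
by congr Ex; apply/funext => x; rewrite big_cons (negbTE Qi).
Qed.

Lemma Ex_le f g : L1 f -> L1 g -> (forall x, f x <= g x) -> Ex f <= Ex g.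
Proof. by move=> lf lg fg; apply: le_Rintegral. Qed.

Lemma Ex_ge0 f : (forall x, 0 <= f x) -> 0 <= Ex f.
Proof. by move=> f0; apply: Rintegral_ge0. Qed.

Lemma Ex_norm f : L1 f -> `|Ex f| <= Ex (fun x => `|f x|).
Proof. by move=> lf; apply: le_normr_Rintegral. Qed.

Lemma Ex_EFin f : L1 f -> (Ex f)%:E = (\int[mu]_x (f x)%:E)%E.
Proof. by move=> lf; rewrite fineK//; exact: integrable_fin_num. Qed.

Lemma L2M f g : L2 f -> L2 g -> L1 (fun x => f x * g x).
Proof.
move=> [mf lf] [mg lg]; apply: (L1_dom (g := fun x => f x ^+ 2 + g x ^+ 2)).
- exact: measurable_funM.
- move=> x; rewrite ler_norml; apply/andP; split; nra.
- exact: L1D.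
Qed.

Lemma L2_cst c : L2 (cst c).
Proof. by split; [exact: measurable_cst|exact: (L1_cst (c ^+ 2))]. Qed.

Lemma L2_L1 f : L2 f -> L1 f.
Proof.
move=> lf; apply: (L1_ext _ (L2M lf (L2_cst 1))) => x.
by rewrite /= mulr1.
Qed.

Lemma L2Z c f : L2 f -> L2 (fun x => c * f x).
Proof.
move=> [mf lf]; split; first exact: measurable_funM.
by apply: (L1_ext _ (L1Z (c ^+ 2) lf)) => x; rewrite /= exprMn.
Qed.

Lemma L2D f g : L2 f -> L2 g -> L2 (fun x => f x + g x).
Proof.
move=> lf lg; have [mf sf] := lf; have [mg sg] := lg.
split; first exact: measurable_funD.
apply: (L1_ext _ (L1D (L1D sf (L1Z 2 (L2M lf lg))) sg)) => x.
by rewrite /=; ring.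
Qed.

Lemma L2B f g : L2 f -> L2 g -> L2 (fun x => f x - g x).
Proof.
move=> lf lg; have := L2D lf (L2Z (-1) lg).
by congr L2; apply/funext => x; rewrite mulN1r.
Qed.

Lemma L2_sum (I : Type) (s : seq I) (Q : pred I) (f : I -> T -> R) : (forall i, Q i -> L2 (f i)) ->
  L2 (fun x => \sum_(i <- s | Q i) f i x).
Proof.
move=> lf; elim: s => [|i s IH].
  rewrite (_ : (fun _ => _) = cst 0); first exact: L2_cst.
  by apply/funext => x; rewrite big_nil.
rewrite (_ : (fun _ => _) = fun x => (if Q i then f i x else 0) + \sum_(j <- s | Q j) f j x).
  by apply: L2D => //; case: (boolP (Q i)) => Qi; [exact: lf|exact: L2_cst].
by apply/funext => x; rewrite big_cons; case: ifP; rewrite ?add0r.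
Qed.

Lemma markov_L1 f (e : R) : L1 f -> (forall x, 0 <= f x) -> 0 < e ->
  (mu [set x | (e <= f x)%R] <= (Ex f / e)%:E)%E.
Proof.
move=> lf f0 e0.
have := @le_integral_abse _ _ _ mu setT measurableT (EFin \o f) e _ e0.
rewrite setTI => /(_ _)/wrap[|h]; first by apply/measurable_EFinP; exact: L1_measurable.
rewrite EFinM lee_pdivlMr// muleC.
move: h; rewrite (_ : [set x | _] = [set x | (e <= f x)%R]); last first.
  by apply/seteqP; split => x /=; rewrite lee_fin ger0_norm.
move=> /le_trans; apply; rewrite Ex_EFin//.
by under eq_integral do rewrite /= ger0_norm//.
Qed.

End L1L2.

(** * Independence of functions of disjoint groups of observations *)

Section independence.
Context {d : measure_display} {T : measurableType d} {R : realType}.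
Variable P : probability T R.

Definition indep_fun d1 d2 (E1 : measurableType d1) (E2 : measurableType d2)
   (U : T -> E1) (V : T -> E2) : Prop :=
  forall A B, measurable A -> measurable B ->
  P (U @^-1` A `&` V @^-1` B) = (P (U @^-1` A) * P (V @^-1` B))%E.

(** Dynkin's argument: the restriction of [P] to [B] and the multiple of [P] by [P B] are finite
    measures that agree on a generating class stable under intersection. *)
Lemma indep_setsystem_left (G : set (set T)) (B : set T) :
  G `<=` measurable -> setI_closed G -> G setT -> measurable B ->
  (forall A, G A -> P (A `&` B) = (P A * P B)%E) ->
  forall A, <<s G >> A -> P (A `&` B) = (P A * P B)%E.
Proof.
move=> Gm GI GT mB h A sA.
have Bfin : P B \is a fin_num by exact: fin_num_measure.
have B0 : 0 <= fine (P B) by exact: fine_ge0.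
pose m1 := mrestr P mB.
pose m2 := mscale (NngNum B0) P.
have H : m1 A = m2 A.
  apply: (@g_sigma_algebra_measure_unique _ R T G Gm (fun=> setT) (fun=> GT) _ m1 m2 GI _ _ A sA).
  - by apply/seteqP; split => // x _; exists 0%N.
  - by move=> C GC; change (P (C `&` B) = (fine (P B))%:E * P C)%E; rewrite fineK// h// muleC.
  - move=> _; change (P (setT `&` B) < +oo)%E; by rewrite setTI ltey_eq Bfin.
change (P (A `&` B) = (fine (P B))%:E * P A)%E in H; by rewrite H fineK// muleC.
Qed.

Lemma indep_setsystem (G1 G2 : set (set T)) :
  G1 `<=` measurable -> setI_closed G1 -> G1 setT ->
  G2 `<=` measurable -> setI_closed G2 -> G2 setT ->
  (forall A B, G1 A -> G2 B -> P (A `&` B) = (P A * P B)%E) ->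
  forall A B, <<s G1 >> A -> <<s G2 >> B -> P (A `&` B) = (P A * P B)%E.
Proof.
move=> m1 I1 T1 m2 I2 T2 h A B sA sB.
have mB : measurable B by apply: (smallest_sub (@sigma_algebra_measurable _ T) m2).
apply: (indep_setsystem_left m1) => // C GC.
have mC : measurable C by exact: m1.
rewrite setIC muleC; apply: (indep_setsystem_left m2) => // D GD.
by rewrite setIC muleC; exact: h.
Qed.

Variable Xs : nat -> {RV P >-> R}.
Hypothesis hindep : mutually_independent Xs.

(** Events bearing on all coordinates of [J] at once, rather than on single ones, so that the class
    is stable under intersection. Only the values of [B] on [J] matter. *)
Definition block_events (J : seq nat) : set (set T) :=
  [set A | exists2 B : nat -> set R, (forall j, measurable (B j)) &
    A = \bigcap_(j in [set` J]) (Xs j @^-1` B j)].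

(* The sigma-algebra generated by the [Xs j] with [j] in [J]. *)
Definition block_space (J : seq nat) := g_sigma_algebraType (block_events J).

Lemma block_events_measurable J : block_events J `<=` measurable.
Proof.
move=> _ [B mB ->]; apply: fin_bigcap_measurable => [|j _]; first exact: finite_seq.
exact: measurable_preimage.
Qed.

Lemma block_eventsI J : setI_closed (block_events J).
Proof.
move=> _ _ [B1 m1 ->] [B2 m2 ->]; exists (fun j => B1 j `&` B2 j).
  by move=> j; exact: measurableI.
by rewrite -bigcapI; apply: eq_bigcapr => j _; rewrite preimage_setI.
Qed.

Lemma block_eventsT J : block_events J setT.
Proof.
exists (fun=> setT) => //.
by apply/seteqP; split => // x _ j _.
Qed.

Lemma block_events_indep J K A B : uniq (J ++ K) -> block_events J A -> block_events K B ->
  P (A `&` B) = (P A * P B)%E.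
Proof.
move=> JK [B1 m1 ->] [B2 m2 ->].
move: (JK); rewrite cat_uniq => /and3P[uJ /hasPn JKd uK].
have [h1 h2] : uniq J /\ uniq K by [].
rewrite (hindep h1 m1) (hindep h2 m2).
(* A single family of Borel sets, taken from the first on [J] and from the second elsewhere, so that
   mutual independence applies to the concatenation. *)
pose B3 j := if j \in J then B1 j else B2 j.
have m3 j : measurable (B3 j) by rewrite /B3; case: ifP.
transitivity (P (\bigcap_(j in [set` J ++ K]) (Xs j @^-1` B3 j))).
  congr (P _); apply/seteqP; split => w.
    move=> [wJ wK] j /=; rewrite mem_cat /B3 => jJK; case: ifP => jJ; first exact: wJ.
    by apply: wK; move: jJK; rewrite /= jJ.
  move=> h; split => j /= jJ.
    by have := h j; rewrite /= mem_cat /B3 jJ; apply.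
  have := h j; rewrite /= mem_cat /B3 jJ orbT (negbTE (JKd _ jJ)).
  exact.
rewrite (hindep JK m3) big_cat /=; congr (_ * _)%E.
  by apply: eq_big_seq => j jJ; rewrite /B3 jJ.
by apply: eq_big_seq => j jK; rewrite /B3 (negbTE (JKd _ jK)).
Qed.

(** Later independence claims reduce to measurability with respect to the sigma-algebras of two
    disjoint blocks, which is checked by composition. *)
Lemma block_indep d1 d2 (E1 : measurableType d1) (E2 : measurableType d2) J K
   (U : T -> E1) (V : T -> E2) : uniq (J ++ K) ->
  measurable_fun [set: block_space J] (U : block_space J -> E1) ->
  measurable_fun [set: block_space K] (V : block_space K -> E2) ->
  indep_fun U V.
Proof.
move=> JK mU mV A B mA mB.
apply: (@indep_setsystem (block_events J) (block_events K)).
- exact: block_events_measurable.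
- exact: block_eventsI.
- exact: block_eventsT.
- exact: block_events_measurable.
- exact: block_eventsI.
- exact: block_eventsT.
- by move=> A' B'; exact: block_events_indep.
- by have := mU measurableT A mA; rewrite setTI.
- by have := mV measurableT B mB; rewrite setTI.
Qed.

Lemma block_measurable d1 (E1 : measurableType d1) J (U : T -> E1) :
  measurable_fun [set: block_space J] (U : block_space J -> E1) ->
  measurable_fun [set: T] U.
Proof.
move=> mU _ B mB.
apply: (smallest_sub (@sigma_algebra_measurable _ T) (@block_events_measurable J)).
exact: mU measurableT B mB.
Qed.

Lemma block_coord J j : j \in J ->
  measurable_fun [set: block_space J] (Xs j : block_space J -> R).
Proof.
move=> jJ _ B mB; rewrite setTI; apply: sub_sigma_algebra.
exists (fun i => if i == j then B else setT) => [i|]; first by case: ifP.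
apply/seteqP; split => w /=.
  by move=> h i /= iJ; case: eqP => [->|].
by move=> /(_ j jJ); rewrite /= eqxx.
Qed.

End independence.

Section indep_integral.
Context {d d1 d2 : measure_display} {T : measurableType d} {R : realType}.
Variable P : probability T R.
Variables (E1 : measurableType d1) (E2 : measurableType d2) (U : {mfun T >-> E1}) (V : {mfun T >-> E2}).
Hypothesis UV : indep_fun P U V.

Let W w := (U w, V w).

Let mW : measurable_fun [set: T] W.
Proof. by apply/measurable_fun_pairP; split; exact: measurable_funPT. Qed.

HB.instance Definition _ := isMeasurableFun.Build _ _ _ _ W mW.

Let joint_law : forall A, measurable A ->
  (distribution P U \x distribution P V)%E A = distribution P W A.
Proof. by apply: product_measure_unique => A B mA mB; exact: UV. Qed.

(** The freezing principle: by independence the joint law is the product of the marginal laws, so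
    Fubini applies there and is carried back to [T]. Integrability at every frozen value identifies
    the inner integral with an expectation pointwise. *)
Lemma indep_Rintegral (f : E1 * E2 -> R) : measurable_fun setT f ->
  L1 P (fun w => f (U w, V w)) ->
  (forall w, L1 P (fun w' => f (U w, V w'))) ->
  L1 P (fun w => Ex P (fun w' => f (U w, V w'))) /\
  Ex P (fun w => f (U w, V w)) = Ex P (fun w => Ex P (fun w' => f (U w, V w'))).
Proof.
move=> mf lf lfw.
have mef : measurable_fun setT (EFin \o f) by exact/measurable_EFinP.
have eW : (\int[distribution P W]_x (f x)%:E = \int[P]_w (f (U w, V w))%:E)%E.
  by rewrite (integral_distribution (X := W) (f := EFin \o f)).
have iW : (distribution P W).-integrable setT (EFin \o f).
  by apply: (integrable_pushforward mW).
have eJ (h : E1 * E2 -> \bar R) :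
    (\int[distribution P U \x distribution P V]_x h x = \int[distribution P W]_x h x)%E.
  by apply: eq_measure_integral => A mA _; exact: joint_law.
have ip : (distribution P U \x distribution P V)%E.-integrable setT (EFin \o f).
  by move/integrableP : iW => [_ iW]; apply/integrableP; split => //; rewrite eJ.
have EF w : (\int[distribution P V]_y (f (U w, y))%:E = \int[P]_w' (f (U w, V w'))%:E)%E.
  apply: (integral_distribution (X := V) (f := fun y => (f (U w, y))%:E)); last exact: lfw.
  exact: (measurableT_comp mef (measurable_pair1 (U w))).
have mF := measurable_fubini_F ip.
have iF := integrable_fubini_F ip.
have iFU : P.-integrable setT (fubini_F (distribution P V) (EFin \o f) \o U).
  apply/integrableP; split; first exact: measurableT_comp.
  move/integrableP : iF => [_]; rewrite ge0_integral_distribution//.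
  exact: measurableT_comp.
have FE w : (fubini_F (distribution P V) (EFin \o f) \o U) w = (Ex P (fun w' => f (U w, V w')))%:E.
  by rewrite /= /fubini_F EF Ex_EFin.
split; first by rewrite /L1 (_ : _ \o _ = fubini_F (distribution P V) (EFin \o f) \o U)//; apply/funext => w; rewrite FE.
rewrite {1}/Ex /Rintegral -eW -eJ -(integral12_prod_meas1 ip).
rewrite (integral_distribution (X := U))//.
by rewrite /Ex; congr fine; apply: eq_integral => w _; rewrite FE.
Qed.
End indep_integral.

(** * Central limit theorem *)

Section smooth_test_functions.
Context {R : realType}.

(** Mean value theorem. The constant is kept instead of being divided by [n.+1], which is why the
    later Taylor remainders carry no factorials. *)
Lemma derive_bound_pow (g h : R -> R) (M : R) n : g 0 = 0 -> 0 <= M ->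
  (forall x : R, is_derive x 1 g (h x)) -> (forall x, `|h x| <= M * `|x| ^+ n) ->
  forall x, `|g x| <= M * `|x| ^+ n.+1.
Proof.
move=> g0 M0 dg hM x.
have cg a b : {within `[a, b], continuous g}.
  by apply: derivable_within_continuous => y _; apply: ex_derive.
have key (c : R) : `|c| <= `|x| -> `|h c * x| <= M * `|x| ^+ n.+1.
  move=> cx; rewrite normrM exprSr mulrA ler_wpM2r//; apply: le_trans (hM c) _.
  by rewrite ler_wpM2l// lerXn2r// nnegrE.
have [x0|x0] := leP 0 x.
  have [c] := @MVT_segment R g h 0 x x0 (fun y _ => dg y) (cg 0 x).
  rewrite in_itv /= g0 !subr0 => /andP[c1 c2] ->.
  by rewrite key// !ger0_norm.
have [c] := @MVT_segment R g h x 0 (ltW x0) (fun y _ => dg y) (cg x 0).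
rewrite in_itv /= g0 !sub0r => /andP[c1 c2] E.
rewrite -normrN E mulrN normrN key//.
by rewrite !ler0_norm ?lerN2// ltW.
Qed.

(** Test functions for the replacement argument. The second derivative is Lipschitz and bounded,
    which gives two remainder bounds; values in the unit interval make measurable compositions
    integrable under any probability. *)
Record smooth_test (M : R) (f f1 f2 : R -> R) : Prop := SmoothTest {
  st_d1 : forall x : R, is_derive x 1 f (f1 x);
  st_d2 : forall x : R, is_derive x 1 f1 (f2 x);
  st_lip : forall x y, `|f2 x - f2 y| <= M * `|x - y|;
  st_bnd : forall x, `|f2 x| <= M;
  st_01 : forall x, 0 <= f x <= 1 }.

(** The cubic bound is meant for small increments, the quadratic one for large increments, where no
    third moment is available. *)
Lemma smooth_test_taylor M f f1 f2 : smooth_test M f f1 f2 -> forall u x,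
  `|f (u + x) - (f u + f1 u * x + f2 u / 2 * x ^+ 2)| <= M * `|x| ^+ 3 /\
  `|f (u + x) - (f u + f1 u * x + f2 u / 2 * x ^+ 2)| <= 2 * M * `|x| ^+ 2.
Proof.
move=> [d1 d2 lip bnd _] u x.
have M0 : 0 <= M by apply: le_trans (bnd 0); exact: normr_ge0.
have sh (k k1 : R -> R) : (forall x : R, is_derive x 1 k (k1 x)) -> forall y : R, is_derive y 1 (fun z => k (u + z)) (k1 (u + y)).
  move=> dk y.
  have h2 : is_derive y 1 (fun z : R => u + z) 1.
    by apply: is_derive_eq; rewrite add0r mulr1.
  by have := @is_derive1_comp R k (fun z : R => u + z) y _ _ (dk _) h2; rewrite mulr1.
pose r1 y := f1 (u + y) - (f1 u + f2 u * y).
pose r y := f (u + y) - (f u + f1 u * y + (f2 u / 2) * y ^+ 2).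
have dr1 (y : R) : is_derive y 1 r1 (f2 (u + y) - f2 u).
  have h1 := sh _ _ d2 y.
  have h2 : is_derive y 1 (fun z : R => f1 u + f2 u * z) (f2 u).
    by apply: is_derive_eq; rewrite /GRing.scale /=; ring.
  exact: is_deriveB.
have dr (y : R) : is_derive y 1 r (r1 y).
  have h1 := sh _ _ d1 y.
  have h2 : is_derive y 1 (fun z : R => f u + f1 u * z + (f2 u / 2) *: z ^+ 2) (f1 u + f2 u * y).
    by apply: is_derive_eq; rewrite /GRing.scale /=; field.
  exact: is_deriveB.
have r10 : r1 0 = 0 by rewrite /r1 addr0 mulr0 addr0 subrr.
have r0 : r 0 = 0 by rewrite /r addr0 expr0n /= !mulr0 !addr0 subrr.
have b1 y : `|f2 (u + y) - f2 u| <= M * `|y| ^+ 1.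
  by apply: le_trans (lip _ _) _; rewrite expr1 addrAC subrr add0r.
have b2 y : `|f2 (u + y) - f2 u| <= 2 * M * `|y| ^+ 0.
  rewrite expr0 mulr1 mulr_natl mulr2n; apply: le_trans (ler_normB _ _) _.
  exact: lerD.
have M20 : 0 <= 2 * M by rewrite mulr_ge0.
split.
- exact: (derive_bound_pow r0 M0 dr (derive_bound_pow r10 M0 dr1 b1)).
- exact: (derive_bound_pow r0 M20 dr (derive_bound_pow r10 M20 dr1 b2)).
Qed.

(** A smooth stand-in for the indicator of the negative half-line, whose derivatives are polynomials
    in itself. *)
Definition sigmoid (y : R) : R := (1 + expR y)^-1.

Lemma sigmoid_itv y : 0 < sigmoid y < 1.
Proof.
have e0 := expR_gt0 y; rewrite /sigmoid invr_gt0 addr_gt0//=.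
by rewrite invf_lt1 ?addr_gt0// ltrDl.
Qed.

Lemma is_derive_sigmoid (y : R) : is_derive y 1 sigmoid (- (sigmoid y * (1 - sigmoid y))).
Proof.
have e0 := expR_gt0 y.
have h : is_derive y 1 (fun z : R => 1 + expR z) (expR y).
  by have := @is_deriveD R R R (cst 1) expR y 1 0 (expR y) _ _; rewrite add0r; apply.
have e1 : 1 + expR y != 0 by rewrite gt_eqF// addr_gt0.
have := @is_deriveV R (fun z : R => 1 + expR z) y (expR y) 1 e1 h.
move=> h2; apply: (is_derive_eq h2); rewrite /sigmoid /GRing.scale /=.
by field.
Qed.

(** With [s] the rescaled sigmoid, each derivative is a power of [k] times a polynomial in [s] of
    absolute value at most one on the unit interval. The third derivative supplies the Lipschitz
    constant of the second. *)
Lemma sigmoid_scaled_test (k c : R) : 0 < k ->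
  exists M f1 f2, smooth_test M (fun y => sigmoid (k * (y - c))) f1 f2.
Proof.
move=> k0.
pose s y := sigmoid (k * (y - c)).
pose f1 y := - k * (s y * (1 - s y)).
pose f2 y := k ^+ 2 * (s y * (1 - s y) * (1 - 2 * s y)).
pose f3 y := - k ^+ 3 * (s y * (1 - s y) * (1 - 6 * s y + 6 * s y ^+ 2)).
have s01 y : 0 < s y < 1 by exact: sigmoid_itv.
have ds (y : R) : is_derive y 1 s (f1 y).
  have h : is_derive y 1 (fun z : R => k * (z - c)) k.
    by apply: is_derive_eq; rewrite /GRing.scale /=; ring.
  have := @is_derive1_comp R sigmoid (fun z : R => k * (z - c)) y _ _ (is_derive_sigmoid _) h.
  by rewrite (_ : _ * k = f1 y)// /f1 /s; ring.
have df1 (y : R) : is_derive y 1 f1 (f2 y).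
  have h := ds y; apply: is_derive_eq; rewrite /GRing.scale /= /f2 /f1; ring.
have df2 (y : R) : is_derive y 1 f2 (f3 y).
  have h := ds y; apply: is_derive_eq; rewrite /GRing.scale /= /f3 /f1; ring.
have b2 y : `|f2 y| <= k ^+ 2.
  rewrite /f2 normrM ger0_norm ?sqr_ge0// ler_piMr ?sqr_ge0//.
  by have /andP[] := s01 y; rewrite ler_norml => ? ?; apply/andP; split; nra.
have b3 y : `|f3 y| <= k ^+ 3.
  rewrite /f3 mulNr normrN normrM ger0_norm ?exprn_ge0 ?(ltW k0)// ler_piMr ?exprn_ge0 ?(ltW k0)//.
  have /andP[h1 h2] := s01 y.
  have q1 : s y * (1 - s y) <= 4^-1 by have := sqr_ge0 (s y - 2^-1); rewrite expr2; nra.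
  have q0 : 0 <= s y * (1 - s y) by nra.
  by rewrite ler_norml; apply/andP; split; nra.
exists (k ^+ 2 + k ^+ 3), f1, f2; split => //.
- move=> x y.
  have h (z : R) : is_derive z 1 (fun z => f2 (y + z) - f2 y) (f3 (y + z)).
    have h2 : is_derive z 1 (fun z : R => y + z) 1.
      by apply: is_derive_eq; rewrite add0r mulr1.
    have h3 := @is_derive1_comp R f2 (fun z : R => y + z) z _ _ (df2 _) h2.
    by apply: is_derive_eq; rewrite mulr1 subr0.
  have g0 : f2 (y + 0) - f2 y = 0 by rewrite addr0 subrr.
  have k3 : 0 <= k ^+ 3 by rewrite exprn_ge0// ltW.
  have hb z : `|f3 (y + z)| <= k ^+ 3 * `|z| ^+ 0 by rewrite mulr1.
  have := derive_bound_pow g0 k3 h hb (x - y).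
  rewrite expr1 [y + _]addrC subrK => h4; apply: le_trans h4 _.
  by rewrite ler_wpM2r// lerDr sqr_ge0.
- by move=> x; apply: le_trans (b2 x) _; rewrite lerDl exprn_ge0// ltW.
- by move=> x; have /andP[/ltW -> /ltW ->] := s01 x.
Qed.

Lemma continuous_sigmoid_scaled (k c : R) : 0 < k -> continuous (fun y => sigmoid (k * (y - c))).
Proof.
move=> k0 y; have [M [f1 [f2 [d1 _ _ _ _]]]] := sigmoid_scaled_test c k0.
by apply: differentiable_continuous; apply/derivable1_diffP; apply: ex_derive.
Qed.

End smooth_test_functions.

Section truncation.
Context {d : measure_display} {T : measurableType d} {R : realType}.
Variable mu : probability T R.

Lemma L1_tail (h : T -> R) (e : R) : L1 mu h -> (forall x, 0 <= h x) -> 0 < e ->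
  exists2 M : R, 0 < M & L1 mu (fun x => if M < h x then h x else 0) /\
     Ex mu (fun x => if M < h x then h x else 0) <= e.
Proof.
move=> lh h0 e0.
have mh := L1_measurable lh.
pose t n x := if n.+1%:R < h x then h x else 0.
have mt n : measurable_fun [set: T] (t n).
  by apply: measurable_fun_ifT => //; exact: measurable_fun_ltr.
have lt n : L1 mu (t n).
  by apply: (L1_dom _ _ lh) => // x; rewrite /t; case: ifP; rewrite ?normr0// ger0_norm.
have [_ _ /= cv] : [/\ mu.-integrable setT (cst 0%E), (\int[mu]_x `|(t n x)%:E - 0|)%E @[n --> \oo] --> 0%E &
    (\int[mu]_x (t n x)%:E)%E @[n --> \oo] --> (\int[mu]_x 0)%E].
  apply: (@dominated_convergence _ _ _ mu setT measurableT (fun n x => (t n x)%:E) (cst 0%E) (EFin \o h)) => //.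
  - by move=> n; exact/measurable_EFinP.
  - apply: aeW => x _; apply: cvg_near_cst; near=> n.
    rewrite /t ltNge; suff -> : h x <= n.+1%:R by [].
    apply: ltW; apply: lt_le_trans (archi_boundP (h0 x)) _; rewrite ler_nat.
    by apply: leqW; near: n; exact: nbhs_infty_ge.
  - by apply: aeW => x n _ /=; rewrite /t lee_fin; case: ifP; rewrite ?normr0// ger0_norm.
rewrite integral0 in cv.
move/fine_cvgP : cv => [_ /cvgrPdist_le/(_ e e0)[n _ /(_ n (leqnn n))]].
rewrite sub0r normrN => hn.
exists n.+1%:R => //; split; first exact: lt.
by apply: le_trans hn; rewrite ler_norm.
Unshelve. all: by end_near. Qed.

Lemma Ex_dist_le (A B : T -> R) (D : R) : L1 mu A -> L1 mu B -> (forall x, `|A x - B x| <= D) ->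
  `|Ex mu A - Ex mu B| <= D.
Proof.
move=> lA lB h; rewrite -ExB//; apply: le_trans (Ex_norm (L1B lA lB)) _.
rewrite -[leRHS](Ex_cst mu); apply: Ex_le => //; last exact: L1_cst.
by apply: L1_norm; exact: L1B.
Qed.

Lemma L1_01 (A : T -> R) : measurable_fun [set: T] A -> (forall x, 0 <= A x <= 1) -> L1 mu A.
Proof.
move=> mA A01; apply: (@L1_bounded _ _ _ _ _ 1) => // x.
by have /andP[h1 h2] := A01 x; rewrite ger0_norm.
Qed.

(* The mean of the second order Taylor polynomial of the test function only
   depends on the first two moments of [Y]. *)
Lemma smooth_test_expect (M : R) (f f1 f2 : R -> R) (u v : R) (Y b : T -> R) :
  smooth_test M f f1 f2 -> measurable_fun [set: R] f -> L2 mu Y -> Ex mu Y = 0 -> Ex mu (fun x => Y x ^+ 2) = v ->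
  L1 mu b -> (forall x, `|f (u + Y x) - (f u + f1 u * Y x + f2 u / 2 * Y x ^+ 2)| <= b x) ->
  `|Ex mu (fun x => f (u + Y x)) - (f u + f2 u / 2 * v)| <= Ex mu b.
Proof.
move=> [_ _ _ _ f01] mf LY EY EY2 lb hb.
have [mY lY2] := LY; have lY := L2_L1 LY.
have lq : L1 mu (fun x => f u + f1 u * Y x + f2 u / 2 * Y x ^+ 2).
  by apply: L1D; [apply: L1D; [exact: L1_cst|exact: L1Z]|exact: L1Z].
have lf : L1 mu (fun x => f (u + Y x)).
  apply: L1_01 => //; apply: (measurableT_comp mf); exact: measurable_funD.
have -> : f u + f2 u / 2 * v = Ex mu (fun x => f u + f1 u * Y x + f2 u / 2 * Y x ^+ 2).
  rewrite ExD; [|by apply: L1D; [exact: L1_cst|exact: L1Z]|exact: L1Z].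
  rewrite ExD; [|exact: L1_cst|exact: L1Z].
  by rewrite Ex_cst !ExZ// EY EY2 mulr0 addr0.
rewrite -ExB//; apply: le_trans (Ex_norm (L1B lf lq)) _.
by apply: Ex_le => //; apply: L1_norm; exact: L1B.
Qed.

End truncation.

Lemma Fubini_01 d1 d2 (T1 : measurableType d1) (T2 : measurableType d2) (R : realType)
  (mu : probability T1 R) (nu : probability T2 R) (F : T1 * T2 -> R) :
  measurable_fun [set: T1 * T2] F -> (forall z, 0 <= F z <= 1) ->
  [/\ L1 mu (fun x => Ex nu (fun y => F (x, y))), L1 nu (fun y => Ex mu (fun x => F (x, y))) &
   Ex mu (fun x => Ex nu (fun y => F (x, y))) = Ex nu (fun y => Ex mu (fun x => F (x, y)))].
Proof.
move=> mF F01.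
have mEF : measurable_fun [set: T1 * T2] (EFin \o F) by exact/measurable_EFinP.
have F0 z : (0 <= (EFin \o F) z)%E by rewrite lee_fin; have /andP[] := F01 z.
have l1 x : L1 nu (fun y => F (x, y)).
  by apply: L1_01 => //; apply: (measurableT_comp mF); exact: measurable_pair1.
have l2 y : L1 mu (fun x => F (x, y)).
  by apply: L1_01 => //; apply: (measurableT_comp mF); exact: measurable_pair2.
have e1 x : (Ex nu (fun y => F (x, y)))%:E = fubini_F nu (EFin \o F) x.
  by rewrite Ex_EFin.
have e2 y : (Ex mu (fun x => F (x, y)))%:E = fubini_G mu (EFin \o F) y.
  by rewrite Ex_EFin.
have m1 : measurable_fun [set: T1] (fun x => Ex nu (fun y => F (x, y))).
  apply/measurable_EFinP; rewrite (_ : _ \o _ = fubini_F nu (EFin \o F)); last by apply/funext => x; rewrite -e1.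
  exact: measurable_fun_fubini_tonelli_F.
have m2 : measurable_fun [set: T2] (fun y => Ex mu (fun x => F (x, y))).
  apply/measurable_EFinP; rewrite (_ : _ \o _ = fubini_G mu (EFin \o F)); last by apply/funext => x; rewrite -e2.
  exact: measurable_fun_fubini_tonelli_G.
have b1 x : 0 <= Ex nu (fun y => F (x, y)) <= 1.
  rewrite Ex_ge0 => [|y]; last by have /andP[] := F01 (x, y).
  rewrite -[leRHS](Ex_cst nu); apply: Ex_le => //; first exact: L1_cst.
  by move=> y; have /andP[] := F01 (x, y).
have b2 y : 0 <= Ex mu (fun x => F (x, y)) <= 1.
  rewrite Ex_ge0 => [|x]; last by have /andP[] := F01 (x, y).
  rewrite -[leRHS](Ex_cst mu); apply: Ex_le => //; first exact: L1_cst.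
  by move=> x; have /andP[] := F01 (x, y).
have L1a := L1_01 mu m1 b1; have L1b := L1_01 nu m2 b2.
split => //; apply: EFin_inj; rewrite !Ex_EFin//.
under eq_integral do rewrite e1.
under [RHS]eq_integral do rewrite e2.
exact: (fubini_tonelli (EFin \o F)).
Qed.

Section same_law.
Context {d : measure_display} {T : measurableType d} {R : realType}.
Variable P : probability T R.
Context {d1 : measure_display} {E : measurableType d1}.
Variables U V : {mfun T >-> E}.
Hypothesis UV : forall B, measurable B -> P (U @^-1` B) = P (V @^-1` B).

Lemma same_law_L1 (h : E -> R) : measurable_fun [set: E] h -> L1 P (h \o U) -> L1 P (h \o V).
Proof.
move=> mh /integrableP[_ hU]; apply/integrableP; split.
  by apply/measurable_EFinP; exact: measurableT_comp.
apply: le_lt_trans hU.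
have mah : measurable_fun [set: E] (fun x => `|(h x)%:E|%E).
  by apply: measurableT_comp => //; exact/measurable_EFinP.
rewrite -(@ge0_integral_distribution _ _ _ _ _ P V (fun x => `|(h x)%:E|%E))//.
rewrite -(@ge0_integral_distribution _ _ _ _ _ P U (fun x => `|(h x)%:E|%E))//.
rewrite le_eqVlt; apply/orP; left; apply/eqP.
by apply: eq_measure_integral => B mB _; rewrite /= /distribution /pushforward UV.
Qed.

Lemma same_law_Ex (h : E -> R) : measurable_fun [set: E] h -> L1 P (h \o U) ->
  Ex P (h \o U) = Ex P (h \o V).
Proof.
move=> mh lU; have lV := same_law_L1 mh lU.
have meh : measurable_fun [set: E] (EFin \o h) by exact/measurable_EFinP.
rewrite /Ex /Rintegral; congr fine.
rewrite -[LHS](@integral_distribution _ _ _ _ _ P U (EFin \o h))//.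
rewrite -[RHS](@integral_distribution _ _ _ _ _ P V (EFin \o h))//.
by apply: eq_measure_integral => B mB _; rewrite /= /distribution /pushforward UV.
Qed.
End same_law.

(** * Moments, convolution and small intervals of the normal law *)

Section gaussian.
Context {R : realType}.
Notation leb := (@lebesgue_measure R).

(** The Radon-Nikodym derivative of the normal law agrees almost everywhere with [normal_pdf], since
    both have the same integral over every measurable set. *)
Lemma ge0_integral_normal_prob (m s : R) (f : R -> \bar R) : measurable_fun [set: R] f ->
  (forall x, (0 <= f x)%E) ->
  (\int[normal_prob m s]_x f x = \int[leb]_x (f x * (normal_pdf m s x)%:E))%E.
Proof.
move=> mf f0.
have dom := @normal_prob_dominates R m s.
rewrite -(Radon_Nikodym_SigmaFinite.change_of_variables dom f0 measurableT mf).
apply: ae_eq_integral => //.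
- apply: emeasurable_funM => //; apply: (measurable_int leb).
  exact: Radon_Nikodym_SigmaFinite.f_integrable.
- apply: emeasurable_funM => //; apply/measurable_EFinP; exact: measurable_normal_pdf.
- apply: ae_eqe_mul2l.
  apply: integral_ae_eq => //.
  + exact: Radon_Nikodym_SigmaFinite.f_integrable.
  + by apply/measurable_EFinP; exact: measurable_normal_pdf.
  + move=> E _ mE; rewrite -(Radon_Nikodym_SigmaFinite.f_integral dom mE)//.
Qed.

Lemma ge0_integral_shift (G : R -> R) (c : R) : continuous G -> (forall x, 0 <= G x) ->
  (\int[leb]_x (G (x + c))%:E = \int[leb]_x (G x)%:E)%E.
Proof.
move=> cG G0.
have dE : (fun x : R => x + c)^`()%classic = cst 1.
  by apply/funext => x; rewrite derive1E deriveD// derive_id derive_cst addr0.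
rewrite [RHS](@increasing_ge0_integration_by_substitutionT R (fun x => x + c) G) ?dE//.
- by apply: eq_integral => x _; rewrite fctE mulr1.
- by move=> x y xy; rewrite ltrD2r.
- by move=> x; exact: cst_continuous.
- exact: is_cvg_cst.
- exact: is_cvg_cst.
- exact: cvg_addrr_Ny.
- exact: cvg_addrr.
Qed.

Lemma ge0_integral_reflect (f : R -> \bar R) : measurable_fun [set: R] f ->
  (forall x, (0 <= f x)%E) ->
  (\int[leb]_x f (- x)%R = \int[leb]_x f x)%E.
Proof.
have split0 (h : R -> \bar R) : measurable_fun [set: R] h -> (forall x, (0 <= h x)%E) ->
  (\int[leb]_x h x = \int[leb]_(x in `]-oo, 0%R]) h x + \int[leb]_(x in `]-oo, 0%R]) h (- x)%R)%E.
  move=> mh h0; rewrite -ge0_integration_by_substitution0//.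
  rewrite -integral_itv_obnd_cbnd; last exact: measurable_funTS.
  rewrite -ge0_integral_setU//=.
  - by rewrite -setCitvl setUv.
  - exact: measurable_funTS.
  - by apply/disj_setPS => x [/=]; rewrite !in_itv /= andbT => h1; rewrite ltNge h1.
move=> mf f0.
rewrite split0//; last by apply: measurableT_comp.
rewrite [RHS]split0// addeC; congr (_ + _)%E.
by apply: eq_integral => x _; rewrite opprK.
Qed.

(* The moments of the normal law are read off the integrals of [exp (c x^2)]. *)
Lemma normal_pdf_tilt (s q x : R) : s != 0 -> 0 < q ->
  expR ((1 - q ^+ 2) / (2 * s ^+ 2) * x ^+ 2) * normal_pdf 0 s x = q^-1 * normal_pdf 0 (s / q) x.
Proof.
move=> s0 q0; have sq0 : s / q != 0 by rewrite mulf_neq0// invr_neq0// gt_eqF.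
rewrite !normal_pdfE// /normal_fun mulrCA -expRD [RHS]mulrA; congr (_ * expR _).
  rewrite /normal_peak expr_div_n.
  have -> : s ^+ 2 / q ^+ 2 * pi *+ 2 = (q^-1) ^+ 2 * (s ^+ 2 * pi *+ 2).
    by move: (pi : R) => p; rewrite exprVn; ring.
  rewrite sqrtrM ?sqr_ge0// sqrtr_sqr gtr0_norm ?invr_gt0// invfM invrK mulrA mulVf ?mul1r//.
  by rewrite gt_eqF.
by rewrite !subr0; field; rewrite s0 gt_eqF.
Qed.

(** Tilting turns the density of deviation [s] into that of deviation [s / q], up to the factor
    [q^-1]. Every positive [q] is allowed, so the exponent may have either sign. *)
Lemma integral_normal_tilt (s q : R) : s != 0 -> 0 < q ->
  (\int[normal_prob 0 s]_x (expR ((1 - q ^+ 2) / (2 * s ^+ 2) * x ^+ 2))%:E = (q^-1)%:E)%E.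
Proof.
move=> s0 q0.
have mE : measurable_fun [set: R] (fun x : R => expR ((1 - q ^+ 2) / (2 * s ^+ 2) * x ^+ 2)).
  by apply: measurableT_comp => //; apply: measurable_funM => //.
rewrite ge0_integral_normal_prob//; last exact/measurable_EFinP.
under eq_integral do rewrite -EFinM normal_pdf_tilt// EFinM.
rewrite ge0_integralZl//.
- by rewrite integral_normal_pdf mule1.
- by apply/measurable_EFinP; exact: measurable_normal_pdf.
- by move=> x _; rewrite lee_fin normal_pdf_ge0.
- by rewrite lee_fin invr_ge0 ltW.
Qed.

Lemma L1_normal_tilt (s q : R) : s != 0 -> 0 < q ->
  L1 (normal_prob 0 s) (fun x => expR ((1 - q ^+ 2) / (2 * s ^+ 2) * x ^+ 2)).
Proof.
move=> s0 q0; apply/integrableP; split.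
  by apply/measurable_EFinP; apply: measurableT_comp => //; apply: measurable_funM.
under eq_integral do rewrite /= ger0_norm ?expR_ge0//.
by rewrite integral_normal_tilt// ltry.
Qed.

Lemma Ex_normal_tilt (s q : R) : s != 0 -> 0 < q ->
  Ex (normal_prob 0 s) (fun x => expR ((1 - q ^+ 2) / (2 * s ^+ 2) * x ^+ 2)) = q^-1.
Proof. by move=> s0 q0; rewrite /Ex /Rintegral integral_normal_tilt. Qed.

(** At [q = 1 / 2] the exponent is [w = 3 / 8 * y ^+ 2], with [y] the absolute value of [x] over
    [s]. Then [y ^+ 3 <= 1 + y ^+ 4]; the number [29 * (w / 2) ^+ 2] dominates [y ^+ 4] because
    [29 * 9 >= 256]; and the square of [w / 2] is at most [expR w]. *)
Lemma normal_cube_le_tilt (s x : R) : 0 < s ->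
  `|x| ^+ 3 <= s ^+ 3 * (1 + 29 * expR ((1 - 2^-1 ^+ 2) / (2 * s ^+ 2) * x ^+ 2)).
Proof.
move=> s0; set w := (_ * x ^+ 2).
pose y := `|x| / s.
have xE : `|x| = s * y by rewrite /y mulrC divfK// gt_eqF.
have y0 : 0 <= y by rewrite divr_ge0// ltW.
have wE : w = 3 / 8 * y ^+ 2.
  by rewrite /w -(real_normK (num_real x)) xE; field; rewrite gt_eqF.
have e2 : (w / 2) ^+ 2 <= expR w.
  have -> : expR w = expR (w / 2) ^+ 2 by rewrite expr2 -expRD -splitr.
  have w0 : 0 <= w / 2 by rewrite wE; nra.
  by rewrite ler_sqr ?nnegrE ?expR_ge0//; apply: le_trans (expR_ge1Dx _); lra.
rewrite xE exprMn ler_pM2l ?exprn_gt0//.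
apply: le_trans (_ : 1 + y ^+ 4 <= _); first by nra.
rewrite lerD2l; apply: le_trans (_ : 29 * (w / 2) ^+ 2 <= _); last by rewrite ler_pM2l.
by rewrite wE; nra.
Qed.

(** The tilt at [q = 1 / 2] has mean two, hence [59 = 1 + 29 * 2]. *)
Lemma L1_normal_cube (s : R) : 0 < s -> L1 (normal_prob 0 s) (fun x => `|x| ^+ 3) /\
  Ex (normal_prob 0 s) (fun x => `|x| ^+ 3) <= 59 * s ^+ 3.
Proof.
move=> s0; have s00 : s != 0 by rewrite gt_eqF.
have h0 : (0 : R) < 2^-1 by rewrite invr_gt0.
have lt := L1_normal_tilt s00 h0.
have l1 : L1 (normal_prob 0 s) (fun x => s ^+ 3 * (1 + 29 * expR ((1 - 2^-1 ^+ 2) / (2 * s ^+ 2) * x ^+ 2))).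
  by apply: L1Z; apply: L1D; [exact: L1_cst|exact: L1Z].
have l3 : L1 (normal_prob 0 s) (fun x => `|x| ^+ 3).
  apply: L1_dom l1.
    have mn : measurable_fun [set: R] (fun x : R => `|x| ^+ 3) by apply: measurable_funX; apply: (measurableT_comp (@normr_measurable R setT)).
    exact: mn.
  by move=> x; rewrite ger0_norm ?exprn_ge0//; exact: normal_cube_le_tilt.
split => //; apply: le_trans (Ex_le l3 l1 _) _; first by move=> x; exact: normal_cube_le_tilt.
rewrite ExZ; last by apply: L1D; [exact: L1_cst|exact: L1Z].
rewrite ExD ?Ex_cst; [|exact: L1_cst|exact: L1Z].
rewrite ExZ// Ex_normal_tilt// invrK mulrC ler_wpM2r ?exprn_ge0 ?(ltW s0)//; lra.
Qed.

Lemma L2_normal_id (s : R) : 0 < s -> L2 (normal_prob 0 s) id.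
Proof.
move=> s0; have [l3 _] := L1_normal_cube s0.
split; first exact: measurable_id.
apply: (@L1_dom _ _ _ (normal_prob 0 s) _ (fun x => 1 + `|(x : R)| ^+ 3)).
- by apply: measurable_funX.
- move=> x /=; rewrite normrX; have := normr_ge0 (x : R); set a := `|_| => a0.
  by have [a1|a1] := leP a 1; nra.
- by apply: L1D => //; exact: L1_cst.
Qed.

(** The tilt formula is differentiated by hand at [q = 1]: the linear lower bound of the exponential
    gives one inequality for [q = 1 - e] and the opposite one for [q = 1 + e], with [e] arbitrarily
    small. *)
Lemma Ex_normal_sqr (s : R) : 0 < s -> Ex (normal_prob 0 s) (fun x => x ^+ 2) = s ^+ 2.
Proof.
move=> s0; have s00 : s != 0 by rewrite gt_eqF.
have [_ l2] := L2_normal_id s0.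
set V := Ex _ _.
have V0 : 0 <= V by apply: Ex_ge0 => x; exact: sqr_ge0.
(* [1 + t z^2 <= exp (t z^2)] for [t] of either sign. *)
have key q : 0 < q -> (1 - q ^+ 2) * (q * V) <= (1 - q) * (2 * s ^+ 2).
  move=> q0.
  have : Ex (normal_prob 0 s) (fun x => 1 + (1 - q ^+ 2) / (2 * s ^+ 2) * x ^+ 2) <= q^-1.
    rewrite -(Ex_normal_tilt s00 q0); apply: Ex_le.
    - by apply: L1D; [exact: L1_cst|exact: L1Z].
    - exact: L1_normal_tilt.
    - by move=> x; exact: expR_ge1Dx.
  rewrite ExD ?Ex_cst; [|exact: L1_cst|exact: L1Z].
  rewrite ExZ// -/V -[q^-1]mul1r ler_pdivlMr// => h.
  have -> : (1 - q ^+ 2) * (q * V) = ((1 - q ^+ 2) / (2 * s ^+ 2) * V * q) * (2 * s ^+ 2).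
    by field.
  by rewrite ler_pM2r ?mulr_gt0 ?exprn_gt0//; lra.
have up e : 0 < e < 1 -> (1 - e) * (2 - e) * V <= 2 * s ^+ 2.
  move=> /andP[e0 e1]; have := key (1 - e) ltac:(lra).
  rewrite (_ : _ * (_ * V) = e * ((1 - e) * (2 - e) * V)); last by ring.
  by rewrite (_ : 1 - (1 - e) = e) ?ler_pM2l//; ring.
have dn e : 0 < e < 1 -> 2 * s ^+ 2 <= (1 + e) * (2 + e) * V.
  move=> /andP[e0 e1]; have := key (1 + e) ltac:(lra).
  rewrite (_ : _ * (_ * V) = - e * ((1 + e) * (2 + e) * V)); last by ring.
  by rewrite (_ : 1 - (1 + e) = - e) ?ler_nM2l ?oppr_lt0//; ring.
have small eps : 0 < eps -> exists e, [/\ 0 < e, e <= 2^-1 & e * (3 * V + 1) <= eps].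
  move=> eps0; exists (Num.min (2^-1) (eps / (3 * V + 1))); split; last 1 first.
  - by rewrite -ler_pdivlMr; [rewrite ge_min lexx orbT|lra].
  - by rewrite lt_min invr_gt0 divr_gt0//; lra.
  - by rewrite ge_min lexx.
apply/eqP; rewrite eq_le; apply/andP; split; apply/ler_addgt0Pr => eps eps0;
  have [e [e0 e1 e2]] := small _ eps0.
- by have := up e ltac:(apply/andP; split; lra); nra.
- by have := dn e ltac:(apply/andP; split; lra); nra.
Qed.

Lemma Ex_normal_id (s : R) : 0 < s -> Ex (normal_prob 0 s) id = 0.
Proof.
move=> s0; have l1 := L2_L1 (L2_normal_id s0).
have symm x : normal_pdf 0 s (- x) = normal_pdf 0 s x.
  by rewrite !normal_pdfE ?gt_eqF// /normal_fun !subr0 sqrrN.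
pose p (x : R) := Num.max x 0; pose q (x : R) := Num.max (- x) 0.
have mp : measurable_fun [set: R] p by apply: measurable_maxr.
have mq : measurable_fun [set: R] q by apply: measurable_maxr => //; exact: measurableT_comp.
have p0 x : 0 <= p x by rewrite le_max lexx orbT.
have q0 x : 0 <= q x by rewrite le_max lexx orbT.
have lp : L1 (normal_prob 0 s) p.
  apply: (L1_dom _ _ (L1_norm l1)) => [|x]; first exact: mp.
  by rewrite ger0_norm// ge_max ler_norm normr_ge0.
have lq : L1 (normal_prob 0 s) q.
  apply: (L1_dom _ _ (L1_norm l1)) => [|x]; first exact: mq.
  by rewrite ger0_norm// ge_max normr_ge0 andbT -normrN ler_norm.
rewrite (_ : id = fun x => p x - q x); last first.
  by apply/funext => x; rewrite /p /q; have [] := leP x 0; have [] := leP (- x) 0; lra.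
rewrite (ExB lp lq); suff -> : Ex (normal_prob 0 s) p = Ex (normal_prob 0 s) q by rewrite subrr.
rewrite /Ex /Rintegral; congr fine.
rewrite !ge0_integral_normal_prob//; try by move=> x; rewrite lee_fin.
- rewrite -ge0_integral_reflect.
  + by apply: eq_integral => x _; rewrite symm.
  + by apply: emeasurable_funM; apply/measurable_EFinP => //; exact: measurable_normal_pdf.
  + by move=> x; rewrite mule_ge0// lee_fin// normal_pdf_ge0.
- exact/measurable_EFinP.
- exact/measurable_EFinP.
Qed.

(** Completing the square: the joint density of a summand [b] and of the sum [x] is the density of
    the sum times the conditional density of [b], which is normal with mean [t ^+ 2 / r ^+ 2 * x]
    and deviation [s * t / r]. *)
Lemma normal_pdf_convolution (s t r x b : R) : 0 < s -> 0 < t -> 0 < r -> r ^+ 2 = s ^+ 2 + t ^+ 2 ->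
  normal_pdf 0 t b * normal_pdf 0 s (x - b) =
  normal_pdf 0 r x * normal_pdf (t ^+ 2 / r ^+ 2 * x) (s * t / r) b.
Proof.
move=> s0 t0 r0 rE.
have [s1 [t1 r1]] : s != 0 /\ t != 0 /\ r != 0 by rewrite !gt_eqF.
have q1 : s * t / r != 0 by rewrite !mulf_neq0// invr_neq0.
rewrite !normal_pdfE// /normal_fun mulrACA -expRD [RHS]mulrACA -expRD.
congr *%R.
  rewrite /normal_peak -!invfM; congr (_^-1).
  have E : t ^+ 2 * pi *+ 2 * (s ^+ 2 * pi *+ 2) = r ^+ 2 * pi *+ 2 * ((s * t / r) ^+ 2 * pi *+ 2) :> R.
    by move: (pi : R) => p; field.
  have p0 z : 0 <= z ^+ 2 * pi *+ 2 :> R by rewrite mulrn_wge0// mulr_ge0 ?sqr_ge0// pi_ge0.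
  by rewrite -(sqrtrM _ (p0 t)) -(sqrtrM _ (p0 r)) E.
congr (expR _); rewrite !subr0.
have -> : s ^+ 2 = r ^+ 2 - t ^+ 2 by rewrite rE; ring.
have h : (r ^+ 2 - t ^+ 2) != 0 by rewrite rE addrK expf_neq0.
rewrite !expr_div_n exprMn.
have -> : s ^+ 2 = r ^+ 2 - t ^+ 2 by rewrite rE; ring.
by field; rewrite t1 r1 h.
Qed.

Lemma Ex_bounded_normal (m s : R) (f : R -> R) : measurable_fun [set: R] f -> (forall x, 0 <= f x <= 1) ->
  (Ex (normal_prob m s) f)%:E = (\int[leb]_x ((f x)%:E * (normal_pdf m s x)%:E))%E.
Proof.
move=> mf f01; rewrite -ge0_integral_normal_prob.
- by rewrite Ex_EFin//; exact: L1_01.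
- exact/measurable_EFinP.
- by move=> x; rewrite lee_fin; have /andP[] := f01 x.
Qed.

Lemma continuous_measurable (f : R -> R) : continuous f -> measurable_fun [set: R] f.
Proof. by move=> cf; apply: continuous_measurable_fun. Qed.

(** After Tonelli the conditional density integrates to one and the density of the sum remains.
    Continuity of [f] serves the translation of the inner integral. *)
Lemma normal_convolution (s t r : R) (f : R -> R) : 0 < s -> 0 < t -> 0 < r -> r ^+ 2 = s ^+ 2 + t ^+ 2 ->
  continuous f -> (forall x, 0 <= f x <= 1) ->
  Ex (normal_prob 0 t) (fun b => Ex (normal_prob 0 s) (fun a => f (a + b))) = Ex (normal_prob 0 r) f.
Proof.
move=> s0 t0 r0 rE cf f01.
have cs (c : R) : continuous (fun x => f (x + c)).
  move=> x; have h : y + c @[y --> x] --> x + c by apply: cvgD; [exact: cvg_id|exact: cvg_cst].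
  exact: (cvg_comp _ _ h (cf _)).
have mf : measurable_fun [set: R] f by exact: continuous_measurable.
have f0 x : 0 <= f x by have /andP[] := f01 x.
have msum : measurable_fun [set: R * R] (fun z => z.1 + z.2) by apply: measurable_funD.
have mdif : measurable_fun [set: R * R] (fun z => z.1 - z.2) by apply: measurable_funB.
have mpdf z : measurable_fun [set: R] (normal_pdf 0 z) by exact: measurable_normal_pdf.
have inner b : (Ex (normal_prob 0 s) (fun a => f (a + b)))%:E =
    (\int[leb]_x ((f x)%:E * (normal_pdf 0 s (x - b))%:E))%E.
  rewrite (@Ex_bounded_normal 0 s (fun a => f (a + b)) (continuous_measurable (cs b)) (fun a => f01 _)).
  under eq_integral do rewrite -EFinM.
  under [RHS]eq_integral do rewrite -EFinM.
  rewrite -(@ge0_integral_shift (fun x => f x * normal_pdf 0 s (x - b)) b).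
  - by apply: eq_integral => x _; rewrite addrK.
  - move=> x; apply: cvgM; first exact: cf.
    have h : y - b @[y --> x] --> x - b by apply: cvgB; [exact: cvg_id|exact: cvg_cst].
    by apply: (cvg_comp _ _ h); apply: continuous_normal_pdf; rewrite gt_eqF.
  - by move=> x; rewrite mulr_ge0// normal_pdf_ge0.
have mf2 : measurable_fun [set: R * R] (fun z => f (z.1 + z.2)) by exact: measurableT_comp.
pose I (b : R) := Ex (normal_prob 0 s) (fun a => f (a + b)).
have I01 b : 0 <= I b <= 1.
  have lI : L1 (normal_prob 0 s) (fun a => f (a + b)) by apply: L1_01 => //; exact: (continuous_measurable (cs b)).
  rewrite Ex_ge0//= -[leRHS](Ex_cst (normal_prob 0 s)); apply: Ex_le => //; first exact: L1_cst.
  by move=> x; have /andP[] := f01 (x + b).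
have mI : measurable_fun [set: R] I.
  have [_ /L1_measurable] // := @Fubini_01 _ _ _ _ R (normal_prob 0 s) (normal_prob 0 t) _ mf2 (fun z => f01 _).
apply: EFin_inj; rewrite [RHS](Ex_bounded_normal 0 r mf f01).
rewrite [LHS](Ex_bounded_normal 0 t mI I01).
rewrite /I; under eq_integral do rewrite inner.
pose K (z : R * R) := (((f z.2)%:E * (normal_pdf 0 s (z.2 - z.1))%:E) * (normal_pdf 0 t z.1)%:E)%E.
have K0 z : (0 <= K z)%E by rewrite !mule_ge0// lee_fin// normal_pdf_ge0.
have mK : measurable_fun [set: R * R] K.
  apply: emeasurable_funM; [apply: emeasurable_funM|]; apply/measurable_EFinP.
  - exact: (measurableT_comp mf).
  - apply: (measurableT_comp (mpdf s)); exact: measurable_funB.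
  - exact: (measurableT_comp (mpdf t)).
transitivity (\int[leb]_b \int[leb]_x K (b, x))%E.
  apply: eq_integral => b _; rewrite /K /= ge0_integralZr//.
  - apply: emeasurable_funM; apply/measurable_EFinP => //.
    by apply: (measurableT_comp (mpdf s)); exact: measurable_funB.
  - by move=> x _; rewrite mule_ge0// lee_fin// normal_pdf_ge0.
  - by rewrite lee_fin normal_pdf_ge0.
transitivity (\int[leb]_x \int[leb]_b K (b, x))%E; first exact: (@fubini_tonelli _ _ _ _ R leb leb K mK K0).
apply: eq_integral => x _.
transitivity (\int[leb]_b ((f x * normal_pdf 0 r x)%:E * (normal_pdf (t ^+ 2 / r ^+ 2 * x) (s * t / r) b)%:E))%E.
  apply: eq_integral => b _; rewrite /K /= -!EFinM; congr EFin.
  by rewrite -mulrA [normal_pdf 0 s _ * _]mulrC (normal_pdf_convolution _ _ s0 t0 r0 rE) mulrA.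
rewrite ge0_integralZl//.
- by rewrite integral_normal_pdf mule1 EFinM.
- by apply/measurable_EFinP; exact: measurable_normal_pdf.
- by move=> b _; rewrite lee_fin normal_pdf_ge0.
- by rewrite lee_fin mulr_ge0// normal_pdf_ge0.
Qed.

Lemma normal_prob_itv_le (a b : R) : a <= b ->
  (normal_prob 0 1 `]a, b]%classic <= ((b - a) * normal_peak 1)%:E)%E.
Proof.
move=> ab; apply: (@le_trans _ _ (\int[leb]_(x in `]a, b]) (normal_peak 1)%:E)%E).
  apply: ge0_le_integral => //=.
  - by move=> x _; rewrite lee_fin normal_pdf_ge0.
  - by apply/measurable_EFinP; apply: measurable_funTS; exact: measurable_normal_pdf.
  - by move=> x _; rewrite lee_fin normal_pdf_ub// oner_neq0.
rewrite integral_cst//= lebesgue_measure_itv /=.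
case: ifPn => [_|]; first by rewrite -EFinB -EFinM mulrC.
by rewrite mule0 lee_fin mulr_ge0 ?subr_ge0// normal_peak_ge0.
Qed.

End gaussian.

Section indicators.
Context {d : measure_display} {T : measurableType d} {R : realType}.
Variable mu : probability T R.

Lemma L1_indic (A : set T) : measurable A -> L1 mu (\1_A : T -> R).
Proof.
move=> mA; apply: L1_01; first exact: measurable_indic.
by move=> x; rewrite indicE; case: (x \in A); rewrite /= ?lexx ?ler01.
Qed.

Lemma Ex_indic (A : set T) : measurable A -> Ex mu (\1_A : T -> R) = fine (mu A).
Proof. by move=> mA; rewrite /Ex /Rintegral integral_indic// setIT. Qed.

Lemma Ex_ge_indic (A : set T) (f : T -> R) (c : R) : measurable A -> L1 mu f -> (forall x, 0 <= f x) ->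
  (forall x, A x -> c <= f x) -> c * fine (mu A) <= Ex mu f.
Proof.
move=> mA lf f0 hf; rewrite -Ex_indic// -ExZ; last exact: L1_indic.
apply: Ex_le => //; first by apply: L1Z; exact: L1_indic.
move=> x; rewrite indicE; case: (boolP (x \in A)) => hx; rewrite ?mulr1 ?mulr0//.
by apply: hf; move: hx; rewrite inE.
Qed.

Lemma Ex_le_indic (A : set T) (f : T -> R) (c : R) : measurable A -> L1 mu f -> (forall x, f x <= 1) ->
  0 <= c -> (forall x, ~ A x -> f x <= c) -> Ex mu f <= fine (mu A) + c.
Proof.
move=> mA lf f1 c0 hf; rewrite -Ex_indic// -[X in _ + X](Ex_cst mu) -ExD; [|exact: L1_indic|exact: L1_cst].
apply: Ex_le => //; first by apply: L1D; [exact: L1_indic|exact: L1_cst].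
move=> x; rewrite indicE; case: (boolP (x \in A)) => hx /=.
  by apply: le_trans (f1 x) _; rewrite lerDl.
by rewrite add0r; apply: hf; move: hx; rewrite notin_setE.
Qed.

End indicators.

(** * Replacement of independent standardised summands by normal ones *)

Section CLT.
Context {d : measure_display} {T : measurableType d} {R : realType}.
Variable P : probability T R.
Variable xi : nat -> {mfun T >-> R}.
Hypothesis xi_law : forall i B, measurable B -> P (xi i @^-1` B) = P (xi 0%N @^-1` B).
Hypothesis xi_L2 : L2 P (xi 0%N).
Hypothesis xi_mean : Ex P (xi 0%N) = 0.
Hypothesis xi_var : Ex P (fun w => xi 0%N w ^+ 2) = 1.

Definition partial_sum k w := \sum_(i < k) xi i w.

Hypothesis xi_indep : forall k, indep_fun P (partial_sum k) (xi k).

Lemma measurable_partial_sum k : measurable_fun [set: T] (partial_sum k).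
Proof. by apply: measurable_sum => i; exact: measurable_funPT. Qed.

HB.instance Definition _ k := isMeasurableFun.Build _ _ _ _ (partial_sum k) (measurable_partial_sum k).

(** The minimum combines the cubic and the quadratic Taylor remainder of an increment [a * xi],
    after division by [M * a ^+ 2]. Its mean exists under a second moment alone. *)
Definition lindeberg_defect (a : R) := Ex P (fun w => xi 0%N w ^+ 2 * Num.min (a * `|xi 0%N w|) 2).

Lemma L1_lindeberg (a : R) : 0 <= a -> L1 P (fun w => xi 0%N w ^+ 2 * Num.min (a * `|xi 0%N w|) 2).
Proof.
move=> a0; have [mx l2] := xi_L2.
apply: (L1_dom _ _ (L1Z 2 l2)) => [|w].
  apply: measurable_funM; first exact: measurable_funX.
  apply: measurable_minr => //; apply: measurable_funM => //.
  exact: (measurableT_comp (@normr_measurable R setT)).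
have m0 : 0 <= Num.min (a * `|xi 0%N w|) 2 by rewrite le_min mulr_ge0//= ler0n.
have m2 : Num.min (a * `|xi 0%N w|) 2 <= 2 by rewrite ge_min lexx orbT.
have x2 := sqr_ge0 (xi 0%N w).
by rewrite normrM (ger0_norm x2) (ger0_norm m0) [leRHS]mulrC ler_wpM2l.
Qed.

(** Below the truncation level the minimum is at most [a * Num.sqrt M]; above it the bound two costs
    twice a tail mean of at most [e / 4]. *)
Lemma lindeberg_defect_small (e : R) : 0 < e ->
  exists2 a0 : R, 0 < a0 & forall a, 0 < a <= a0 -> lindeberg_defect a <= e.
Proof.
move=> e0; have [mx l2] := xi_L2.
have e4 : 0 < e / 4 by rewrite divr_gt0.
have [M M0 [lt ht]] := L1_tail l2 (fun w => sqr_ge0 (xi 0%N w)) e4.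
have sM : 0 < Num.sqrt M by rewrite sqrtr_gt0.
exists (e / 2 / Num.sqrt M); first by rewrite !divr_gt0.
move=> a /andP[a0 ha].
pose t w := if M < xi 0%N w ^+ 2 then xi 0%N w ^+ 2 else 0.
have : lindeberg_defect a <= Ex P (fun w => (a * Num.sqrt M) * xi 0%N w ^+ 2 + 2 * t w).
  apply: Ex_le; [exact: L1_lindeberg (ltW a0)|by apply: L1D; exact: L1Z|move=> w].
  have x2 := sqr_ge0 (xi 0%N w).
  rewrite /t; case: ltP => hM.
    rewrite addrC -[leLHS]addr0 mulrC lerD//; last by rewrite mulr_ge0// ltW// mulr_gt0.
    by rewrite ler_wpM2r// ge_min lexx orbT.
  rewrite mulr0 addr0 mulrC ler_wpM2r// ge_min; apply/orP; left.
  by rewrite ler_pM2l// -sqrtr_sqr ler_wsqrtr.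
rewrite ExD; [|exact: L1Z|exact: L1Z].
rewrite !ExZ// xi_var mulr1 => /le_trans; apply.
move: ha; rewrite ler_pdivlMr// => ha.
by rewrite [leRHS]splitr lerD//; lra.
Qed.

(** The scaled summand and the normal variable have the same first two moments, hence the same mean
    Taylor polynomial, and only the remainders are left. The normal one is bounded by its third
    moment, at most [59 * a ^+ 3]. *)
Lemma swap_one_step (M : R) (f f1 f2 : R -> R) (a : R) : smooth_test M f f1 f2 ->
  measurable_fun [set: R] f -> 0 < a -> forall u,
  `|Ex P (fun w => f (u + a * xi 0%N w)) - Ex (normal_prob 0 a) (fun z => f (u + z))| <=
  a ^+ 2 * M * (lindeberg_defect a + 59 * a).
Proof.
move=> st mf a0 u.
have M0 : 0 <= M by case: st => _ _ _ /(_ 0) h _; apply: le_trans h; exact: normr_ge0.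
have [mx l2] := xi_L2.
have [lc hc] := L1_normal_cube a0.
have h1 : `|Ex P (fun w => f (u + a * xi 0%N w)) - (f u + f2 u / 2 * a ^+ 2)| <= a ^+ 2 * M * lindeberg_defect a.
  rewrite /lindeberg_defect -ExZ; last exact: L1_lindeberg (ltW a0).
  apply: (smooth_test_expect st mf (L2Z a xi_L2)).
  - by rewrite ExZ ?xi_mean ?mulr0//; exact: L2_L1.
  - transitivity (Ex P (fun w => a ^+ 2 * xi 0%N w ^+ 2)); first by congr Ex; apply/funext => w; rewrite exprMn.
    by rewrite ExZ// xi_var mulr1.
  - by apply: L1Z; exact: L1_lindeberg (ltW a0).
  - move=> w; have [t1 t2] := smooth_test_taylor st u (a * xi 0%N w).
    have E : `|a * xi 0%N w| = a * `|xi 0%N w| by rewrite normrM gtr0_norm.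
    rewrite E in t1 t2; rewrite -[xi 0%N w ^+ 2](real_normK (num_real _)).
    set y := `|xi 0%N w| in t1 t2 *; have y0 : 0 <= y by exact: normr_ge0.
    have [h|h] := leP (a * y) 2.
      by apply: le_trans t1 _; rewrite le_eqVlt; apply/orP; left; apply/eqP; ring.
    by apply: le_trans t2 _; rewrite le_eqVlt; apply/orP; left; apply/eqP; ring.
have h2 : `|Ex (normal_prob 0 a) (fun z => f (u + z)) - (f u + f2 u / 2 * a ^+ 2)| <= a ^+ 2 * M * (59 * a).
  have l3 := L1Z M lc.
  have hb : Ex (normal_prob 0 a) (fun z => M * `|z| ^+ 3) <= a ^+ 2 * M * (59 * a).
    rewrite ExZ//; apply: le_trans (ler_wpM2l M0 hc) _.
    by rewrite le_eqVlt; apply/orP; left; apply/eqP; ring.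
  apply: le_trans hb.
  apply: (smooth_test_expect st mf (L2_normal_id a0) (Ex_normal_id a0) (Ex_normal_sqr a0) l3) => z.
  by have [] := smooth_test_taylor st u z.
rewrite mulrDr; apply: le_trans (lerD h1 h2).
apply: le_trans (ler_normB _ _).
by rewrite opprB addrA subrK.
Qed.

(* The summands are exchanged for normal variables one at a time, and the
   normal variables already in place are merged by convolution. *)
Lemma swap_all (f : R -> R) (a D : R) : continuous f -> (forall x, 0 <= f x <= 1) -> 0 < a ->
  (forall u, `|Ex P (fun w => f (u + a * xi 0%N w)) - Ex (normal_prob 0 a) (fun z => f (u + z))| <= D) ->
  forall k y, `|Ex P (fun w => f (y + a * partial_sum k.+1 w)) -
     Ex (normal_prob 0 (a * Num.sqrt k.+1%:R)) (fun z => f (y + z))| <= k.+1%:R * D.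
Proof.
move=> cf f01 a0 hD.
have mf : measurable_fun [set: R] f by exact: continuous_measurable.
elim=> [|k IH] y.
  rewrite sqrtr1 mulr1 mul1r; apply: le_trans (hD y).
  rewrite (_ : (fun w => f (y + a * partial_sum 1 w)) = fun w => f (y + a * xi 0%N w))//.
  by apply/funext => w; rewrite /partial_sum big_ord1.
pose S w := partial_sum k.+1 w.
have mS : measurable_fun [set: T] S by exact: measurable_partial_sum.
have mc (c : R) : measurable_fun [set: R] (fun z => f (c + z)).
  by apply: (measurableT_comp mf); exact: measurable_funD.
have l01 (c : R) i : L1 P (fun w => f (c + a * xi i w)).
  apply: L1_01 => [|w]; last exact: f01.
  by apply: (measurableT_comp (mc c)); exact: measurable_funM.
have lawk (c : R) : Ex P (fun w => f (c + a * xi k.+1 w)) = Ex P (fun w => f (c + a * xi 0%N w)).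
  apply/esym; apply: (@same_law_Ex _ _ _ P _ _ (xi 0%N) (xi k.+1) _ (fun x => f (c + a * x))).
  - by move=> B mB; exact/esym/xi_law.
  - by apply: (measurableT_comp (mc c)); exact: measurable_funM.
  - exact: l01.
have [lE EE] : L1 P (fun w => Ex P (fun w' => f (y + a * S w + a * xi k.+1 w'))) /\
   Ex P (fun w => f (y + a * partial_sum k.+2 w)) = Ex P (fun w => Ex P (fun w' => f (y + a * S w + a * xi k.+1 w'))).
  have := @indep_Rintegral _ _ _ T R P _ _ (partial_sum k.+1) (xi k.+1) (@xi_indep k.+1)
     (fun p => f (y + a * p.1 + a * p.2)) _ _ _.
  move=> /(_ _ _ _)[||w|h1 h2].
  - apply: (measurableT_comp mf); apply: measurable_funD.
      by apply: measurable_funD => //; exact: measurable_funM.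
    exact: measurable_funM.
  - apply: L1_01 => [|w]; last exact: f01.
    apply: (measurableT_comp mf); apply: measurable_funD; last exact: measurable_funM.
    by apply: measurable_funD => //; exact: measurable_funM.
  - exact: (l01 (y + a * S w) k.+1).
  split => //; rewrite -h2; congr Ex; apply/funext => w /=.
  by rewrite /partial_sum big_ord_recr /= mulrDr addrA.
have mF : measurable_fun [set: T * measurableTypeR R] (fun p : T * measurableTypeR R => f (y + a * S p.1 + p.2)).
  apply: (measurableT_comp mf); apply: measurable_funD => //.
  by apply: measurable_funD => //; apply: measurable_funM => //; exact: (measurableT_comp mS).
have [lF1 lF2 EF] := @Fubini_01 _ _ _ _ _ P (normal_prob 0 a) (fun p => f (y + a * S p.1 + p.2)) mF (fun _ => f01 _).
rewrite /= in lF1 lF2 EF.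
pose r := a * Num.sqrt k.+1%:R.
have r0 : 0 < r by rewrite mulr_gt0// sqrtr_gt0 ltr0n.
(* The last summand is exchanged while the sum of the earlier ones is frozen, and [EF] moves the
   normal variable outside. *)
have step1 : `|Ex P (fun w => f (y + a * partial_sum k.+2 w)) -
    Ex (normal_prob 0 a) (fun z => Ex P (fun w => f (y + a * S w + z)))| <= D.
  rewrite EE -EF; apply: Ex_dist_le => // w; rewrite lawk; exact: hD.
have cy : continuous (fun z => f (y + z)).
  move=> x; have h : y + z @[z --> x] --> y + x by apply: cvgD; [exact: cvg_cst|exact: cvg_id].
  exact: (cvg_comp _ _ h (cf _)).
have conv : Ex (normal_prob 0 a) (fun b => Ex (normal_prob 0 r) (fun c => f (y + (c + b)))) =
   Ex (normal_prob 0 (a * Num.sqrt k.+2%:R)) (fun z => f (y + z)).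
  apply: (normal_convolution r0 a0) => //.
    by rewrite mulr_gt0// sqrtr_gt0 ltr0n.
  by rewrite /r !exprMn !sqr_sqrtr// -[k.+2%:R]natr1; ring.
(* The normal variable [z] is frozen in turn, and the induction hypothesis is used at the shifted
   point [y + z]; this is why it holds for all [y]. *)
have step2 : `|Ex (normal_prob 0 a) (fun z => Ex P (fun w => f (y + a * S w + z))) -
   Ex (normal_prob 0 a) (fun b => Ex (normal_prob 0 r) (fun c => f (y + (c + b))))| <= k.+1%:R * D.
  apply: (Ex_dist_le lF2).
    have mG : measurable_fun [set: measurableTypeR R * measurableTypeR R] (fun p : measurableTypeR R * measurableTypeR R => f (y + (p.2 + p.1))).
      by apply: (measurableT_comp (mc y)); exact: measurable_funD.
    have [h1 _ _] := @Fubini_01 _ _ _ _ _ (normal_prob 0 a) (normal_prob 0 r) (fun p => f (y + (p.2 + p.1))) mG (fun _ => f01 _).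
    exact: h1.
  move=> z.
  have e1 : Ex P (fun w => f (y + a * S w + z)) = Ex P (fun w => f (y + z + a * partial_sum k.+1 w)).
    by congr (Ex P _); apply/funext => w; rewrite addrAC.
  have e2 : Ex (normal_prob 0 r) (fun c => f (y + (c + z))) = Ex (normal_prob 0 r) (fun c => f (y + z + c)).
    by congr (Ex (normal_prob 0 r) _); apply/funext => c; rewrite [c + z]addrC addrA.
  rewrite [X in `|X - _|]e1 [X in `|_ - X|]e2; exact: IH.
rewrite [X in `|_ - X|]conv in step2.
have DE : k.+2%:R * D = D + k.+1%:R * D by rewrite -[k.+2%:R]natr1; ring.
rewrite [leRHS]DE; apply: le_trans (lerD step1 step2).
by apply: le_trans (ler_normD _ _); rewrite addrA subrK.
Qed.

(** At the scale [a = 1 / sqrt n] the [n] replacements cost together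
    [M * (lindeberg_defect a + 59 * a)], because [n * a ^+ 2 = 1]. *)
Lemma CLT_smooth (M : R) (f f1 f2 : R -> R) : smooth_test M f f1 f2 -> continuous f ->
  forall e : R, 0 < e -> exists N : nat, forall n, (N <= n)%N ->
   `|Ex P (fun w => f (partial_sum n w / Num.sqrt n%:R)) - Ex (normal_prob 0 1) f| <= e.
Proof.
move=> st cf e e0.
have f01 : forall x, 0 <= f x <= 1 by case: st.
have mf : measurable_fun [set: R] f by exact: continuous_measurable.
have M0 : 0 <= M by case: st => _ _ _ /(_ 0) h _; apply: le_trans h; exact: normr_ge0.
(* Both remainder terms are brought below this value; [M + 1] guards against division by zero when
   [M] vanishes. *)
have e1 : 0 < e / (2 * (M + 1)) by rewrite divr_gt0// mulr_gt0// ltr_wpDl.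
have [a0 a00 ha0] := lindeberg_defect_small e1.
pose a1 := Num.min a0 (e / (2 * (M + 1)) / 59).
have a10 : 0 < a1 by rewrite lt_min a00 divr_gt0.
exists (Num.bound ((a1 ^-1) ^+ 2)).+1 => n hn.
have n0 : (0 < n)%N by apply: leq_trans hn.
have nR : 0 < n%:R :> R by rewrite ltr0n.
pose a := (Num.sqrt n%:R : R)^-1.
have sn : 0 < Num.sqrt n%:R :> R by rewrite sqrtr_gt0.
have a_0 : 0 < a by rewrite invr_gt0.
have aa1 : a <= a1.
  rewrite -[leRHS]invrK lef_pV2 ?posrE ?invr_gt0//.
  rewrite -[leLHS]gtr0_norm ?invr_gt0// -sqrtr_sqr ler_wsqrtr//.
  apply: ltW; apply: lt_le_trans (archi_boundP _) _; first exact: sqr_ge0.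
  by rewrite ler_nat ltnW.
case: n n0 hn nR @a sn a_0 aa1 => // k _ hn nR a sn a_0 aa1.
have := swap_all cf f01 a_0 (swap_one_step st mf a_0) k 0.
rewrite (_ : a * Num.sqrt _ = 1); last by rewrite mulVf// gt_eqF.
rewrite (_ : (fun w => f (0 + a * partial_sum k.+1 w)) = fun w => f (partial_sum k.+1 w / Num.sqrt k.+1%:R)); last first.
  by apply/funext => w; rewrite add0r mulrC.
rewrite (_ : (fun z => f (0 + z)) = f); last by apply/funext => z; rewrite add0r.
move=> /le_trans; apply.
have ka : k.+1%:R * a ^+ 2 = 1 by rewrite exprVn sqr_sqrtr ?ltW// divff// gt_eqF.
have -> : k.+1%:R * (a ^+ 2 * M * (lindeberg_defect a + 59 * a)) = k.+1%:R * a ^+ 2 * (M * (lindeberg_defect a + 59 * a)) by ring.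
rewrite ka mul1r.
have h1 : lindeberg_defect a <= e / (2 * (M + 1)).
  by apply: ha0; rewrite a_0/=; apply: le_trans aa1 _; rewrite ge_min lexx.
have h2 : 59 * a <= e / (2 * (M + 1)).
  have : a <= e / (2 * (M + 1)) / 59 by apply: le_trans aa1 _; rewrite ge_min lexx orbT.
  by rewrite ler_pdivlMr// mulrC.
apply: le_trans (ler_wpM2l M0 (lerD h1 h2)) _.
have -> : M * (e / (2 * (M + 1)) + e / (2 * (M + 1))) = e * (M / (M + 1)) by field; rewrite gt_eqF// ltr_wpDl.
rewrite ler_piMr ?(ltW e0)// ler_pdivrMr ?ltr_wpDl// mul1r; lra.
Qed.

(** Since [expR x >= 1 + x], the slope [e^-1 / h] already brings the sigmoid within [e] of its
    limits at distance [h] from the origin. *)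
Lemma sigmoid_sharp (h e : R) : 0 < h -> 0 < e -> exists2 k : R, 0 < k &
  (forall y, y <= - h -> 1 - e <= sigmoid (k * y)) /\ (forall y, h <= y -> sigmoid (k * y) <= e).
Proof.
move=> h0 e0; exists (e^-1 / h); first by rewrite divr_gt0// invr_gt0.
have k0 : 0 < e^-1 / h by rewrite divr_gt0// invr_gt0.
have big (x : R) : e^-1 <= x -> (1 + expR x)^-1 <= e.
  move=> hx; rewrite -[leRHS]invrK lef_pV2 ?posrE ?invr_gt0 ?addr_gt0 ?expR_gt0//.
  by have := expR_ge1Dx x; lra.
split=> y hy; last first.
  by rewrite /sigmoid; apply: big; rewrite mulrAC ler_pdivlMr// ler_pM2l ?invr_gt0.
have -> : sigmoid (e^-1 / h * y) = 1 - (1 + expR (- (e^-1 / h * y)))^-1.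
  rewrite /sigmoid expRN; have := expR_gt0 (e^-1 / h * y); set z := expR _ => z0.
  by field; rewrite !gt_eqF// addr_gt0.
rewrite lerD2l lerN2; apply: big; rewrite -mulrN mulrAC ler_pdivlMr// ler_pM2l ?invr_gt0//.
by rewrite lerNr.
Qed.

Lemma cdf_upper_arith (p E1 E2 F0 F1 e e' : R) : (1 - e') * p <= E1 -> E1 - E2 <= e' -> E2 <= F1 + e' ->
  F1 <= F0 + e / 4 -> p <= 1 -> e' <= e / 8 -> 0 <= e' -> p <= F0 + e.
Proof. by move=> h1 h2 h3 h4 h5 h6 h7; have := ler_wpM2l h7 h5; lra. Qed.

Lemma cdf_lower_arith (p E1 E2 F0 F1 e e' : R) : E1 <= p + e' -> - e' <= E1 - E2 -> (1 - e') * F1 <= E2 ->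
  F0 <= F1 + e / 4 -> F1 <= 1 -> e' <= e / 8 -> 0 <= e' -> F0 - e <= p.
Proof. by move=> h1 h2 h3 h4 h5 h6 h7; have := ler_wpM2l h7 h5; lra. Qed.

Let W n w := partial_sum n w / Num.sqrt n%:R.

Let mW n : measurable_fun [set: T] (W n).
Proof. by apply: measurable_funM => //; exact: measurable_partial_sum. Qed.

Definition Phi (c : R) : R := fine (normal_prob 0 1 `]-oo, c]%classic).

Lemma Phi_lip (a b : R) : a <= b -> Phi a <= Phi b <= Phi a + (b - a) * normal_peak 1.
Proof.
move=> ab.
have E : normal_prob 0 1 `]-oo, b]%classic = (normal_prob 0 1 `]-oo, a]%classic + normal_prob 0 1 `]a, b]%classic)%E.
  rewrite -measureU//; first by congr (normal_prob _ _ _); rewrite -itv_bndbnd_setU.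
  by apply/seteqP; split => // x [/=]; rewrite !in_itv /= => h1 /andP[h2 _]; move: h2; rewrite ltNge h1.
have f1 : normal_prob 0 1 `]-oo, a]%classic \is a fin_num by exact: fin_num_measure.
have f2 : normal_prob 0 1 `]a, b]%classic \is a fin_num by exact: fin_num_measure.
have -> : Phi b = Phi a + fine (normal_prob 0 1 `]a, b]%classic) by rewrite /Phi E fineD.
apply/andP; split; first by rewrite lerDl fine_ge0.
by rewrite lerD2l -lee_fin fineK// normal_prob_itv_le.
Qed.

(** Sigmoids centred at [c + h] and [c - h] bound the indicator of the half-line up to small errors.
    Weak and strict inequalities are both recorded because the event that the square is at most a
    given number is the difference of a closed and an open half-line. *)
Lemma CLT_cdf (c e : R) : 0 < e -> exists N : nat, forall n, (N <= n)%N ->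
  [/\ fine (P [set w | W n w <= c]) <= Phi c + e,
      Phi c - e <= fine (P [set w | W n w <= c]),
      fine (P [set w | W n w < c]) <= Phi c + e &
      Phi c - e <= fine (P [set w | W n w < c])].
Proof.
move=> e0.
pose K := @normal_peak R 1.
have K0 : 0 < K by rewrite normal_peak_gt0// oner_neq0.
(* An interval of length [2 * h] then has normal mass at most [e / 4]. *)
pose h := e / (8 * K).
have h0 : 0 < h by rewrite divr_gt0// mulr_gt0.
have hK : 2 * h * K = e / 4 by rewrite /h; field; rewrite gt_eqF.
pose e' := Num.min (e / 8) (2^-1).
have e'0 : 0 < e' by rewrite lt_min divr_gt0//= invr_gt0.
have e'e : e' <= e / 8 by rewrite ge_min lexx.
have e'2 : e' <= 2^-1 by rewrite ge_min lexx orbT.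
have [k k0 [hl hr]] := sigmoid_sharp h0 e'0.
have sgle (b : R) : exists N, forall n, (N <= n)%N ->
   `|Ex P (fun w => sigmoid (k * (W n w - b))) - Ex (normal_prob 0 1) (fun y => sigmoid (k * (y - b)))| <= e'.
  have [M [f1 [f2 st]]] := sigmoid_scaled_test b k0.
  exact: (CLT_smooth st (continuous_sigmoid_scaled k0)).
have [N1 hN1] := sgle (c + h).
have [N2 hN2] := sgle (c - h).
have s01 (y : R) : 0 <= sigmoid y <= 1 by have /andP[/ltW -> /ltW ->] := sigmoid_itv y.
have ms (b : R) : measurable_fun [set: R] (fun y => sigmoid (k * (y - b))).
  by apply: continuous_measurable; exact: continuous_sigmoid_scaled.
have lP n b : L1 P (fun w => sigmoid (k * (W n w - b))).
  by apply: L1_01 => // ; apply: (measurableT_comp (ms b)).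
have lN b : L1 (normal_prob 0 1) (fun y => sigmoid (k * (y - b))).
  by apply: L1_01 => //; exact: ms.
exists (maxn N1 N2) => n; rewrite geq_max => /andP[/hN1 H1 /hN2 H2].
have mle := measurable_sublevel (mW n) c; have mlt := measurable_strict_sublevel (mW n) c.
have lt_le : fine (P [set w | W n w < c]) <= fine (P [set w | W n w <= c]).
  rewrite fine_le ?fin_num_measure// le_measure ?inE// => w /=; exact: ltW.
have le1 (x : R) : sigmoid x <= 1 by have /andP[] := s01 x.
have ge0 (x : R) : 0 <= sigmoid x by have /andP[] := s01 x.
have up : fine (P [set w | W n w <= c]) <= Phi c + e.
  have a1 : (1 - e') * fine (P [set w | W n w <= c]) <= Ex P (fun w => sigmoid (k * (W n w - (c + h)))).
    apply: Ex_ge_indic => // w /= hw; apply: hl.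
    by rewrite lerBlDr [- h + _]addrC addrK.
  have a2 : Ex (normal_prob 0 1) (fun y => sigmoid (k * (y - (c + h)))) <= Phi (c + 2 * h) + e'.
    apply: Ex_le_indic => //; first exact: ltW.
    move=> y /=; rewrite in_itv /= => /negP; rewrite -ltNge => hy; apply: hr.
    by rewrite lerBrDr; apply: le_trans (ltW hy); lra.
  have /andP[_ a3] : Phi c <= Phi (c + 2 * h) <= Phi c + (c + 2 * h - c) * K by apply: Phi_lip; lra.
  have pr1 : fine (P [set w | W n w <= c]) <= 1 by rewrite -lee_fin fineK ?fin_num_measure// probability_le1.
  move: H1; rewrite ler_norml => /andP[_ H1].
  rewrite addrAC subrr add0r hK in a3.
  exact: (cdf_upper_arith a1 H1 a2 a3 pr1 e'e (ltW e'0)).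
have dn : Phi c - e <= fine (P [set w | W n w < c]).
  have a1 : Ex P (fun w => sigmoid (k * (W n w - (c - h)))) <= fine (P [set w | W n w < c]) + e'.
    apply: Ex_le_indic => //; first exact: ltW.
    move=> w /= /negP; rewrite -leNgt => hy; apply: hr.
    by rewrite lerBrDr subrKC.
  have a2 : (1 - e') * Phi (c - 2 * h) <= Ex (normal_prob 0 1) (fun y => sigmoid (k * (y - (c - h)))).
    apply: Ex_ge_indic => // y /=; rewrite in_itv /= => hy; apply: hl.
    by rewrite lerBlDr; apply: le_trans hy _; lra.
  have /andP[_ a3] : Phi (c - 2 * h) <= Phi c <= Phi (c - 2 * h) + (c - (c - 2 * h)) * K by apply: Phi_lip; lra.
  have pr1 : Phi (c - 2 * h) <= 1 by rewrite -lee_fin fineK ?fin_num_measure// probability_le1.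
  move: H2; rewrite ler_norml => /andP[H2 _].
  rewrite subKr hK in a3.
  exact: (cdf_lower_arith a1 H2 a2 a3 pr1 e'e (ltW e'0)).
split; [exact: up|exact: le_trans dn lt_le|exact: le_trans lt_le up|exact: dn].
Qed.

End CLT.

(** * The Gini kernel *)

Section smax_smin.
Context {R : realType}.
Implicit Types s t : seq R.

Lemma smax_ge s x : x \in s -> x <= smax s.
Proof.
rewrite /smax => xs; elim: s (head 0 s) xs => // y s IH d.
rewrite inE big_cons le_max => /orP[/eqP ->|xs]; first by rewrite lexx.
by rewrite IH ?orbT.
Qed.

Lemma smin_le s x : x \in s -> smin s <= x.
Proof.
rewrite /smin => xs; elim: s (head 0 s) xs => // y s IH d.
rewrite inE big_cons ge_min => /orP[/eqP ->|xs]; first by rewrite lexx.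
by rewrite IH ?orbT.
Qed.

Lemma smax_mem s : s != [::] -> smax s \in s.
Proof.
move=> s0; rewrite /smax.
have : forall d, \big[Order.max/d]_(x <- s) x \in d :: s.
  elim: s {s0} => [|y s IH] d; first by rewrite big_nil mem_head.
  rewrite big_cons /Order.max; case: ifP => _; last by rewrite !inE eqxx orbT.
  by move: (IH d); rewrite !inE => /orP[->|->]; rewrite ?orbT.
by case: s s0 => // y s _ /(_ y); rewrite /= !inE orbA orbb.
Qed.

Lemma smin_mem s : s != [::] -> smin s \in s.
Proof.
move=> s0; rewrite /smin.
have : forall d, \big[Order.min/d]_(x <- s) x \in d :: s.
  elim: s {s0} => [|y s IH] d; first by rewrite big_nil mem_head.
  rewrite big_cons /Order.min; case: ifP => _; first by rewrite !inE eqxx orbT.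
  by move: (IH d); rewrite !inE => /orP[->|->]; rewrite ?orbT.
by case: s s0 => // y s _ /(_ y); rewrite /= !inE orbA orbb.
Qed.

Lemma smax_eq s m : m \in s -> (forall y, y \in s -> y <= m) -> smax s = m.
Proof.
move=> ms hm; apply/eqP; rewrite eq_le smax_ge// andbT; apply/hm/smax_mem.
by apply: contraTneq ms => ->.
Qed.

Lemma smin_eq s m : m \in s -> (forall y, y \in s -> m <= y) -> smin s = m.
Proof.
move=> ms hm; apply/eqP; rewrite eq_le smin_le//=; apply/hm/smin_mem.
by apply: contraTneq ms => ->.
Qed.

Lemma smax_cons x s : s != [::] -> smax (x :: s) = Num.max x (smax s).
Proof.
move=> s0; apply: smax_eq.
  by rewrite /Num.max; case: ifP => _; rewrite ?mem_head// inE smax_mem ?orbT.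
by move=> y; rewrite inE le_max => /orP[/eqP ->|/smax_ge ->]; rewrite ?lexx ?orbT.
Qed.

Lemma smin_cons x s : s != [::] -> smin (x :: s) = Num.min x (smin s).
Proof.
move=> s0; apply: smin_eq.
  by rewrite /Num.min; case: ifP => _; rewrite ?mem_head// inE smin_mem ?orbT.
by move=> y; rewrite inE ge_min => /orP[/eqP ->|/smin_le ->]; rewrite ?lexx ?orbT.
Qed.

Lemma smax_perm s t : perm_eq s t -> smax s = smax t.
Proof.
move=> st; have [t0|t0] := eqVneq t [::]; first by move: st; rewrite t0 => /perm_nilP ->.
apply: smax_eq => [|y]; first by rewrite (perm_mem st) smax_mem.
by rewrite (perm_mem st); exact: smax_ge.
Qed.

Lemma smin_perm s t : perm_eq s t -> smin s = smin t.
Proof.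
move=> st; have [t0|t0] := eqVneq t [::]; first by move: st; rewrite t0 => /perm_nilP ->.
apply: smin_eq => [|y]; first by rewrite (perm_mem st) smin_mem.
by rewrite (perm_mem st); exact: smin_le.
Qed.

Lemma psi_perm theta s t : perm_eq s t -> psi theta s = psi theta t.
Proof. by move=> st; rewrite /psi (smax_perm st) (smin_perm st). Qed.

Lemma abs_smax_le s : `|smax s| <= \sum_(x <- s) `|x|.
Proof.
have [->|s0] := eqVneq s [::]; first by rewrite /smax !big_nil normr0.
by rewrite (big_rem _ (smax_mem s0)) /= lerDl sumr_ge0.
Qed.

Lemma abs_smin_le s : `|smin s| <= \sum_(x <- s) `|x|.
Proof.
have [->|s0] := eqVneq s [::]; first by rewrite /smin !big_nil normr0.
by rewrite (big_rem _ (smin_mem s0)) /= lerDl sumr_ge0.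
Qed.

Definition psi_range (theta : R) (u : R * R) : R := (theta - 1) * u.1 + (theta + 1) * u.2.

(** A group of observations enters the kernel only through its maximum and minimum. Laws and
    independence can then be treated in the fixed space [R * R], whatever the size of the group. *)
Definition psi_insert (theta x : R) (u : R * R) : R := psi_range theta (Num.max x u.1, Num.min x u.2).

Definition range_pair s := (smax s, smin s).

Lemma psiE theta s : psi theta s = psi_range theta (range_pair s).
Proof. by rewrite /psi /psi_range /=; ring. Qed.

Lemma psi_cons theta x s : s != [::] -> psi theta (x :: s) = psi_insert theta x (range_pair s).
Proof. by move=> s0; rewrite psiE /psi_insert /range_pair smax_cons// smin_cons. Qed.

Lemma measurable_psi_range theta : measurable_fun [set: R * R] (psi_range theta).
Proof. by apply: measurable_funD; apply: measurable_funM. Qed.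

Lemma measurable_psi_insert theta : measurable_fun [set: R * (R * R)] (fun p => psi_insert theta p.1 p.2).
Proof.
apply: measurable_funD; apply: measurable_funM => //.
- by apply: measurable_maxr => //; apply: measurableT_comp.
- by apply: measurable_minr => //; apply: measurableT_comp.
Qed.

Lemma abs_psi_insert_le theta x u : `|psi_insert theta x u| <= (`|theta| + 1) * (2 * `|x| + `|u.1| + `|u.2|).
Proof.
have h1 : `|Num.max x u.1| <= `|x| + `|u.1|.
  by rewrite /Num.max; case: ifP => _; rewrite ?lerDl ?lerDr.
have h2 : `|Num.min x u.2| <= `|x| + `|u.2|.
  by rewrite /Num.min; case: ifP => _; rewrite ?lerDl ?lerDr.
have t1 : `|theta - 1| <= `|theta| + 1 by apply: le_trans (ler_normB _ _) _; rewrite normr1.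
have t2 : `|theta + 1| <= `|theta| + 1 by apply: le_trans (ler_normD _ _) _; rewrite normr1.
rewrite /psi_insert /psi_range /=; apply: le_trans (ler_normD _ _) _; rewrite !normrM.
have -> : (`|theta| + 1) * (2 * `|x| + `|u.1| + `|u.2|) = (`|theta| + 1) * (`|x| + `|u.1|) + (`|theta| + 1) * (`|x| + `|u.2|) by ring.
by rewrite lerD// ler_pM.
Qed.

(* This is what makes [X] square integrable when the projection is. *)
Lemma psi_insert_affine theta x u : 0 <= x ->
  `|psi_insert theta x u - (theta - 1) * x| <= (`|theta| + 1) * (`|u.1| + `|u.2|).
Proof.
move=> x0.
have h1 : `|Num.max x u.1 - x| <= `|u.1|.
  have [h|h] := leP x u.1; last by rewrite subrr normr0.
  by rewrite !ger0_norm ?subr_ge0//; [rewrite gerBl|exact: le_trans h].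
have h2 : `|Num.min x u.2| <= `|u.2|.
  by have [h|h] := leP x u.2 => //; rewrite !ger0_norm//; exact: le_trans h.
have t1 : `|theta - 1| <= `|theta| + 1 by apply: le_trans (ler_normB _ _) _; rewrite normr1.
have t2 : `|theta + 1| <= `|theta| + 1 by apply: le_trans (ler_normD _ _) _; rewrite normr1.
rewrite (_ : psi_insert _ _ _ - _ = (theta - 1) * (Num.max x u.1 - x) + (theta + 1) * Num.min x u.2); last by rewrite /psi_insert /psi_range /=; ring.
by apply: le_trans (ler_normD _ _) _; rewrite !normrM mulrDr lerD// ler_pM.
Qed.

End smax_smin.

Section laws.
Context {d : measure_display} {T : measurableType d} {R : realType}.
Variable P : probability T R.

Definition same_law d1 (E : measurableType d1) (U V : T -> E) :=
  forall B, measurable B -> P (U @^-1` B) = P (V @^-1` B).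

(** The half-lines []x, +oo[] are stable under intersection and generate the Borel sets. *)
Lemma cdf_same_law (X Y : {RV P >-> R}) : (forall x, cdf X x = cdf Y x) -> same_law X Y.
Proof.
move=> h B mB.
apply: (@g_sigma_algebra_measure_unique _ R _ (@RGenOInfty.G R) _ (fun n => `]- n%:R, +oo[%classic) _ _
  (distribution P X) (distribution P Y)).
- by move=> _ [x ->]; exact: measurable_itv.
- by move=> n; exists (- n%:R).
- apply/seteqP; split => // x _; exists (Num.truncn `|x|).+1 => //=.
  rewrite in_itv /= andbT ltrNl; apply: le_lt_trans (truncnS_gt _).
  by rewrite -normrN ler_norm.
- move=> _ _ [x ->] [y ->]; exists (Num.max x y).
  by apply/seteqP; split => z; rewrite /= !in_itv /= !andbT gt_max => /andP.
- by move=> _ [x ->]; have := ccdf_1_cdf X x; rewrite h -ccdf_1_cdf.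
- by move=> n; rewrite (le_lt_trans (probability_le1 _ _)) ?ltry.
- suff : (@RGenOInfty.G R).-sigma.-measurable B by [].
  by rewrite -RGenOInfty.measurableE.
Qed.

Lemma indep_same_law d1 d2 (E1 : measurableType d1) (E2 : measurableType d2)
  (U U' : {mfun T >-> E1}) (V V' : {mfun T >-> E2}) :
  indep_fun P U V -> indep_fun P U' V' -> same_law U U' -> same_law V V' ->
  same_law (fun w => (U w, V w)) (fun w => (U' w, V' w)).
Proof.
move=> i i' hU hV B mB.
pose W w := (U w, V w); pose W' w := (U' w, V' w).
have mW : measurable_fun [set: T] W by apply/measurable_fun_pairP; split; exact: measurable_funPT.
have mW' : measurable_fun [set: T] W' by apply/measurable_fun_pairP; split; exact: measurable_funPT.
pose W1 : {mfun T >-> (E1 * E2)%type} := mfun_Sub (mem_set mW).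
pose W2 : {mfun T >-> (E1 * E2)%type} := mfun_Sub (mem_set mW').
have e1 := @product_measure_unique _ _ _ _ _ (distribution P U) (distribution P V) (distribution P W1) _ B mB.
have e2 := @product_measure_unique _ _ _ _ _ (distribution P U) (distribution P V) (distribution P W2) _ B mB.
have : distribution P W1 B = distribution P W2 B.
  rewrite -e1; last by move=> A1 A2 m1 m2; exact: i.
  rewrite -e2//.
  move=> A1 A2 m1 m2; rewrite [RHS](_ : _ = (P (U @^-1` A1) * P (V @^-1` A2))%E)//.
  by rewrite hU// hV//; exact: i'.
by [].
Qed.

Lemma indep_comp d1 d2 d3 d4 (E1 : measurableType d1) (E2 : measurableType d2)
   (F1 : measurableType d3) (F2 : measurableType d4)
   (U : T -> E1) (V : T -> E2) (f : E1 -> F1) (h : E2 -> F2) :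
  measurable_fun [set: E1] f -> measurable_fun [set: E2] h -> indep_fun P U V ->
  indep_fun P (f \o U) (h \o V).
Proof.
move=> mf mh i A B mA mB; by apply: (i (f @^-1` A) (h @^-1` B)); exact: measurable_preimage.
Qed.

Lemma indep_ExM d1 d2 (E1 : measurableType d1) (E2 : measurableType d2)
  (U : {mfun T >-> E1}) (V : {mfun T >-> E2}) (f : E1 -> R) (h : E2 -> R) :
  indep_fun P U V -> measurable_fun [set: E1] f -> measurable_fun [set: E2] h ->
  L2 P (f \o U) -> L2 P (h \o V) ->
  Ex P (fun w => f (U w) * h (V w)) = Ex P (f \o U) * Ex P (h \o V).
Proof.
move=> i mf mh lf lh.
have [_ ->] := @indep_Rintegral _ _ _ _ _ P _ _ U V i (fun p => f p.1 * h p.2)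
   ltac:(by apply: measurable_funM; apply: measurableT_comp) (L2M lf lh) (fun w => L1Z (f (U w)) (L2_L1 lh)).
rewrite mulrC -(ExZ _ (L2_L1 lf)); congr (Ex P _); apply/funext => w /=.
by rewrite (ExZ _ (L2_L1 lh)) mulrC.
Qed.

Lemma L2_dom (f g : T -> R) : measurable_fun [set: T] f -> (forall x, `|f x| <= g x) -> L2 P g -> L2 P f.
Proof.
move=> mf fg [mg lg]; split => //; apply: L1_dom lg; first exact: measurable_funX.
move=> x; rewrite normrX lerXn2r ?nnegrE//; exact: le_trans (fg x).
Qed.

Lemma L2_norm (f : T -> R) : L2 P f -> L2 P (fun x => `|f x|).
Proof.
move=> lf; have [mf l2] := lf; split; first exact: (measurableT_comp (@normr_measurable R setT)).
by apply: L1_ext l2 => x; rewrite real_normK ?num_real.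
Qed.

End laws.

(** * The range of a group of observations and the projected kernel *)

Section kernel.
Context {d : measure_display} {T : measurableType d} {R : realType}.
Variable P : probability T R.
Variable Xs : nat -> {RV P >-> R}.

Definition obs (J : seq nat) (w : T) : seq R := [seq Xs j w | j <- J].

Definition obs_range (J : seq nat) (w : T) : R * R := range_pair (obs J w).

Lemma range_pair_cons (x : R) s : s != [::] ->
  range_pair (x :: s) = (Num.max x (range_pair s).1, Num.min x (range_pair s).2).
Proof. by move=> s0; rewrite /range_pair smax_cons// smin_cons. Qed.

Lemma range_pair1 (x : R) : range_pair [:: x] = (x, x).
Proof. by rewrite /range_pair /smax /smin !big_cons !big_nil /= maxxx minxx. Qed.

Let extend (p : R * (R * R)) : R * R := (Num.max p.1 p.2.1, Num.min p.1 p.2.2).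

Let measurable_extend : measurable_fun [set: R * (R * R)] extend.
Proof.
apply/measurable_fun_pairP; split.
- by apply: measurable_maxr => //; apply: measurableT_comp.
- by apply: measurable_minr => //; apply: measurableT_comp.
Qed.

Let diag (x : R) : R * R := (x, x).

Let measurable_diag : measurable_fun [set: R] diag.
Proof. by apply: measurable_fun_pair; exact: measurable_id. Qed.

Lemma obs_range_cons j J : J != [::] -> obs_range (j :: J) = extend \o (fun w => (Xs j w, obs_range J w)).
Proof.
move=> J0; apply/funext => w; rewrite /obs_range /= range_pair_cons//.
by case: J J0.
Qed.

Lemma obs_range1 j : obs_range [:: j] = diag \o Xs j.
Proof. by apply/funext => w; rewrite /obs_range /= range_pair1. Qed.

Lemma block_obs_range J K : {subset K <= J} ->
  measurable_fun [set: block_space Xs J] (obs_range K : block_space Xs J -> R * R).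
Proof.
elim: K => [_|j K IH jK]; first exact: (measurable_cst (obs_range [::] point)).
have mj : measurable_fun [set: block_space Xs J] (Xs j : block_space Xs J -> R).
  by apply: block_coord; apply: jK; rewrite mem_head.
have [->|K0] := eqVneq K [::].
  by rewrite obs_range1; exact: measurableT_comp.
rewrite obs_range_cons//; apply: measurableT_comp => //.
apply/measurable_fun_pairP; split => //; apply: IH => i iK.
by apply: jK; rewrite inE iK orbT.
Qed.

Lemma measurable_obs_range J : measurable_fun [set: T] (obs_range J).
Proof. by apply: (@block_measurable _ _ _ _ Xs _ _ J); exact: block_obs_range. Qed.

HB.instance Definition _ J := isMeasurableFun.Build _ _ _ _ (obs_range J) (measurable_obs_range J).

Hypothesis hindep : mutually_independent Xs.
Hypothesis hlaw : forall i, same_law P (Xs i) (Xs 0%N).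

Lemma obs_range_indep J K : uniq (J ++ K) -> indep_fun P (obs_range J) (obs_range K).
Proof. by move=> JK; apply: (block_indep hindep JK); exact: block_obs_range. Qed.

Lemma Xs_obs_range_indep j J : uniq (j :: J) -> indep_fun P (Xs j) (obs_range J).
Proof.
move=> JK; apply: (@block_indep _ _ _ _ _ hindep _ _ _ _ [:: j] J) => //.
- by apply: block_coord; rewrite mem_head.
- exact: block_obs_range.
Qed.

(** Induction on the number of observations: by independence the joint law of one observation and
    the range of the others is determined by the two marginal laws. *)
Lemma obs_range_law J K : uniq J -> uniq K -> size J = size K -> same_law P (obs_range J) (obs_range K).
Proof.
elim: J K => [|j J IH] [|k K]//= /andP[jJ uJ] /andP[kK uK] [JK] B mB.
have ll : same_law P (Xs j) (Xs k) by move=> C mC; rewrite (hlaw j mC) (hlaw k mC).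
have [J0|J0] := eqVneq J [::].
  have K0 : K = [::] by apply/eqP; rewrite -size_eq0 -JK J0.
  rewrite J0 K0 !obs_range1; apply: (ll (diag @^-1` B)).
  exact: measurable_preimage measurable_diag mB.
have K0 : K != [::] by rewrite -size_eq0 -JK size_eq0.
rewrite !obs_range_cons// !comp_preimage.
apply: (@indep_same_law _ _ _ _ _ _ _ _ (Xs j) (Xs k) (obs_range J) (obs_range K)) => //.
- by apply: Xs_obs_range_indep; rewrite /= jJ.
- by apply: Xs_obs_range_indep; rewrite /= kK.
- exact: IH.
- exact: measurable_preimage measurable_extend mB.
Qed.

Variable theta : R.
Variable v : nat.
Hypothesis v1 : (1 < v)%N.

(** An explicit version of the conditional expectation of [psi] given its first argument, defined at
    every point; [iota 1 v.-1] lists the observations used by [first_obs] other than the first. *)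
Definition proj_kernel (x : R) := Ex P (fun w => psi_insert theta x (obs_range (iota 1 v.-1) w)).

Lemma psi_obs_cons j J w : J != [::] -> psi theta (obs (j :: J) w) = psi_insert theta (Xs j w) (obs_range J w).
Proof. by move=> J0; rewrite psi_cons//; case: J J0. Qed.

Lemma L1_obs_range J : (forall i, L1 P (Xs i)) ->
  L1 P (fun w => `|(obs_range J w).1|) /\ L1 P (fun w => `|(obs_range J w).2|).
Proof.
move=> lX.
have m1 : measurable_fun [set: T] (fun w => (obs_range J w).1) by apply: measurableT_comp => //; exact: measurable_obs_range.
have m2 : measurable_fun [set: T] (fun w => (obs_range J w).2) by apply: measurableT_comp => //; exact: measurable_obs_range.
have ls : L1 P (fun w => \sum_(j <- J) `|Xs j w|) by apply: L1_sum => j _; exact: L1_norm.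
split; apply: L1_norm; apply: L1_dom ls => // w.
- by apply: le_trans (abs_smax_le _) _; rewrite /obs big_map.
- by apply: le_trans (abs_smin_le _) _; rewrite /obs big_map.
Qed.

Lemma L2_obs_range J : (forall i, L2 P (Xs i)) ->
  L2 P (fun w => `|(obs_range J w).1|) /\ L2 P (fun w => `|(obs_range J w).2|).
Proof.
move=> lX.
have m1 : measurable_fun [set: T] (fun w => (obs_range J w).1) by apply: measurableT_comp => //; exact: measurable_obs_range.
have m2 : measurable_fun [set: T] (fun w => (obs_range J w).2) by apply: measurableT_comp => //; exact: measurable_obs_range.
have ls : L2 P (fun w => \sum_(j <- J) `|Xs j w|) by apply: L2_sum => j _; exact: L2_norm.
split; apply: L2_norm; apply: L2_dom ls => // w.
- by apply: le_trans (abs_smax_le _) _; rewrite /obs big_map.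
- by apply: le_trans (abs_smin_le _) _; rewrite /obs big_map.
Qed.

Lemma measurable_psi_obs J : measurable_fun [set: T] (fun w => psi theta (obs J w)).
Proof.
have -> : (fun w => psi theta (obs J w)) = psi_range theta \o obs_range J by apply/funext => w; rewrite psiE.
by apply: measurableT_comp; [exact: measurable_psi_range|exact: measurable_obs_range].
Qed.

Lemma abs_psi_range_le (u : R * R) : `|psi_range theta u| <= (`|theta| + 1) * (`|u.1| + `|u.2|).
Proof.
have t1 : `|theta - 1| <= `|theta| + 1 by apply: le_trans (ler_normB _ _) _; rewrite normr1.
have t2 : `|theta + 1| <= `|theta| + 1 by apply: le_trans (ler_normD _ _) _; rewrite normr1.
by apply: le_trans (ler_normD _ _) _; rewrite !normrM mulrDr lerD// ler_wpM2r.
Qed.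

Lemma L1_psi_obs J : (forall i, L1 P (Xs i)) -> L1 P (fun w => psi theta (obs J w)).
Proof.
move=> /(L1_obs_range J)[l1 l2].
apply: L1_dom (measurable_psi_obs J) _ (L1Z (`|theta| + 1) (L1D l1 l2)) => w.
by rewrite psiE abs_psi_range_le.
Qed.

Lemma L2_psi_obs J : (forall i, L2 P (Xs i)) -> L2 P (fun w => psi theta (obs J w)).
Proof.
move=> /(L2_obs_range J)[l1 l2].
apply: L2_dom (measurable_psi_obs J) _ (L2Z (`|theta| + 1) (L2D l1 l2)) => w.
by rewrite psiE abs_psi_range_le.
Qed.

Lemma L1_psi_insert_obs J x : (forall i, L1 P (Xs i)) -> L1 P (fun w => psi_insert theta x (obs_range J w)).
Proof.
move=> /(L1_obs_range J)[l1 l2].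
apply: L1_dom _ _ (L1Z (`|theta| + 1) (L1D (L1D (L1_cst P (2 * `|x|)) l1) l2)) => [|w]; last exact: abs_psi_insert_le.
apply: (measurableT_comp (f := fun u => psi_insert theta x u)); last exact: measurable_obs_range.
exact: (measurableT_comp (measurable_psi_insert theta) (pair1_measurable x)).
Qed.

Lemma psi_insert_lip (x y : R) u : `|psi_insert theta x u - psi_insert theta y u| <= 2 * (`|theta| + 1) * `|x - y|.
Proof.
have h1 : `|Num.max x u.1 - Num.max y u.1| <= `|x - y|.
  by rewrite /Num.max; case: (ltP x u.1); case: (ltP y u.1) => h1 h2;
    rewrite ?subrr ?normr0 ?normr_ge0 ?lexx// ler_norml; have := ler_norm (x - y); have := ler_norm (y - x); rewrite (distrC y x) => *; apply/andP; split; lra.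
have h2 : `|Num.min x u.2 - Num.min y u.2| <= `|x - y|.
  by rewrite /Num.min; case: (ltP x u.2); case: (ltP y u.2) => h2 h3;
    rewrite ?subrr ?normr0 ?normr_ge0 ?lexx// ler_norml; have := ler_norm (x - y); have := ler_norm (y - x); rewrite (distrC y x) => *; apply/andP; split; lra.
rewrite (_ : _ - _ = psi_range theta (Num.max x u.1 - Num.max y u.1, Num.min x u.2 - Num.min y u.2)); last first.
  by rewrite /psi_insert /psi_range /=; ring.
apply: le_trans (abs_psi_range_le _) _.
rewrite (_ : 2 * _ * _ = (`|theta| + 1) * (`|x - y| + `|x - y|)); last by ring.
by rewrite ler_wpM2l ?addr_ge0// lerD.
Qed.

Section L1_facts.
Hypothesis lX : forall i, L1 P (Xs i).

Lemma measurable_proj_kernel : measurable_fun [set: R] proj_kernel.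
Proof.
apply: continuous_measurable => x; apply/cvgrPdist_le => e e0.
have c0 : 0 < 2 * (`|theta| + 1) by rewrite mulr_gt0// ltr_wpDl.
near=> y.
apply: le_trans (_ : 2 * (`|theta| + 1) * `|x - y| <= _); last first.
  rewrite mulrC -ler_pdivlMr//; near: y.
  by apply: cvgr_dist_le; [exact: cvg_id|rewrite divr_gt0].
by apply: Ex_dist_le => [||w]; [exact: L1_psi_insert_obs|exact: L1_psi_insert_obs|exact: psi_insert_lip].
Unshelve. all: by end_near. Qed.

Lemma proj_kernel_law J : uniq J -> size J = v.-1 -> forall x,
  Ex P (fun w => psi_insert theta x (obs_range J w)) = proj_kernel x.
Proof.
move=> uJ sJ x.
apply: (same_law_Ex (obs_range_law uJ (iota_uniq 1 v.-1) _) (h := fun u => psi_insert theta x u)).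
- by rewrite size_iota.
- exact: (measurableT_comp (measurable_psi_insert theta) (pair1_measurable x)).
- exact: L1_psi_insert_obs.
Qed.

Lemma proj_kernel_affine x : 0 <= x -> `|proj_kernel x - (theta - 1) * x| <=
  (`|theta| + 1) * (Ex P (fun w => `|(obs_range (iota 1 v.-1) w).1|) + Ex P (fun w => `|(obs_range (iota 1 v.-1) w).2|)).
Proof.
move=> x0; have [l1 l2] := L1_obs_range (iota 1 v.-1) lX.
rewrite -(ExD l1 l2) -(ExZ _ (L1D l1 l2)).
rewrite -[X in _ - X](Ex_cst P) -ExB; [|exact: L1_psi_insert_obs|exact: L1_cst].
have lB := L1B (L1_psi_insert_obs (iota 1 v.-1) x lX) (L1_cst P ((theta - 1) * x)).
apply: le_trans (Ex_norm lB) _; apply: Ex_le => [||w].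
- exact: L1_norm.
- exact/L1Z/L1D.
- exact: psi_insert_affine.
Qed.

End L1_facts.
End kernel.

Lemma Ex_norm0_sqr d (T : measurableType d) (R : realType) (mu : probability T R) (f : T -> R) :
  L1 mu f -> Ex mu (fun x => `|f x|) = 0 -> Ex mu (fun x => f x ^+ 2) = 0.
Proof.
move=> lf f0; have mf := L1_measurable lf.
have /ae_eq_integral_abs h : (\int[mu]_x `|(f x)%:E| = 0)%E by rewrite -[LHS](Ex_EFin (L1_norm lf)) f0.
have ae0 : ae_eq mu [set: T] (EFin \o (fun x => f x ^+ 2)) (cst 0%E).
  move: (h measurableT ltac:(exact/measurable_EFinP)); apply: filterS => x /= fx /fx[->].
  by rewrite expr0n.
rewrite /Ex /Rintegral (ae_eq_integral (cst 0%E) _ _ _ _ ae0)//; last first.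
  by apply/measurable_EFinP; exact: measurable_funX.
by rewrite integral0.
Qed.

(** * The projection as a conditional expectation, and its moments *)

Section projection.
Context {d : measure_display} {T : measurableType d} {R : realType}.
Variable P : probability T R.
Variable Xs : nat -> {RV P >-> R}.
Hypothesis hindep : mutually_independent Xs.
Hypothesis hlaw : forall i, same_law P (Xs i) (Xs 0%N).
Variable theta : R.
Variable v : nat.
Hypothesis v1 : (1 < v)%N.
Hypothesis lX : forall i, L1 P (Xs i).

Let G := proj_kernel Xs theta v.
Let mG : measurable_fun [set: R] G := measurable_proj_kernel theta v lX.

Lemma first_obsE w : first_obs Xs v w = obs Xs (0%N :: iota 1 v.-1) w.
Proof. by rewrite /first_obs -[in LHS](ltn_predK v1). Qed.

(** The defining property of a conditional expectation, by freezing [Xs j]. The test function [k] is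
    a constant for the mean, an indicator for uniqueness, a sign for the contraction property, and
    [G] itself for covariances. *)
Lemma Ex_mul_psi (k : R -> R) j J : uniq (j :: J) -> size J = v.-1 -> measurable_fun [set: R] k ->
  L1 P (fun w => k (Xs j w) * psi theta (obs Xs (j :: J) w)) ->
  L1 P (fun w => k (Xs j w) * G (Xs j w)) /\
  Ex P (fun w => k (Xs j w) * psi theta (obs Xs (j :: J) w)) = Ex P (fun w => k (Xs j w) * G (Xs j w)).
Proof.
move=> uJ sJ mk lk.
have J0 : J != [::] by rewrite -size_eq0 sJ; case: (v) v1 => [|[]].
have E w : k (Xs j w) * psi theta (obs Xs (j :: J) w) = k (Xs j w) * psi_insert theta (Xs j w) (obs_range Xs J w).
  by rewrite psi_obs_cons.
have mf : measurable_fun setT (fun p : R * (R * R) => k p.1 * psi_insert theta p.1 p.2).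
  by apply: measurable_funM; [exact: measurableT_comp|exact: measurable_psi_insert].
have lw w : L1 P (fun w' => k (Xs j w) * psi_insert theta (Xs j w) (obs_range Xs J w')).
  by apply: L1Z; exact: L1_psi_insert_obs.
have := @indep_Rintegral _ _ _ _ _ P _ _ (Xs j) (obs_range Xs J) (Xs_obs_range_indep hindep uJ) _ mf (L1_ext E lk) lw.
rewrite /=; case.
have -> : (fun w => Ex P (fun w' => k (Xs j w) * psi_insert theta (Xs j w) (obs_range Xs J w'))) = (fun w => k (Xs j w) * G (Xs j w)).
  apply/funext => w; rewrite ExZ; last exact: L1_psi_insert_obs.
  by rewrite (proj_kernel_law hindep hlaw theta (v := v) lX)//; case/andP: uJ.
by move=> l e; split => //; rewrite -e; congr (Ex P _); apply/funext => w; rewrite E.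
Qed.

Let J1 := iota 1 v.-1.
Let uJ1 : uniq (0%N :: J1). Proof. by rewrite /= mem_iota iota_uniq. Qed.
Let sJ1 : size J1 = v.-1. Proof. by rewrite size_iota. Qed.
Let psi0 w := psi theta (obs Xs (0%N :: J1) w).
Let lpsi : L1 P psi0 := L1_psi_obs theta (0%N :: J1) lX.

Lemma L1_proj i : L1 P (G \o Xs i).
Proof.
suff h : L1 P (G \o Xs 0%N) by apply: (same_law_L1 _ mG h) => B mB; rewrite (hlaw i mB).
have [] := @Ex_mul_psi (fun=> 1) 0%N J1 uJ1 sJ1 (measurable_cst (1 : R)).
  by apply: L1_ext lpsi => w; rewrite mul1r.
by move=> h _; apply: L1_ext h => w; rewrite mul1r.
Qed.

Lemma Ex_proj i : Ex P (G \o Xs i) = Ex P psi0.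
Proof.
have -> : Ex P (G \o Xs i) = Ex P (G \o Xs 0%N).
  by apply: (same_law_Ex _ mG (L1_proj i)) => B mB; rewrite (hlaw i mB).
have [] := @Ex_mul_psi (fun=> 1) 0%N J1 uJ1 sJ1 (measurable_cst (1 : R)).
  by apply: L1_ext lpsi => w; rewrite mul1r.
move=> _ h; transitivity (Ex P (fun w => 1 * psi0 w)).
  by rewrite h; congr (Ex P _); apply/funext => w; rewrite mul1r.
by congr (Ex P _); apply/funext => w; rewrite mul1r.
Qed.

Lemma measurable_indic_set (B : set R) : measurable B -> measurable_fun [set: R] (\1_B : R -> R).
Proof. by move=> mB; exact: measurable_indic. Qed.

Lemma L1_indicM (B : set R) j (f : T -> R) : measurable B -> L1 P f -> L1 P (fun w => \1_B (Xs j w) * f w).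
Proof.
move=> mB lf; apply: L1_dom _ _ (L1_norm lf) => [|w].
  apply: measurable_funM; last exact: (L1_measurable lf).
  exact: measurableT_comp (measurable_indic_set mB) _.
by rewrite normrM ger0_norm// ler_piMl// indicE; case: (_ \in _).
Qed.

(** Contraction of the conditional expectation in mean absolute value: the test function [k] is the
    sign of [G]. *)
Lemma Ex_norm_proj : Ex P (fun w => `|G (Xs 0%N w)|) <= Ex P (fun w => `|psi0 w|).
Proof.
pose B := [set x : R | 0 <= G x].
have mB : measurable B := measurable_superlevel mG 0.
pose k x : R := 2 * \1_B x - 1.
have mk : measurable_fun [set: R] k.
  by apply: measurable_funB => //; apply: measurable_funM => //; exact: measurable_indic_set.
have k1 x : `|k x| <= 1.
  by rewrite /k indicE; case: (_ \in _); rewrite ?mulr1 ?mulr0 ?sub0r ?normrN ?normr1// (_ : 2 - 1 = 1) ?normr1//; lra.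
have lk : L1 P (fun w => k (Xs 0%N w) * psi0 w).
  apply: L1_dom _ _ (L1_norm lpsi) => [|w]; last by rewrite normrM ler_piMl.
  by apply: measurable_funM; [exact: measurableT_comp|exact: (L1_measurable lpsi)].
have [_ e] := Ex_mul_psi uJ1 sJ1 mk lk.
have -> : (fun w => `|G (Xs 0%N w)|) = (fun w => k (Xs 0%N w) * G (Xs 0%N w)).
  apply/funext => w; rewrite /k indicE.
  have [h|h] := leP 0 (G (Xs 0%N w)).
    by rewrite mem_set// ger0_norm//=; lra.
  by rewrite memNset ?ltr0_norm//=; [lra|apply/negP; rewrite -ltNge].
rewrite -e; apply: Ex_le => //; first exact: L1_norm.
by move=> w; apply: le_trans (ler_norm _) _; rewrite normrM ler_piMl.
Qed.

(** Uniqueness of the conditional expectation, by testing on indicators; it transfers the variance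
    assumed for [g] to [G]. *)
Lemma proj_ae (g : R -> R) : is_cond_expectation (fun w => psi theta (first_obs Xs v w)) (Xs 0%N) g ->
  ae_eq (distribution P (Xs 0%N)) [set: R] (EFin \o g) (EFin \o G).
Proof.
case=> _ mg ig hB; apply: integral_ae_eq => //; first exact/measurable_EFinP.
move=> B _ mB; rewrite -hB//.
have mXB : measurable (Xs 0%N @^-1` B) by exact: measurable_preimage.
have [lk ek] := Ex_mul_psi uJ1 sJ1 (measurable_indic_set mB) (L1_indicM 0%N mB lpsi).
transitivity (Ex P (fun w => \1_B (Xs 0%N w) * psi0 w))%:E.
  rewrite Ex_EFin; last exact: L1_indicM.
  rewrite integral_mkcond; apply: eq_integral => w _.
  rewrite patchE /psi0 -first_obsE indicE.
  have -> : (w \in Xs 0%N @^-1` B) = (Xs 0%N w \in B) by apply/idP/idP; rewrite !inE.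
  by case: ifPn => _; rewrite ?mul1r ?mul0r.
rewrite ek Ex_EFin//.
rewrite (integral_mkcond B) (integral_distribution (X := Xs 0%N)).
- apply: eq_integral => w _; rewrite /= patchE indicE.
  by case: ifPn => _; rewrite ?mul1r ?mul0r.
- by apply/(measurable_restrictT _ mB); apply: measurable_funTS; exact/measurable_EFinP.
- rewrite (_ : _ \o _ = EFin \o (fun w => \1_B (Xs 0%N w) * G (Xs 0%N w)))//.
  by apply/funext => w; rewrite /= patchE indicE; case: ifPn => _; rewrite ?mul1r ?mul0r.
Qed.

Lemma ae_eq_law (X : {RV P >-> R}) (f h : R -> R) : same_law P X (Xs 0%N) ->
  ae_eq (distribution P (Xs 0%N)) [set: R] (EFin \o f) (EFin \o h) ->
  ae_eq P [set: T] (EFin \o (f \o X)) (EFin \o (h \o X)).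
Proof.
move=> hX [N [mN N0 sub]]; exists (X @^-1` N); split.
- exact: measurable_preimage.
- by rewrite [LHS](hX N mN).
- by move=> w hw; apply: sub => /= hh; apply: hw => _; exact: hh.
Qed.

(* The mean of [psi] vanishes also in the degenerate case where
   [max + min] has mean [0], when [theta] is the junk value [0]. *)
Lemma psi_centered : (forall i, Ex P (fun w => Num.max (- Xs i w) 0) = 0) -> theta = GIM P Xs v ->
  Ex P psi0 = 0 /\ (theta = 1 -> Ex P (fun w => `|psi0 w|) = 0).
Proof.
move=> hneg hth.
pose u w := obs_range Xs (0%N :: J1) w.
have [n1 n2] := L1_obs_range (0%N :: J1) lX.
have mu := measurable_obs_range Xs (0%N :: J1).
have l1 : L1 P (fun w => (u w).1) by apply: L1_dom _ _ n1 => //; exact: measurableT_comp.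
have l2 : L1 P (fun w => (u w).2) by apply: L1_dom _ _ n2 => //; exact: measurableT_comp.
(* The total negative part. It bounds the minimum from below and has mean zero, which stands in for
   almost sure positivity of the observations. *)
pose ng w := \sum_(j <- 0%N :: J1) Num.max (- Xs j w) 0.
have lneg j : L1 P (fun w => Num.max (- Xs j w) 0).
  apply: L1_dom _ _ (L1_norm (lX j)) => [|w].
    by apply: measurable_maxr => //; exact: measurableT_comp.
  by rewrite ger0_norm ?le_max ?lexx ?orbT// ge_max normr_ge0 -normrN ler_norm.
have lng : L1 P ng by apply: L1_sum.
have ng0 : Ex P ng = 0 by rewrite Ex_sum// big1.
have u2ng w : - ng w <= (u w).2.
  have : smin (obs Xs (0%N :: J1) w) \in obs Xs (0%N :: J1) w by exact: smin_mem.
  case/mapP => j jJ e; rewrite /u /obs_range /range_pair /= e /ng (big_rem _ jJ) /= lerNl.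
  apply: le_trans (_ : Num.max (- Xs j w) 0 <= _); first by rewrite le_max lexx.
  by rewrite lerDl sumr_ge0// => i _; rewrite le_max lexx orbT.
have ng_ge0 w : 0 <= ng w by apply: sumr_ge0 => i _; rewrite le_max lexx orbT.
have e2 : Ex P (fun w => `|(u w).2|) <= Ex P (fun w => (u w).2).
  have -> : Ex P (fun w => (u w).2) = Ex P (fun w => (u w).2 + 2 * ng w).
    by rewrite ExD ?ExZ ?ng0 ?mulr0 ?addr0//; exact: L1Z.
  apply: Ex_le => [//||w]; first exact/L1D/L1Z.
  by rewrite ler_norml; have := u2ng w; have := ng_ge0 w => *; apply/andP; split; lra.
have u2 : 0 <= Ex P (fun w => (u w).2) by apply: le_trans e2; exact: Ex_ge0.
have u12 : Ex P (fun w => (u w).2) <= Ex P (fun w => (u w).1).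
  by apply: Ex_le => // w; apply/smin_le/smax_mem.
have hN : fine 'E_P[fun w => smax (first_obs Xs v w) - smin (first_obs Xs v w)] =
    Ex P (fun w => (u w).1) - Ex P (fun w => (u w).2).
  rewrite -ExB// unlock /Ex /Rintegral; congr fine; apply: eq_integral => w _.
  by rewrite first_obsE.
have hD : fine 'E_P[fun w => smax (first_obs Xs v w) + smin (first_obs Xs v w)] =
    Ex P (fun w => (u w).1) + Ex P (fun w => (u w).2).
  rewrite -ExD// unlock /Ex /Rintegral; congr fine; apply: eq_integral => w _.
  by rewrite first_obsE.
have ep : Ex P psi0 = (theta - 1) * Ex P (fun w => (u w).1) + (theta + 1) * Ex P (fun w => (u w).2).
  rewrite -!ExZ// -ExD; [|exact: L1Z|exact: L1Z].
  by congr (Ex P _); apply/funext => w; rewrite /psi0 psiE.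
move: hth; rewrite /GIM hN hD => hth.
move: u2 u12 hth ep e2; set a := Ex P (fun w => (u w).1); set b := Ex P (fun w => (u w).2) => u2 u12 hth ep e2.
have [D0|D0] := eqVneq (a + b) 0.
  have a0 : a = 0 by lra.
  have b0 : b = 0 by lra.
  split; first by rewrite ep a0 b0 !mulr0 addr0.
  by rewrite hth D0 invr0 mulr0 => /eqP; rewrite eq_sym oner_eq0.
have hth' : theta * (a + b) = a - b by rewrite hth mulfVK.
split; first by rewrite ep; lra.
(* At [theta = 1] the kernel is twice the minimum, whose mean is then zero. *)
move=> th1; have b0 : b = 0 by move: hth'; rewrite th1; lra.
apply/eqP; rewrite eq_le Ex_ge0// andbT.
have -> : (fun w => `|psi0 w|) = (fun w => 2 * `|(u w).2|).
  apply/funext => w; rewrite /psi0 psiE /psi_range th1 subrr mul0r add0r normrM ger0_norm//.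

by rewrite ExZ// mulr_ge0_le0//; rewrite -b0.
Qed.

(** What is assumed of [X] and [g] is carried over to the observations and [G], through equality of
    laws and almost sure equality. *)
Lemma proj_moments (X : {RV P >-> R}) (g : R -> R) (s2 : R) :
  (forall w, 0 <= X w) -> same_law P X (Xs 0%N) -> theta = GIM P Xs v ->
  is_cond_expectation (fun w => psi theta (first_obs Xs v w)) (Xs 0%N) g ->
  ('V_P[g \o X] = s2%:E)%E -> 0 < s2 ->
  (forall i, [/\ L2 P (Xs i), L2 P (G \o Xs i), Ex P (G \o Xs i) = 0 &
     Ex P (fun w => G (Xs i w) ^+ 2) = s2]) /\ Ex P psi0 = 0.
Proof.
move=> X0 hX hth hg hs s0.
have hXi i : same_law P X (Xs i) by move=> B mB; rewrite hX// (hlaw i mB).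
have lXX : L1 P X by apply: (same_law_L1 _ (@measurable_id _ R setT) (lX 0%N)) => B mB; rewrite /= -hX.
(* Only [X] is non-negative at every point; the negative parts of the observations are reached
   through their law. *)
have hneg i : Ex P (fun w => Num.max (- Xs i w) 0) = 0.
  have mm : measurable_fun [set: R] (fun x : R => Num.max (- x) 0) by apply: measurable_maxr.
  have e : (fun x : R => Num.max (- x) 0) \o X = cst 0.
    by apply/funext => w; rewrite /= max_r// oppr_le0.
  have := same_law_Ex (hXi i) mm; rewrite e Ex_cst => <-//; exact: (L1_cst P 0).
have [p0 p1] := psi_centered hneg hth.
have EG i : Ex P (G \o Xs i) = 0 by rewrite Ex_proj.
have aeg := ae_eq_law hX (proj_ae hg).
have [_ mg _ _] := hg.
have LGX : L1 P (G \o X) by apply: (same_law_L1 _ mG (L1_proj 0%N)) => B mB; rewrite /= -hX.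
have EGX : Ex P (G \o X) = 0 by rewrite (same_law_Ex hX mG LGX) EG.
have mgX : measurable_fun [set: T] (EFin \o (g \o X)) by apply/measurable_EFinP; exact: measurableT_comp.
have mGX : measurable_fun [set: T] (EFin \o (G \o X)) by apply/measurable_EFinP; exact: measurableT_comp.
have egX : fine 'E_P[g \o X] = 0.
  by rewrite unlock -[RHS]EGX /Ex /Rintegral; congr fine; exact: ae_eq_integral.
have V2 : (\int[P]_w (G (X w) ^+ 2)%:E = s2%:E)%E.
  rewrite -hs /variance unlock egX unlock; apply: ae_eq_integral => //.
  - by apply/measurable_EFinP; apply: measurable_funX; exact/measurable_EFinP.
  - by apply/measurable_EFinP; apply: measurable_funM; apply: measurable_funB => //; exact/measurable_EFinP.
  - move: aeg; apply: filterS => w /= h _; have [e] := h I; congr EFin.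
    by rewrite -[RHS]/((g (X w) - 0) * (g (X w) - 0)) e subr0 expr2.
have L2GX : L2 P (G \o X).
  split; first exact/measurable_EFinP.
  apply/integrableP; split; first by apply/measurable_EFinP; apply: measurable_funX; exact/measurable_EFinP.
  rewrite (_ : integral _ _ _ = s2%:E) ?ltry//= -V2; apply: eq_integral => w _.
  by rewrite /= ger0_norm// sqr_ge0.
have m2 : measurable_fun [set: R] (fun x : R => G x ^+ 2) by exact: measurable_funX.
have L2G i : L2 P (G \o Xs i).
  split; first exact: measurableT_comp.
  by apply: (same_law_L1 (hXi i) m2); case: L2GX.
have VG i : Ex P (fun w => G (Xs i w) ^+ 2) = s2.
  rewrite -[LHS](same_law_Ex (hXi i) m2); last by case: L2GX.
  by rewrite /Ex /Rintegral V2.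
suff LX i : L2 P (Xs i).
  by split => [i|]; [split; [exact: LX|exact: L2G|exact: EG|exact: VG]|exact: p0].
(* At [theta = 1] the kernel would be null in mean, and so would its projection, against the
   positive variance. *)
have th1 : theta - 1 != 0.
  apply/eqP => th1; have /p1 e0 : theta = 1 by lra.
  have := Ex_norm0_sqr (L1_proj 0%N) _; rewrite [X in _ -> X = _](VG 0%N) => h.
  suff : s2 = 0 by lra.
  apply: h; apply/eqP; rewrite eq_le Ex_ge0// andbT -e0; exact: Ex_norm_proj.
suff L2X : L2 P X.
  split; first exact: measurable_funPT.
  by apply: (same_law_L1 (hXi i) (@exprn_measurable R setT 2)); case: L2X.
have mX : measurable_fun [set: T] X by exact: measurable_funPT.
(* For non-negative [x], [G x] differs from [(theta - 1) * x] by at most [K]. Division by the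
   non-zero slope bounds [X] by a square integrable variable. *)
pose K := (`|theta| + 1) * (Ex P (fun w => `|(obs_range Xs (iota 1 v.-1) w).1|) + Ex P (fun w => `|(obs_range Xs (iota 1 v.-1) w).2|)).
apply: L2_dom mX _ (L2Z `|theta - 1|^-1 (L2D (L2_norm L2GX) (L2_cst P K))) => w.
rewrite -[leLHS](mulKf (x := `|theta - 1|)) ?normr_eq0// ler_wpM2l// -normrM /=.
have := proj_kernel_affine theta v lX (X0 w); rewrite -/K -/G => h.
rewrite [X in `|X|](_ : _ = G (X w) - (G (X w) - (theta - 1) * X w)); last by lra.
by apply: le_trans (ler_normB _ _) _; rewrite lerD2l.
Qed.

End projection.

(** * Laws of large numbers *)

Section bilinearity.
Context {d : measure_display} {T : measurableType d} {R : realType}.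
Variable P : probability T R.

Lemma Ex_sum_mul (I : Type) (r : seq I) (Q : pred I) (f : I -> T -> R) (g : T -> R) :
  (forall i, L2 P (f i)) -> L2 P g ->
  Ex P (fun w => (\sum_(i <- r | Q i) f i w) * g w) = \sum_(i <- r | Q i) Ex P (fun w => f i w * g w).
Proof.
move=> lf lg; under eq_fun do rewrite mulr_suml.
by rewrite Ex_sum// => i _; exact: L2M.
Qed.

Lemma Ex_sum_sum (I J : Type) (r : seq I) (r' : seq J) (Q : pred I) (Q' : pred J)
    (f : I -> T -> R) (g : J -> T -> R) : (forall i, L2 P (f i)) -> (forall j, L2 P (g j)) ->
  Ex P (fun w => (\sum_(i <- r | Q i) f i w) * (\sum_(j <- r' | Q' j) g j w)) =
  \sum_(i <- r | Q i) \sum_(j <- r' | Q' j) Ex P (fun w => f i w * g j w).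
Proof.
move=> lf lg; rewrite Ex_sum_mul//; last by apply: L2_sum.
apply: eq_bigr => i _; under eq_fun do rewrite mulrC.
by rewrite Ex_sum_mul//; apply: eq_bigr => j _; under eq_fun do rewrite mulrC.
Qed.

Lemma Ex_sqrB (f g : T -> R) : L2 P f -> L2 P g ->
  Ex P (fun w => (f w - g w) ^+ 2) =
  Ex P (fun w => f w * f w) - 2 * Ex P (fun w => f w * g w) + Ex P (fun w => g w * g w).
Proof.
move=> lf lg; have ff := L2M lf lf; have fg := L2M lf lg; have gg := L2M lg lg.
rewrite -ExZ// -ExB//; last exact: L1Z.
rewrite -ExD//; last by apply: L1B => //; exact: L1Z.
by congr (Ex P _); apply/funext => w; ring.
Qed.

Lemma Ex_sqrD3 (f g h : T -> R) : L2 P f -> L2 P g -> L2 P h ->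
  Ex P (fun w => (f w + g w + h w) ^+ 2) <=
  3 * (Ex P (fun w => f w ^+ 2) + Ex P (fun w => g w ^+ 2) + Ex P (fun w => h w ^+ 2)).
Proof.
move=> lf lg lh; have [_ l] := L2D (L2D lf lg) lh.
have [[_ l1] [_ l2] [_ l3]] := And3 lf lg lh.
rewrite -!ExD//; last exact: L1D.
rewrite -ExZ; last by do 2 apply: L1D => //.
apply: Ex_le => //; first by apply: L1Z; do 2 apply: L1D => //.
move=> w; have := sqr_ge0 (f w - g w); have := sqr_ge0 (f w - h w); have := sqr_ge0 (g w - h w); nra.
Qed.

End bilinearity.

Section weak_law.
Context {d : measure_display} {T : measurableType d} {R : realType}.
Variable P : probability T R.
Variable Y : nat -> {mfun T >-> R}.
Hypothesis hlaw : forall i, same_law P (Y i) (Y 0%N).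
Hypothesis hindep : forall i j, i != j -> indep_fun P (Y i) (Y j).
Hypothesis lY : L1 P (Y 0%N).
Hypothesis Y0 : forall i w, 0 <= Y i w.

Let lawC i B : measurable B -> P (Y 0%N @^-1` B) = P (Y i @^-1` B).
Proof. by move=> mB; rewrite (hlaw i mB). Qed.

Let lYi i : L1 P (Y i) := same_law_L1 (lawC i) (@measurable_id _ R setT) lY.

(** Truncation: the bounded centred part is small in mean square by pairwise independence, and the
    excess over [M] is small in mean. Convergence in mean is the form to which Markov's inequality
    is applied later. *)
Lemma weak_law_L1 (e : R) : 0 < e -> exists N, forall n, (N <= n)%N ->
  Ex P (fun w => `|(\sum_(i < n) Y i w) / n%:R - Ex P (Y 0%N)|) <= e.
Proof.
move=> e0; have e40 : 0 < e / 4 by rewrite divr_gt0.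
have [M M0 [ltail htail]] := L1_tail lY (Y0 0%N) e40.
pose m := Ex P (fun w => Num.min (Y 0%N w) M).
pose f y : R := Num.min y M - m.
have mg : measurable_fun [set: R] (fun y : R => Num.min y M) by apply: measurable_minr.
have mf : measurable_fun [set: R] f by apply: measurable_funB.
have Z0 i w : 0 <= Num.min (Y i w) M <= M by rewrite le_min Y0 ltW//= ge_min lexx orbT.
have lZ i : L1 P (fun w => Num.min (Y i w) M).
  apply: (@L1_bounded _ _ _ _ _ M); first exact: (measurableT_comp mg).
  by move=> w; have /andP[h1 h2] := Z0 i w; rewrite ger0_norm.
have EZ i : Ex P (fun w => Num.min (Y i w) M) = m.
  exact/esym/(same_law_Ex (lawC i) mg)/lZ.
have EY i : Ex P (Y i) = Ex P (Y 0%N) by exact/esym/(same_law_Ex (lawC i) (@measurable_id _ R setT)).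
have m0 : 0 <= m <= M.
  rewrite Ex_ge0/=; last by move=> w; have /andP[] := Z0 0%N w.
  rewrite -[leRHS](Ex_cst P); apply: Ex_le => //; first exact: L1_cst.
  by move=> w; have /andP[] := Z0 0%N w.
have fM i w : `|f (Y i w)| <= M.
  by rewrite ler_norml /f; have /andP[h1 h2] := Z0 i w; case/andP: m0 => h3 h4; apply/andP; split; lra.
have lf i : L2 P (f \o Y i).
  exact: L2_dom (measurableT_comp mf _) (fM i) (L2_cst P M).
have Ef i : Ex P (f \o Y i) = 0.
  have l : L1 P (cst m) by exact: L1_cst.
  by rewrite /f /= (_ : _ \o _ = fun w => Num.min (Y i w) M - m)// ExB// EZ [X in _ - X]Ex_cst subrr.
have Effi i j : i != j -> Ex P (fun w => f (Y i w) * f (Y j w)) = 0.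
  by move=> ij; rewrite (indep_ExM (hindep ij) mf mf (lf i) (lf j)) Ef mul0r.
have Eff i : Ex P (fun w => f (Y i w) * f (Y i w)) <= M ^+ 2.
  rewrite -[leRHS](Ex_cst P); apply: Ex_le; [exact: (L2M (lf i) (lf i))|exact: L1_cst|move=> w].
  by rewrite -expr2 -[leLHS]ger0_norm ?sqr_ge0// normrX lerXn2r ?nnegrE// ltW.
(* Four quarters of [e] are spent. This threshold bounds the mean of [e^-1 * A ^+ 2] by one; the
   others are the constant in the Young inequality for [A], the mean of [B], and the shift of the
   centring by truncation. *)
exists (Num.truncn (4 * M ^+ 2 / e ^+ 2)).+1 => n Nn.
have n0 : 0 < n%:R :> R by rewrite ltr0n; exact: leq_trans Nn.
have nM : 4 * M ^+ 2 / e ^+ 2 <= n%:R.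
  by apply: ltW; apply: lt_le_trans (truncnS_gt _) _; rewrite ler_nat.
pose A w := (\sum_(i < n) f (Y i w)) / n%:R.
pose B w := (\sum_(i < n) (Y i w - Num.min (Y i w) M)) / n%:R.
have lS : L2 P (fun w => \sum_(i < n) f (Y i w)) by apply: L2_sum => i _; exact: lf.
have lA : L2 P A by rewrite /A; under eq_fun do rewrite mulrC; exact: L2Z.
have lsB : L1 P (fun w => \sum_(i < n) (Y i w - Num.min (Y i w) M)).
  by apply: L1_sum => i _; exact: L1B.
have lB : L1 P B by rewrite /B; under eq_fun do rewrite mulrC; exact: L1Z.
have EA2 : Ex P (fun w => A w ^+ 2) <= M ^+ 2 / n%:R.
  have -> : (fun w => A w ^+ 2) = (fun w => n%:R ^- 2 * ((\sum_(i < n) f (Y i w)) * (\sum_(i < n) f (Y i w)))).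
    by apply/funext => w; rewrite /A; field; rewrite gt_eqF.
  rewrite ExZ; last exact: L2M.
  have := Ex_sum_sum (index_enum 'I_n) (index_enum 'I_n) xpredT xpredT (fun i : 'I_n => lf i) (fun i : 'I_n => lf i).
  rewrite /comp => ->.
  rewrite ler_pdivrMl ?exprn_gt0// (_ : n%:R ^+ 2 * (M ^+ 2 / n%:R) = \sum_(i < n) M ^+ 2); last first.
    by rewrite sumr_const card_ord -mulr_natr; field; rewrite gt_eqF.
  apply: ler_sum => i _; rewrite (bigD1 i)//= big1 ?addr0 ?Eff// => j ji.
  by apply: Effi; rewrite eq_sym.
have EB : Ex P B = Ex P (Y 0%N) - m.
  have -> : B = (fun w => n%:R^-1 * \sum_(i < n) (Y i w - Num.min (Y i w) M)).
    by apply/funext => w; rewrite mulrC.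
  rewrite ExZ// Ex_sum; last by move=> i _; exact: L1B.
  under eq_bigr do rewrite ExB// EZ EY.
  by rewrite sumr_const card_ord -[X in _ * X]mulr_natl mulKf// gt_eqF.
have hd : 0 <= Ex P (Y 0%N) - m <= e / 4.
  rewrite /m -ExB//; apply/andP; split.
    by apply: Ex_ge0 => w; rewrite subr_ge0 ge_min lexx.
  apply: le_trans htail; apply: Ex_le => //; first exact: L1B.
  move=> w; case: ifPn => [h|]; first by rewrite gerBl; have /andP[] := Z0 0%N w.
  by rewrite -leNgt => h; rewrite min_l// subrr.
have lAB := L1D (L1D (L1Z e^-1 (proj2 lA)) (L1_cst P (e / 4))) (L1D lB (L1_cst P (e / 4))).
apply: le_trans (_ : Ex P (fun w => e^-1 * A w ^+ 2 + e / 4 + (B w + e / 4)) <= _).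
  apply: Ex_le => //.
    apply/L1_norm/L1B; last exact: L1_cst.
    by under eq_fun do rewrite mulrC; apply/L1Z/L1_sum.
  move=> w; have -> : (\sum_(i < n) Y i w) / n%:R - Ex P (Y 0%N) = A w + B w - (Ex P (Y 0%N) - m).
    rewrite /A /B -mulrDl -big_split /=.
    under [X in X / _ - (_ - _)]eq_bigr do rewrite /f.
    rewrite [X in _ = X / _ - _](eq_bigr (fun i : 'I_n => Y i w - m)); last by move=> i _; ring.
    by rewrite sumrB sumr_const card_ord -mulr_natr; field; rewrite gt_eqF.
  have B0 : 0 <= B w.
    by apply: divr_ge0 => //; apply: sumr_ge0 => i _; rewrite subr_ge0 ge_min lexx.
  have hA : `|A w| <= e^-1 * A w ^+ 2 + e / 4.
    rewrite -subr_ge0 (_ : _ - _ = e^-1 * (`|A w| - e / 2) ^+ 2); last first.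
      by rewrite sqrrB real_normK ?num_real//; field; rewrite gt_eqF.
    by rewrite mulr_ge0 ?sqr_ge0// invr_ge0 ltW.
  case/andP: hd => hd1 hd2.
  apply: le_trans (ler_normB _ _) _; apply: le_trans (lerD (ler_normD _ _) (lexx _)) _.
  by rewrite (ger0_norm B0) (ger0_norm hd1) -addrA lerD// lerD2l.
have lA2 := L1Z e^-1 (proj2 lA); have lq := L1_cst P (e / 4).
have -> : Ex P (fun w => e^-1 * A w ^+ 2 + e / 4 + (B w + e / 4)) = e^-1 * Ex P (fun w => A w ^+ 2) + e / 4 + (Ex P B + e / 4).
  by rewrite [LHS](ExD (L1D lA2 lq) (L1D lB lq)) (ExD lA2 lq) (ExD lB lq) (ExZ _ (proj2 lA)) Ex_cst.
rewrite EB.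
have : e^-1 * Ex P (fun w => A w ^+ 2) <= e / 4.
  rewrite ler_pdivrMl//; apply: le_trans EA2 _; rewrite ler_pdivrMr//.
  by move: nM; rewrite ler_pdivrMr ?exprn_gt0//; nra.
by case/andP: hd => _ h1 h2; lra.
Qed.

(** The truncation level grows with [n], so it eventually passes any fixed level with small tail.
    For squares this controls the maximum: a single value above [t * n] makes the average exceed
    [t]. *)
Lemma tail_average (t e : R) : 0 < t -> 0 < e -> exists N, forall n, (N <= n)%N ->
  L1 P (fun w => (\sum_(i < n) if t * n%:R < Y i w then Y i w else 0) / n%:R) /\
  Ex P (fun w => (\sum_(i < n) if t * n%:R < Y i w then Y i w else 0) / n%:R) <= e.
Proof.
move=> t0 e0; have [M M0 [ltail htail]] := L1_tail lY (Y0 0%N) e0.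
exists (Num.truncn (M / t)).+1 => n Nn.
have n0 : 0 < n%:R :> R by rewrite ltr0n; exact: leq_trans Nn.
have nM : M <= t * n%:R.
  rewrite mulrC -ler_pdivrMr//.
  by apply: ltW; apply: lt_le_trans (truncnS_gt _) _; rewrite ler_nat.
pose g y : R := if t * n%:R < y then y else 0.
have mg : measurable_fun [set: R] g.
  apply: measurable_fun_ifT => //; exact: measurable_fun_ltr.
have l0 : L1 P (g \o Y 0%N).
  apply: L1_dom _ _ lY => [|w]; first exact: measurableT_comp.
  by rewrite /g /=; case: ifP => _; rewrite ?normr0 ?Y0// ger0_norm.
have li i : L1 P (g \o Y i) := same_law_L1 (lawC i) mg l0.
have Ei i : Ex P (g \o Y i) = Ex P (g \o Y 0%N) by exact/esym/(same_law_Ex (lawC i) mg).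
have ls : L1 P (fun w => \sum_(i < n) g (Y i w)) by apply: L1_sum => i _; exact: li.
have -> : (fun w => (\sum_(i < n) if t * n%:R < Y i w then Y i w else 0) / n%:R) =
   (fun w => n%:R^-1 * \sum_(i < n) g (Y i w)) by apply/funext => w; rewrite mulrC.
split; first exact: L1Z.
rewrite ExZ// [X in _ * X](_ : _ = \sum_(i < n) Ex P (g \o Y i)); last first.
  by apply: Ex_sum => i _; exact: li.
under eq_bigr do rewrite Ei.
rewrite sumr_const card_ord -[X in _ * X]mulr_natl mulKf ?gt_eqF//.
apply: le_trans htail; apply: Ex_le => // w; rewrite /g /=.
case: ifPn => [h|_]; first by rewrite (le_lt_trans nM h).
by case: ifPn => // _; exact: Y0.
Qed.

End weak_law.

(** * Expansion of the log-likelihood ratio *)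

Section log_ratio_expansion.
Context {R : realType}.

(** The difference equals [((a - s * W) * (a + s * W) - W ^+ 2 * (q - s ^+ 2)) / q], with [q] at
    least [s ^+ 2 / 2]. *)
Lemma sqr_ratio_close (s M t h a W q : R) : 0 < s -> 0 <= M -> 0 < h ->
  h <= 1 -> 2 * h <= s ^+ 2 -> 4 * h * (2 * s * M + 1 + M ^+ 2) <= t * s ^+ 2 ->
  `|W| <= M -> `|a - s * W| <= h -> `|q - s ^+ 2| <= h -> `|a ^+ 2 / q - W ^+ 2| <= t / 2.
Proof.
move=> s0 M0 h0 h1 hs ht WM haW hq.
have q2 : s ^+ 2 / 2 <= q by move: hq; rewrite ler_norml => /andP[]; lra.
have s20 : 0 < s ^+ 2 by rewrite exprn_gt0.
have q0 : 0 < q by apply: lt_le_trans q2; rewrite divr_gt0.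
rewrite (_ : _ - _ = ((a - s * W) * (a + s * W) - W ^+ 2 * (q - s ^+ 2)) / q); last by field; rewrite gt_eqF.
rewrite normrM (gtr0_norm (x := q^-1)) ?invr_gt0// ler_pdivrMr//.
apply: le_trans (ler_normB _ _) _; rewrite !normrM.
have sW : `|s * W| <= s * M by rewrite normrM gtr0_norm// ler_wpM2l// ltW.
have asW : `|a + s * W| <= 2 * s * M + 1.
  rewrite (_ : a + s * W = (a - s * W) + (s * W + s * W)); last by ring.
  apply: le_trans (ler_normD _ _) _; have := ler_normD (s * W) (s * W); lra.
have W2 : `|W| * `|W| <= M ^+ 2 by rewrite expr2 ler_pM.
have e1 : `|a - s * W| * `|a + s * W| <= h * (2 * s * M + 1) by apply: ler_pM.
have e2 : `|W| * `|W| * `|q - s ^+ 2| <= M ^+ 2 * h by rewrite ler_pM// mulr_ge0.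
have t0 : 0 <= t.
  rewrite -(pmulr_lge0 _ s20); apply: le_trans ht; apply: mulr_ge0; first by rewrite mulr_ge0// ltW.
  by rewrite addr_ge0 ?sqr_ge0// addr_ge0// mulr_ge0// mulr_ge0// ltW.
have e3 : t / 2 * (s ^+ 2 / 2) <= t / 2 * q by rewrite ler_wpM2l// divr_ge0.
by lra.
Qed.

(** The likelihood part with no probability left in it: the tolerance [h] depends on [s], [M] and
    [t] only, so it is fixed before the sample size. *)
Lemma EL_ratio_expansion (s M t : R) : 0 < s -> 0 < M -> 0 < t ->
  exists2 h : R, 0 < h & forall n (V : 'I_n -> R) (W : R), (0 < n)%N -> `|W| <= M ->
    `|Num.sqrt n%:R * ((\sum_k V k) / n%:R) - s * W| <= h ->
    `|(\sum_k V k ^+ 2) / n%:R - s ^+ 2| <= h ->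
    (forall k, `|V k| <= h * Num.sqrt n%:R) ->
    0 < EL_ratio V /\ `|- 2 * ln (EL_ratio V) - W ^+ 2| <= t.
Proof.
move=> s0 M0 t0.
have s20 : 0 < s ^+ 2 by rewrite exprn_gt0.
have M20 : 0 < M ^+ 2 by rewrite exprn_gt0.
(* The relative error of the bounds on the ratio is at most [8 * e]; this choice makes it cost at
   most [t / 2] on quantities up to [M ^+ 2 + t]. *)
pose e := Num.min 8^-1 (t / (16 * (M ^+ 2 + t))).
have e0 : 0 < e by rewrite lt_min invr_gt0 ltr0n/= divr_gt0// mulr_gt0// addr_gt0.
have e8 : e <= 8^-1 by rewrite ge_min lexx.
have et : 16 * e * (M ^+ 2 + t) <= t.
  rewrite -mulrA [e * _]mulrC mulrA -ler_pdivlMl ?mulr_gt0 ?addr_gt0// mulrC.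
  by rewrite ge_min lexx orbT.
pose A := 2 * s * M + 1 + M ^+ 2.
have A0 : 0 < A by rewrite /A !addr_gt0// !mulr_gt0.
(* The first three terms serve [sqr_ratio_close]; the last one makes the product of the mean and the
   maximum small enough for [EL_ratio_bounds]. *)
pose h := Num.min (Num.min 1 (s ^+ 2 / 2)) (Num.min (t * s ^+ 2 / (4 * A)) (e * s ^+ 2 / (8 * (s * M + 1)))).
have sM : 0 < s * M + 1 by rewrite addr_gt0// mulr_gt0.
have h0 : 0 < h by rewrite !lt_min ltr01 !divr_gt0//= ?mulr_gt0.
have h1 : h <= 1 by rewrite !ge_min lexx.
have h2 : 2 * h <= s ^+ 2.
  have : h <= s ^+ 2 / 2 by rewrite !ge_min lexx orbT.
  lra.
have h3 : 4 * h * A <= t * s ^+ 2.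
  rewrite -mulrA [h * A]mulrC mulrA mulrC -ler_pdivlMr ?mulr_gt0//.
  by rewrite !ge_min lexx !orbT.
have h4 : 8 * h * (s * M + 1) <= e * s ^+ 2.
  rewrite -mulrA [h * _]mulrC mulrA mulrC -ler_pdivlMr ?mulr_gt0//.
  by rewrite !ge_min lexx !orbT.
exists h => // n V W n0 WM hS hV2 hV.
set S := (\sum_k V k) / n%:R in hS; set V2 := (\sum_k V k ^+ 2) / n%:R in hV2.
set r : R := Num.sqrt n%:R in hS hV.
have r0 : 0 < r by rewrite sqrtr_gt0 ltr0n.
have r2 : r ^+ 2 = n%:R by rewrite sqr_sqrtr.
have V2s : s ^+ 2 / 2 <= V2 by move: hV2; rewrite ler_norml => /andP[]; lra.
have V20 : 0 < V2 by apply: lt_le_trans V2s; rewrite divr_gt0.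
have hSM : `|S| * (h * r) <= e / 4 * V2.
  have : `|r * S| <= s * M + 1.
    rewrite -(subrK (s * W) (r * S)); apply: le_trans (ler_normD _ _) _.
    have : `|s * W| <= s * M by rewrite normrM gtr0_norm// ler_wpM2l// ltW.
    lra.
  rewrite normrM gtr0_norm// => hrS.
  have : e * (s ^+ 2 / 2) <= e * V2 by rewrite ler_wpM2l// ltW.
  have : h * (r * `|S|) <= h * (s * M + 1) by rewrite ler_wpM2l// ltW.
  rewrite (_ : `|S| * (h * r) = h * (r * `|S|)); last by ring.
  lra.
have e01 : 0 < e <= 8^-1 by rewrite e0.
have [EL0 lo up] := EL_ratio_bounds n0 erefl erefl V20 (mulr_gt0 h0 r0) hV e01 hSM.
split => //.
have cl := sqr_ratio_close s0 (ltW M0) h0 h1 h2 h3 WM hS hV2.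
have E : n%:R * S ^+ 2 / V2 = (r * S) ^+ 2 / V2 by rewrite [in RHS]exprMn r2.
rewrite -/S -/V2 E in lo up.
move: cl lo up; set a := _ / V2 => cl lo up.
have a0 : 0 <= a by rewrite divr_ge0 ?sqr_ge0// ltW.
have W2 : W ^+ 2 <= M ^+ 2 by rewrite -(ger0_norm (sqr_ge0 W)) normrX lerXn2r ?nnegrE// ltW.
move: cl; rewrite ler_norml => /andP[cl1 cl2].
have aM : a <= M ^+ 2 + t by lra.
have ea : e * a <= e * (M ^+ 2 + t) by rewrite ler_wpM2l// ltW.
have up' : - 2 * ln (EL_ratio V) <= a + 8 * (e * a).
  apply: le_trans up _; rewrite ler_pdivrMr; last lra.
  have ea0 : 0 <= e * a by apply: mulr_ge0 a0; exact: ltW.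
  have e80 : 0 <= 1 - 8 * e by lra.
  have := mulr_ge0 ea0 e80.
  lra.
by rewrite ler_norml; apply/andP; split; lra.
Qed.

End log_ratio_expansion.

(** * Convergence to the chi-square law *)

Section chi_square_limit.
Context {R : realType}.

Let N01 := normal_prob (0 : R) 1.

(** The distribution function of the square of a standard normal variable. [Num.sqrt] is zero on
    negative numbers, which gives the correct value zero there. *)
Definition chi1_cdf (y : R) : R := Phi (Num.sqrt y) - Phi (- Num.sqrt y).

Let chi1_cdf_arith (a b a' b' a1 b1 u r K : R) : a' <= a + (u + r - u) * K -> b <= b' + (- u - (- u - r)) * K ->
  a1 <= a' -> b' <= b1 -> a1 - b1 <= a - b + 2 * r * K.
Proof. by move=> *; lra. Qed.

(** Subadditivity of the square root and the Lipschitz bound for [Phi] give a modulus of continuity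
    uniform in [x], also at the origin, near which the density is unbounded. *)
Lemma chi1_cdf_step (x t : R) : 0 <= t -> chi1_cdf (x + t) <= chi1_cdf x + 2 * Num.sqrt t * normal_peak 1.
Proof.
move=> t0.
have h : Num.sqrt (x + t) <= Num.sqrt x + Num.sqrt t.
  have [x0|x0] := ltP x 0.
    by rewrite (ltr0_sqrtr x0) add0r ler_wsqrtr//; lra.
  rewrite -[leRHS]ger0_norm ?addr_ge0 ?sqrtr_ge0// -sqrtr_sqr ler_wsqrtr// sqrrD !sqr_sqrtr//.
  by have := mulr_ge0 (sqrtr_ge0 x) (sqrtr_ge0 t); lra.
have K0 : 0 <= normal_peak (1 : R) by rewrite normal_peak_ge0.
have tK : 0 <= Num.sqrt t * normal_peak (1 : R) by rewrite mulr_ge0 ?sqrtr_ge0.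
have /andP[_ h1] : Phi (Num.sqrt x) <= Phi (Num.sqrt x + Num.sqrt t) <= Phi (Num.sqrt x) + (Num.sqrt x + Num.sqrt t - Num.sqrt x) * normal_peak 1.
  by apply: Phi_lip; rewrite lerDl sqrtr_ge0.
have /andP[_ h2] : Phi (- Num.sqrt x - Num.sqrt t) <= Phi (- Num.sqrt x) <= Phi (- Num.sqrt x - Num.sqrt t) + (- Num.sqrt x - (- Num.sqrt x - Num.sqrt t)) * normal_peak 1.
  by apply: Phi_lip; rewrite gerBl sqrtr_ge0.
have /andP[h3 _] := Phi_lip h.
have h' : - Num.sqrt x - Num.sqrt t <= - Num.sqrt (x + t) by lra.
have /andP[h4 _] := Phi_lip h'.
exact: chi1_cdf_arith h1 h2 h3 h4.
Qed.

Lemma normal_prob_pt (a : R) : N01 [set a] = 0%E.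
Proof.
apply/eqP; rewrite eq_le measure_ge0 andbT; apply/lee_addgt0Pr => e e0; rewrite add0e.
have K0 : 0 < normal_peak (1 : R) by rewrite normal_peak_gt0// oner_neq0.
have d0 : 0 < e / normal_peak 1 by rewrite divr_gt0.
apply: (@le_trans _ _ (N01 `]a - e / normal_peak 1, a]%classic)).
  by apply: le_measure; rewrite ?inE//= => x ->; rewrite /= in_itv /= lexx andbT; lra.
apply: le_trans (normal_prob_itv_le _) _; first by lra.
by rewrite subKr divfK// gt_eqF.
Qed.

(** The set where [z ^+ 2 <= y] and the half-line up to [- Num.sqrt y] overlap in one point at most,
    which the normal law does not charge. *)
Lemma chi_square1_cdf (y : R) : chi_square1 R `]-oo, y]%classic = (chi1_cdf y)%:E.
Proof.
have -> : chi_square1 R `]-oo, y]%classic = N01 [set z | z ^+ 2 <= y].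
  by rewrite /chi_square1 /distribution /pushforward; congr (N01 _).
have [y0|y0] := ltP y 0.
  rewrite /chi1_cdf (ltr0_sqrtr y0) oppr0 subrr; have -> : [set z : R | z ^+ 2 <= y] = set0.
    by apply/seteqP; split => // z /=; have := sqr_ge0 z; lra.
  exact: measure0.
set a := Num.sqrt y; have a0 : 0 <= a by exact: sqrtr_ge0.
have f1 c : N01 `]-oo, c]%classic \is a fin_num by exact: fin_num_measure.
have E : [set z : R | z ^+ 2 <= y] `|` `]-oo, - a]%classic = `]-oo, a]%classic.
  apply/seteqP; split => z /=; rewrite !in_itv /=.
    case=> [h|]; last lra.
    apply: le_trans (ler_norm z) _; rewrite -sqrtr_sqr; exact: ler_wsqrtr.
  move=> za; have [h|h] := leP z (- a); [by right|left].
  rewrite -[leLHS]ger0_norm ?sqr_ge0// normrX -(sqr_sqrtr y0) -/a lerXn2r ?nnegrE//.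
  by rewrite ler_norml (ltW h).
have I : [set z : R | z ^+ 2 <= y] `&` `]-oo, - a]%classic `<=` [set - a].
  move=> z /= []; rewrite in_itv /= => h1 h2; apply/eqP; rewrite eq_le h2 /=.
  rewrite lerNl; apply: le_trans (ler_norm (- z)) _; rewrite normrN -sqrtr_sqr; exact: ler_wsqrtr.
have mS : measurable [set z : R | z ^+ 2 <= y] := measurable_sublevel (@exprn_measurable R setT 2) y.
have I0 : N01 ([set z : R | z ^+ 2 <= y] `&` `]-oo, - a]%classic) = 0%E.
  apply/eqP; rewrite eq_le measure_ge0 andbT -[leRHS](normal_prob_pt (- a)).
  by apply: le_measure; rewrite ?inE//; exact: measurableI.
have UE : N01 `]-oo, a]%classic = (N01 [set z : R | (z ^+ 2 <= y)%R] + N01 `]-oo, (- a)%R]%classic)%E.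
  rewrite -E; have := @measureUfinr _ _ _ N01 [set z : R | z ^+ 2 <= y] `]-oo, - a]%classic mS (measurable_itv _).
  rewrite -ge0_fin_numE// => /(_ (f1 _)) h; apply: etrans h _.
  by rewrite [X in (_ - X)%E](_ : _ = 0%E) ?sube0//; exact: I0.
have fS : N01 [set z : R | (z ^+ 2 <= y)%R] \is a fin_num by exact: fin_num_measure.
by rewrite /chi1_cdf /Phi -/N01 -/a UE fineD// addrK fineK.
Qed.

Variables (d : measure_display) (T : measurableType d) (P : probability T R).

Lemma fine_probability_le (A B : set T) : measurable A -> measurable B -> A `<=` B ->
  fine (P A) <= fine (P B).
Proof.
by move=> mA mB AB; rewrite fine_le ?fin_num_measure// le_measure ?inE.
Qed.

Lemma fine_probabilityU (A B : set T) : measurable A -> measurable B ->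
  fine (P (A `|` B)) <= fine (P A) + fine (P B).
Proof.
move=> mA mB; rewrite -fineD ?fin_num_measure//.
apply: fine_le; rewrite ?fin_numD ?fin_num_measure//; first exact: measurableU.
exact: measureU2.
Qed.

Let dist_le_up (y z x t : R) : y <= x -> `|y - z| <= t -> z <= x + t.
Proof. by move=> h; rewrite ler_norml => /andP[]; lra. Qed.

Let dist_le_dn (y z x t : R) : `|y - z| <= t -> z <= x - t -> y <= x.
Proof. by rewrite ler_norml => /andP[]; lra. Qed.

Let sandwich_arith (S S1 S2 p q1 q2 b e : R) : S1 <= S + e / 4 -> S <= S2 + e / 4 ->
  p <= q1 + b -> q2 <= p + b -> `|q1 - S1| <= e / 4 -> `|q2 - S2| <= e / 4 -> b <= e / 4 -> `|S - p| <= e.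
Proof.
move=> h1 h2 h3 h4; rewrite !ler_norml => /andP[h5 h6] /andP[h7 h8] h9.
by apply/andP; split; lra.
Qed.

(** Slutsky's argument: outside a small event, which also absorbs infinite values, [Y] lies within
    [t] of [W ^+ 2], so its distribution function is squeezed between two shifted ones, and the
    limit is uniformly continuous. *)
Lemma cvg_chi_square1 (W : nat -> T -> R) (Y : nat -> T -> \bar R) :
  (forall n, measurable_fun [set: T] (Y n)) -> (forall n, measurable_fun [set: T] (W n)) ->
  (forall c e : R, 0 < e -> exists N : nat, forall n, (N <= n)%N ->
    [/\ fine (P [set w | W n w <= c]) <= Phi c + e,
      Phi c - e <= fine (P [set w | W n w <= c]),
      fine (P [set w | W n w < c]) <= Phi c + e &
      Phi c - e <= fine (P [set w | W n w < c])]) ->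
  (forall t e : R, 0 < t -> 0 < e -> exists N : nat, forall n, (N <= n)%N ->
    exists B, [/\ measurable B, fine (P B) <= e &
      forall w, ~ B w -> exists2 y : R, Y n w = y%:E & `|y - W n w ^+ 2| <= t]) ->
  cvg_in_distribution P Y (chi_square1 R).
Proof.
move=> mY mW hW hB; split => // x _; rewrite chi_square1_cdf.
have mS n c := measurable_sublevel (measurable_funX 2 (mW n)) c.
have mlt n c := measurable_strict_sublevel (mW n) c.
have mYx n : measurable [set w | (Y n w <= x%:E)%E].
  have := measurable_preimage (mY n) (emeasurable_itv `]-oo, x%:E]).
  by congr (measurable _); apply/seteqP; split => z /=; rewrite in_itv.
have hS c e : 0 < e -> exists N : nat, forall n, (N <= n)%N -> `|fine (P [set w | W n w ^+ 2 <= c]) - chi1_cdf c| <= e.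
  move=> e0; have e20 : 0 < e / 2 by rewrite divr_gt0.
  have [c0|c0] := ltP c 0.
    exists 0%N => n _; rewrite /chi1_cdf (ltr0_sqrtr c0) oppr0 subrr subr0 (_ : [set w | _] = set0).
      by rewrite measure0 normr0 ltW.
    by apply/seteqP; split => // w /=; have := sqr_ge0 (W n w); lra.
  have [N1 h1] := hW (Num.sqrt c) _ e20; have [N2 h2] := hW (- Num.sqrt c) _ e20.
  exists (maxn N1 N2) => n; rewrite geq_max => /andP[/h1[a1 a2 _ _] /h2[_ _ a3 a4]].
  (* Keeping the second half-line open makes the union disjoint, so no boundary point has to be
     discarded. *)
  have E : [set w | W n w <= Num.sqrt c] = [set w | W n w ^+ 2 <= c] `|` [set w | W n w < - Num.sqrt c].
    apply/seteqP; split => w /=.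
      move=> h; have [h'|h'] := ltP (W n w) (- Num.sqrt c); [by right|left].
      rewrite -[leLHS]ger0_norm ?sqr_ge0// normrX -(sqr_sqrtr c0) lerXn2r ?nnegrE ?sqrtr_ge0//.
      by rewrite ler_norml h'.
    case=> [h|h]; last by apply: le_trans (ltW h) _; have := sqrtr_ge0 c; lra.
    by apply: le_trans (ler_norm _) _; rewrite -sqrtr_sqr ler_wsqrtr.
  have D : P [set w | W n w <= Num.sqrt c] = (P [set w | (W n w ^+ 2 <= c)%R] + P [set w | (W n w < - Num.sqrt c)%R])%E.
    rewrite E measureU//; apply/seteqP; split => // w [/= h1' h2'].
    have : `|W n w| <= Num.sqrt c by rewrite -sqrtr_sqr ler_wsqrtr.
    by rewrite ler_norml => /andP[]; rewrite leNgt h2'.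
  rewrite D fineD ?fin_num_measure// in a1 a2.
  by rewrite /chi1_cdf ler_norml; apply/andP; split; lra.
apply: cvg_EFin; first by apply: nearW => n; exact: fin_num_measure.
apply/cvgrPdist_le => e e0.
have e40 : 0 < e / 4 by rewrite divr_gt0.
have K0 : 0 < normal_peak (1 : R) by rewrite normal_peak_gt0// oner_neq0.
(* Chosen so that a shift by [t = r ^+ 2] moves the limit by at most [e / 4]. *)
pose r := e / (8 * normal_peak 1).
have r0 : 0 < r by rewrite divr_gt0// mulr_gt0.
pose t := r ^+ 2.
have t0 : 0 < t by rewrite exprn_gt0.
have rt : 2 * Num.sqrt t * normal_peak 1 = e / 4.
  by rewrite /t sqrtr_sqr gtr0_norm// /r; field; rewrite gt_eqF.
have up := chi1_cdf_step x (ltW t0); have dn := chi1_cdf_step (x - t) (ltW t0).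
rewrite subrK rt in dn; rewrite rt in up.
have [N1 h1] := hS (x + t) _ e40; have [N2 h2] := hS (x - t) _ e40.
have [N3 h3] := hB _ _ t0 e40.
exists (maxn N1 (maxn N2 N3)) => // n /=; rewrite !geq_max => /and3P[/h1 a1 /h2 a2 /h3[B [mB PB hBw]]].
have u1 : fine (P [set w | (Y n w <= x%:E)%E]) <= fine (P [set w | W n w ^+ 2 <= x + t]) + fine (P B).
  apply: le_trans (fine_probabilityU (mS n _) mB); apply: fine_probability_le => //.
    exact: measurableU.
  move=> w /= hw; have [Bw|Bw] := pselect (B w); [by right|left].
  have [y Yy] := hBw w Bw; move: hw; rewrite Yy lee_fin => hy.
  exact: dist_le_up.
have u2 : fine (P [set w | W n w ^+ 2 <= x - t]) <= fine (P [set w | (Y n w <= x%:E)%E]) + fine (P B).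
  apply: le_trans (fine_probabilityU (mYx n) mB); apply: fine_probability_le => //.
    exact: measurableU.
  move=> w /= hw; have [Bw|Bw] := pselect (B w); [by right|left].
  have [y Yy] := hBw w Bw; rewrite Yy lee_fin => h; exact: dist_le_dn h hw.
exact: (sandwich_arith up dn u1 u2 a1 a2 PB).
Qed.

End chi_square_limit.

(** * Deterministic control of the pseudo-values *)

Section pseudo_value_control.
Context {R : realType}.

Lemma norm_le_sqr (a b : R) : 0 <= b -> a ^+ 2 <= b ^+ 2 -> `|a| <= b.
Proof. by move=> b0; rewrite -[a ^+ 2](real_normK (num_real a)) ler_sqr ?nnegrE. Qed.

Lemma sum5_lt1 (a b c d e : R) : 0 <= a -> 0 <= b -> 0 <= c -> 0 <= d -> 0 <= e ->
  a + b + c + d + e < 1 -> [/\ a < 1, b < 1, c < 1, d < 1 & e < 1].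
Proof. by move=> *; split; lra. Qed.

(** Mean-square closeness of [V] to [c * g] serves twice: it passes to averages of squares by
    Young's inequality with weight [de], and to each single value because one squared difference is
    at most the whole sum. *)
Lemma pseudo_value_control (n : nat) (c s2 de h : R) (g V : 'I_n -> R) : (0 < n)%N ->
  0 <= c -> 0 <= s2 -> 0 < de -> de <= 1 -> de * (3 + c + c ^+ 2 * (s2 + 2)) <= h ->
  (\sum_k (V k - c * g k) ^+ 2) / n%:R < de ^+ 2 ->
  `|(\sum_k g k ^+ 2) / n%:R - s2| < de ->
  (\sum_k if de ^+ 2 * n%:R < g k ^+ 2 then g k ^+ 2 else 0) / n%:R < de ^+ 2 ->
  `|(\sum_k V k ^+ 2) / n%:R - (c ^+ 2) * s2| <= h /\ (forall k, `|V k| <= h * Num.sqrt n%:R).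
Proof.
move=> n0 c0 s20 de0 de1 hh hQ hG htail.
have nR0 : 0 < n%:R :> R by rewrite ltr0n.
set r : R := Num.sqrt n%:R.
have r0 : 0 <= r by exact: sqrtr_ge0.
have r2 : r ^+ 2 = n%:R by rewrite sqr_sqrtr.
have c2 : 0 <= c ^+ 2 by exact: sqr_ge0.
have hc : de * (c + 1) <= h.
  apply: le_trans hh; rewrite ler_wpM2l ?(ltW de0)//.
  by have := mulr_ge0 c2 (addr_ge0 s20 (ler0n R 2)); lra.
split.
- set Q := (\sum_k (V k - c * g k) ^+ 2) / n%:R in hQ.
  set G2 := (\sum_k g k ^+ 2) / n%:R in hG.
  have E : (\sum_k V k ^+ 2) / n%:R - c ^+ 2 * G2 = (\sum_k (V k ^+ 2 - c ^+ 2 * g k ^+ 2)) / n%:R.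
    by rewrite sumrB -mulr_sumr mulrBl /G2 mulrA.
  have H1 : `|(\sum_k V k ^+ 2) / n%:R - c ^+ 2 * G2| <= (1 + de^-1) * Q + de * c ^+ 2 * G2.
    rewrite E normrM (gtr0_norm (x := n%:R^-1)) ?invr_gt0//.
    rewrite /Q /G2 !mulrA -mulrDl ler_wpM2r ?invr_ge0 ?(ltW nR0)//.
    apply: le_trans (ler_norm_sum _ _ _) _.
    rewrite !mulr_sumr -big_split /=; apply: ler_sum => k _.
    have -> : V k ^+ 2 - c ^+ 2 * g k ^+ 2 = (V k - c * g k) ^+ 2 + 2 * (V k - c * g k) * (c * g k) by ring.
    have -> : (1 + de^-1) * (V k - c * g k) ^+ 2 + de * c * c * g k ^+ 2 =
       (V k - c * g k) ^+ 2 + (de^-1 * (V k - c * g k) ^+ 2 + de * (c * g k) ^+ 2) by ring.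
    apply: le_trans (ler_normD _ _) _; rewrite (ger0_norm (sqr_ge0 _)) lerD2l.
    set x := V k - c * g k; set y := c * g k.
    have : 0 <= de^-1 * (`|x| - de * `|y|) ^+ 2 by rewrite mulr_ge0 ?sqr_ge0 ?invr_ge0 ?ltW.
    rewrite (_ : de^-1 * _ = de^-1 * `|x| ^+ 2 - 2 * (`|x| * `|y|) + de * `|y| ^+ 2); last by field; rewrite gt_eqF.
    by rewrite !real_normK ?num_real// !normrM (ger0_norm (x := 2)) ?ler0n//; lra.
  have H2 : (1 + de^-1) * Q <= de ^+ 2 + de.
    apply: le_trans (ler_wpM2l _ (ltW hQ)) _; first by rewrite addr_ge0// invr_ge0 ltW.
    by rewrite le_eqVlt; apply/orP; left; apply/eqP; field; rewrite gt_eqF.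
  move: hG; rewrite ltr_norml => /andP[hG1 hG2].
  have H3 : de * c ^+ 2 * G2 <= de * c ^+ 2 * (s2 + 1).
    by rewrite ler_wpM2l ?mulr_ge0 ?(ltW de0)//; lra.
  have H4 : `|c ^+ 2 * G2 - c ^+ 2 * s2| <= c ^+ 2 * de.
    by rewrite -mulrBr normrM (ger0_norm c2) ler_wpM2l// ler_norml !ltW.
  have H5 : de ^+ 2 <= de by rewrite expr2 ler_piMr// ltW.
  have H6 : 0 <= de * c by rewrite mulr_ge0 // ltW.
  rewrite -(subrK (c ^+ 2 * G2) ((\sum_k V k ^+ 2) / n%:R)) -addrA.
  apply: le_trans (ler_normD _ _) _; apply: le_trans (lerD H1 H4) _.
  apply: le_trans hh; lra.
- move=> k.
  (* One index with [g k ^+ 2] above [de ^+ 2 * n] would alone push the truncated average beyond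
     [de ^+ 2]. *)
  have gk : `|g k| <= de * r.
    apply: norm_le_sqr; first by rewrite mulr_ge0// ltW.
    rewrite exprMn r2 leNgt; apply/negP => hk.
    move: htail; rewrite ltNge => /negP; apply.
    rewrite ler_pdivlMr// (bigD1 k)//= hk; apply: le_trans (ltW hk) _.
    by rewrite lerDl; apply: sumr_ge0 => i _; case: ifP => // _; exact: sqr_ge0.
  have Dk : `|V k - c * g k| <= de * r.
    apply: norm_le_sqr; first by rewrite mulr_ge0// ltW.
    rewrite exprMn r2 -ler_pdivrMr//; apply: le_trans (ltW hQ).
    rewrite ler_wpM2r ?invr_ge0 ?(ltW nR0)// (bigD1 k)//= lerDl.
    by apply: sumr_ge0 => i _; exact: sqr_ge0.
  rewrite -(subrK (c * g k) (V k)); apply: le_trans (ler_normD _ _) _.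
  apply: le_trans (_ : de * (c + 1) * r <= _); last by rewrite ler_wpM2r.
  rewrite normrM (ger0_norm c0).
  rewrite (_ : de * (c + 1) * r = de * r + c * (de * r)); last by ring.
  by rewrite lerD// ler_wpM2l.
Qed.

End pseudo_value_control.

(** * Hajek projection of the pseudo-values *)

Section asymptotics.
Context {d : measure_display} {T : measurableType d} {R : realType}.
Variable P : probability T R.
Variable Xs : nat -> {RV P >-> R}.
Hypothesis hindep : mutually_independent Xs.
Hypothesis hlaw : forall i, same_law P (Xs i) (Xs 0%N).
Variable theta : R.
Variable v : nat.
Hypothesis v1 : (1 < v)%N.
Hypothesis lX : forall i, L2 P (Xs i).
Variable s2 : R.

Let G := proj_kernel Xs theta v.
Hypothesis lG : forall i, L2 P (G \o Xs i).
Hypothesis EG : forall i, Ex P (G \o Xs i) = 0.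
Hypothesis VG : forall i, Ex P (fun w => G (Xs i w) ^+ 2) = s2.
Hypothesis Epsi0 : Ex P (fun w => psi theta (obs Xs (0%N :: iota 1 v.-1) w)) = 0.

Let lX1 i : L1 P (Xs i) := L2_L1 (lX i).
Let mG : measurable_fun [set: R] G := measurable_proj_kernel theta v lX1.
Let J0 := 0%N :: iota 1 v.-1.
Let uJ0 : uniq J0. Proof. by rewrite /= mem_iota iota_uniq. Qed.
Let sJ0 : size J0 = v. Proof. by rewrite /= size_iota (ltn_predK v1). Qed.

Definition kernel_var := Ex P (fun w => psi theta (obs Xs (0%N :: iota 1 v.-1) w) ^+ 2).
Let C := kernel_var.

Lemma kernel_var_ge0 : 0 <= C. Proof. by apply: Ex_ge0 => w; exact: sqr_ge0. Qed.

Lemma s2_ge0 : 0 <= s2. Proof. by rewrite -(VG 0); apply: Ex_ge0 => w; exact: sqr_ge0. Qed.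

Lemma psi_obs_mean J : uniq J -> size J = v -> Ex P (fun w => psi theta (obs Xs J w)) = 0.
Proof.
move=> uJ sJ; rewrite -Epsi0.
have e K : (fun w => psi theta (obs Xs K w)) = psi_range theta \o obs_range Xs K by apply/funext => w; rewrite psiE.
have := L1_psi_obs theta J lX1; rewrite !e => l.
by apply: (same_law_Ex (obs_range_law hindep hlaw uJ uJ0 _) (measurable_psi_range theta) l); rewrite sJ sJ0.
Qed.

Lemma psi_obs_var J : uniq J -> size J = v -> Ex P (fun w => psi theta (obs Xs J w) ^+ 2) = C.
Proof.
move=> uJ sJ.
have e K : (fun w => psi theta (obs Xs K w) ^+ 2) = (fun u => psi_range theta u ^+ 2) \o obs_range Xs K by apply/funext => w; rewrite psiE.
have [_] := L2_psi_obs theta J lX; rewrite /C /kernel_var !e => l.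
apply: (same_law_Ex (obs_range_law hindep hlaw uJ uJ0 _) _ l); first by rewrite sJ sJ0.
by apply: measurable_funX; exact: measurable_psi_range.
Qed.

Lemma psi_obs_cov_le J K : uniq J -> size J = v -> uniq K -> size K = v ->
  Ex P (fun w => psi theta (obs Xs J w) * psi theta (obs Xs K w)) <= C.
Proof.
move=> uJ sJ uK sK.
have lJ := L2_psi_obs theta J lX; have lK := L2_psi_obs theta K lX.
have [_ l1] := lJ; have [_ l2] := lK.
have -> : C = Ex P (fun w => 2^-1 * (psi theta (obs Xs J w) ^+ 2 + psi theta (obs Xs K w) ^+ 2)).
  by rewrite ExZ ?ExD ?psi_obs_var//; [lra|exact: L1D].
apply: Ex_le => [||w]; [exact: L2M|exact/L1Z/L1D|].
by have := sqr_ge0 (psi theta (obs Xs J w) - psi theta (obs Xs K w)); rewrite sqrrB; lra.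
Qed.

Lemma psi_obs_cov0 J K : uniq (J ++ K) -> size J = v ->
  Ex P (fun w => psi theta (obs Xs J w) * psi theta (obs Xs K w)) = 0.
Proof.
move=> uJK sJ.
have e L : psi_range theta \o obs_range Xs L = (fun w => psi theta (obs Xs L w)) by apply/funext => w; rewrite [RHS]psiE.
have -> : (fun w => psi theta (obs Xs J w) * psi theta (obs Xs K w)) =
   (fun w => psi_range theta (obs_range Xs J w) * psi_range theta (obs_range Xs K w)).
  by apply/funext => w; rewrite !psiE.
have i := obs_range_indep hindep uJK; have m2 := measurable_psi_range theta.
rewrite (indep_ExM i m2 m2) !e; [|exact: L2_psi_obs|exact: L2_psi_obs].
by rewrite psi_obs_mean ?mul0r//; move: uJK; rewrite cat_uniq => /andP[].
Qed.

Lemma psi_obs_proj j J : uniq (j :: J) -> size (j :: J) = v ->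
  Ex P (fun w => G (Xs j w) * psi theta (obs Xs (j :: J) w)) = s2.
Proof.
move=> uJ sJ.
have sJ' : size J = v.-1 by rewrite -sJ.
have [_ ->] := Ex_mul_psi hindep hlaw v1 lX1 uJ sJ' mG (L2M (lG j) (L2_psi_obs theta (j :: J) lX)).
by rewrite -(VG j); congr (Ex P _); apply/funext => w; rewrite expr2.
Qed.

Lemma psi_obs_proj0 j J : uniq (j :: J) -> size J = v ->
  Ex P (fun w => G (Xs j w) * psi theta (obs Xs J w)) = 0.
Proof.
move=> uJ sJ.
have e L : psi_range theta \o obs_range Xs L = (fun w => psi theta (obs Xs L w)) by apply/funext => w; rewrite [RHS]psiE.
have -> : (fun w => G (Xs j w) * psi theta (obs Xs J w)) = (fun w => G (Xs j w) * psi_range theta (obs_range Xs J w)).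
  by apply/funext => w; rewrite !psiE.
rewrite (indep_ExM (Xs_obs_range_indep hindep uJ) mG (measurable_psi_range theta) (lG j)) ?e; last exact: L2_psi_obs.
by rewrite EG mul0r.
Qed.

Lemma Xs_indep i j : i != j -> indep_fun P (Xs i) (Xs j).
Proof.
move=> ij; apply: (@block_indep _ _ _ _ _ hindep _ _ _ _ [:: i] [:: j]).
- by rewrite /= inE ij.
- by apply: block_coord; rewrite mem_head.
- by apply: block_coord; rewrite mem_head.
Qed.

Lemma proj_cov i j : Ex P (fun w => G (Xs i w) * G (Xs j w)) = if i == j then s2 else 0.
Proof.
have [->|ij] := eqVneq i j.
  by rewrite -(VG j); congr (Ex P _); apply/funext => w; rewrite expr2.
by rewrite (indep_ExM (Xs_indep ij) mG mG (lG i) (lG j)) EG mul0r.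
Qed.

(** With [Xs i] and the block [J] frozen, integrating out the block [K] replaces the second kernel
    by [G], which reduces the claim to [psi_obs_proj]. *)
Lemma psi_obs_cov1 i J K : uniq (i :: J ++ K) -> size J = v.-1 -> size K = v.-1 ->
  Ex P (fun w => psi theta (obs Xs (i :: J) w) * psi theta (obs Xs (i :: K) w)) = s2.
Proof.
move=> uJK sJ sK.
have Jn : J != [::] by rewrite -size_eq0 sJ; case: (v) v1 => [|[]].
have Kn : K != [::] by rewrite -size_eq0 sK; case: (v) v1 => [|[]].
pose W w := (Xs i w, obs_range Xs J w).
have mW : measurable_fun [set: T] W.
  by apply: measurable_fun_pair; [exact: measurable_funPT|exact: measurable_obs_range].
pose WW : {mfun T >-> (R * (R * R))%type} := mfun_Sub (mem_set mW).
have iW : indep_fun P WW (obs_range Xs K).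
  apply: (@block_indep _ _ _ _ _ hindep _ _ _ _ (i :: J) K) => //; last exact: block_obs_range.
  apply: measurable_fun_pair; first by apply: block_coord; rewrite mem_head.
  by apply: block_obs_range => j jJ; rewrite inE jJ orbT.
pose f (p : (R * (R * R)) * (R * R)) := psi_insert theta p.1.1 p.1.2 * psi_insert theta p.1.1 p.2.
have mf : measurable_fun setT f.
  apply: measurable_funM; first exact: (measurableT_comp (measurable_psi_insert theta)).
  have m : measurable_fun setT (fun p : (R * (R * R)) * (R * R) => (p.1.1, p.2)).
    by apply: measurable_fun_pair => //; apply: measurableT_comp.
  exact: (measurableT_comp (measurable_psi_insert theta) m).
have E w : psi theta (obs Xs (i :: J) w) * psi theta (obs Xs (i :: K) w) = f (WW w, obs_range Xs K w).
  by rewrite !psi_obs_cons.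
have lf : L1 P (fun w => f (WW w, obs_range Xs K w)).
  by apply: L1_ext E _; apply: L2M; exact: L2_psi_obs.
have lw w : L1 P (fun w' => f (WW w, obs_range Xs K w')).
  exact: (L1Z (psi_insert theta (Xs i w) (obs_range Xs J w)) (L1_psi_insert_obs theta K (Xs i w) lX1)).
have [_ e] := indep_Rintegral iW mf lf lw.
under eq_fun do rewrite E.
rewrite e -(@psi_obs_proj i J); last 2 first.
- by move: uJK; rewrite -cat_cons cat_uniq => /andP[].
- by rewrite /= sJ (ltn_predK v1).
congr (Ex P _); apply/funext => w.
rewrite psi_obs_cons// mulrC /f /=.
rewrite /G -(proj_kernel_law hindep hlaw theta (v := v) lX1 (J := K))//; last first.
  by move: uJK; rewrite cons_uniq cat_uniq => /and4P[].
by rewrite -ExZ//; exact: L1_psi_insert_obs.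
Qed.

(** * Covariances of kernels over overlapping subsets *)

Section sets.
Variable n : nat.
Implicit Types (A B : {set 'I_n}) (i k : 'I_n).

Definition sample_psi A w := psi theta [seq Xs (val i) w | i <- enum A].

Let block A : seq nat := [seq val i | i <- enum A].

Let sample_psiE A w : sample_psi A w = psi theta (obs Xs (block A) w).
Proof. by rewrite /obs /block -map_comp. Qed.

Let block_uniq A : uniq (block A).
Proof. by rewrite map_inj_uniq ?enum_uniq//; exact: val_inj. Qed.

Let size_block A : size (block A) = #|A|. Proof. by rewrite size_map cardE. Qed.

Let mem_block A i : (val i \in block A) = (i \in A).
Proof. by rewrite mem_map ?mem_enum//; exact: val_inj. Qed.

Let sample_psi_through A i w : i \in A -> sample_psi A w = psi theta (obs Xs (val i :: block (A :\ i)%SET) w).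
Proof.
move=> iA; rewrite sample_psiE; apply: psi_perm; apply: perm_map.
rewrite -[_ :: _]/(map val (i :: enum (A :\ i)%SET)); apply: perm_map.
apply: uniq_perm; rewrite ?enum_uniq//= ?enum_uniq ?andbT ?mem_enum ?finset.in_setD1 ?eqxx// => j.
by rewrite inE !mem_enum finset.in_setD1; case: eqP => // ->.
Qed.

Let block_through A i : i \in A -> #|A| = v -> uniq (val i :: block (A :\ i)%SET) /\ size (block (A :\ i)%SET) = v.-1.
Proof.
move=> iA cA; rewrite /= mem_block finset.in_setD1 eqxx block_uniq size_block; split => //.
by have := finset.cardsD1 i A; rewrite iA cA; case: (v) v1 => // m _ [].
Qed.

Let block_cat A B : (A :&: B)%SET = finset.set0 -> uniq (block A ++ block B).
Proof.
move=> AB; rewrite cat_uniq !block_uniq andbT /=; apply/hasPn => _ /mapP[i iB ->].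
move: iB; rewrite mem_enum /= mem_block => iB; apply/negP => iA.
by have : i \in (A :&: B)%SET; [rewrite finset.inE iA|rewrite AB finset.inE].
Qed.

Lemma L2_sample_psi A : L2 P (sample_psi A).
Proof.
have -> : sample_psi A = (fun w => psi theta (obs Xs (block A) w)) by apply/funext => w; rewrite sample_psiE.
exact: L2_psi_obs.
Qed.

Lemma sample_psi_proj A k : #|A| = v ->
  Ex P (fun w => sample_psi A w * G (Xs k w)) = if k \in A then s2 else 0.
Proof.
move=> cA; case: ifPn => kA.
  have [u s] := block_through kA cA.
  rewrite -(@psi_obs_proj (val k) _ u); last by rewrite /= s (ltn_predK v1).
  by congr (Ex P _); apply/funext => w; rewrite (sample_psi_through _ kA) mulrC.
rewrite -(@psi_obs_proj0 (val k) (block A)) ?size_block//; last by rewrite /= mem_block kA block_uniq.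
by congr (Ex P _); apply/funext => w; rewrite sample_psiE mulrC.
Qed.

Lemma sample_psi_cov_le A B : #|A| = v -> #|B| = v -> Ex P (fun w => sample_psi A w * sample_psi B w) <= C.
Proof.
move=> cA cB; have := @psi_obs_cov_le (block A) (block B); rewrite !size_block => /(_ _ cA _ cB).
by under eq_fun do rewrite -!sample_psiE; apply.
Qed.

Lemma sample_psi_cov0 A B : #|A| = v -> #|A :&: B|%SET = 0%N -> Ex P (fun w => sample_psi A w * sample_psi B w) = 0.
Proof.
move=> cA /eqP; rewrite finset.cards_eq0 => /eqP AB.
have := @psi_obs_cov0 (block A) (block B) (block_cat AB); rewrite size_block => /(_ cA).
by under eq_fun do rewrite -!sample_psiE.
Qed.

Lemma sample_psi_cov1 A B : #|A| = v -> #|B| = v -> #|A :&: B|%SET = 1%N ->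
  Ex P (fun w => sample_psi A w * sample_psi B w) = s2.
Proof.
move=> cA cB /eqP/finset.cards1P[i ABi].
have : i \in (A :&: B)%SET by rewrite ABi finset.set11.
rewrite finset.inE => /andP[iA iB].
have [uA sA] := block_through iA cA; have [uB sB] := block_through iB cB.
rewrite -(@psi_obs_cov1 (val i) _ _ _ sA sB).
  by congr (Ex P _); apply/funext => w; rewrite (sample_psi_through _ iA) (sample_psi_through _ iB).
have AB' : ((A :\ i) :&: (B :\ i))%SET = finset.set0.
  apply/finset.setP => j; rewrite !finset.inE.
  apply/negP => /andP[/andP[ji jA] /andP[_ jB]].
  have : j \in (A :&: B)%SET by rewrite finset.inE jA.
  by rewrite ABi finset.inE (negbTE ji).
rewrite cons_uniq block_cat// andbT mem_cat negb_or.
by move: uA uB => /= /andP[-> _] /andP[-> _].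
Qed.

(* A crude bound suffices for overlaps of two or more indices, which are rare. *)
Lemma sample_psi_cov A B : #|A| = v -> #|B| = v ->
  Ex P (fun w => sample_psi A w * sample_psi B w) <=
  s2 * #|A :&: B|%SET%:R + C * (#|A :&: B|%SET * #|A :&: B|%SET.-1)%:R.
Proof.
move=> cA cB; case E : #|_|%SET => [|[|m]].
- by rewrite sample_psi_cov0// !mulr0 addr0.
- by rewrite sample_psi_cov1// mulr1 muln0 mulr0 addr0.
apply: le_trans (sample_psi_cov_le cA cB) _.
apply: le_trans (_ : C * (m.+2 * m.+2.-1)%:R <= _).
  by rewrite ler_peMr ?kernel_var_ge0// ler1n.
by rewrite lerDr mulr_ge0// s2_ge0.
Qed.

(** The overlap already contains [k], so the crude bound is charged only to further common
    indices. *)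
Lemma sample_psi_cov_through A B k : #|A| = v -> #|B| = v -> k \in A -> k \in B ->
  Ex P (fun w => sample_psi A w * sample_psi B w) <= s2 + C * (#|A :&: B|%SET.-1)%:R.
Proof.
move=> cA cB kA kB; case E : #|_|%SET => [|[|m]].
- have : k \in (A :&: B)%SET by rewrite finset.inE kA.
  by move/eqP : E; rewrite finset.cards_eq0 => /eqP ->; rewrite finset.inE.
- by rewrite sample_psi_cov1// mulr0 addr0.
apply: le_trans (sample_psi_cov_le cA cB) _.
apply: le_trans (_ : C * (m.+2.-1)%:R <= _).
  by rewrite ler_peMr ?kernel_var_ge0// ler1n.
by rewrite lerDr s2_ge0.
Qed.

End sets.

(** * Mean-square errors of the Hajek projection *)

Section sample.
Variable n : nat.
(** The sample has size [n.+1]. The assumption makes [n.+1 - v] at least half of it, which bounds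
    the factor [al] in [pseudo_value_hajek]. *)
Hypothesis vn : (v.*2 <= n.+1)%N.

Let x w (i : 'I_n.+1) := Xs i w.
Let U w := Usum v (psi theta) (x w).
Let Uk k w := Usum_through v (psi theta) (x w) k.
Let H w := \sum_(i < n.+1) G (Xs i w).
(** [c1] and [c2] count the [v]-subsets of the sample through one and through two given indices. *)
Let c1 : R := 'C(n, v.-1)%:R.
Let c2 : R := 'C(n.-1, v.-2)%:R.

Let lpsi (A : {set 'I_n.+1}) : L2 P (sample_psi A) := L2_sample_psi A.

Let lU : L2 P U. Proof. by apply: L2_sum => A _; exact: lpsi. Qed.

Let lUk k : L2 P (Uk k). Proof. by apply: L2_sum => A _; exact: lpsi. Qed.

Let lH : L2 P H. Proof. by apply: L2_sum => i _; exact: lG. Qed.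

Let EUU : Ex P (fun w => U w * U w) <= s2 * (n.+1%:R * c1 ^+ 2) + C * (n.+1%:R * n%:R * c2 ^+ 2).
Proof.
rewrite [leLHS](Ex_sum_sum _ _ _ _ lpsi lpsi).
have -> : n.+1%:R * c1 ^+ 2 = \sum_(A : {set 'I_n.+1} | #|A| == v) \sum_(B : {set 'I_n.+1} | #|B| == v) #|A :&: B|%SET%:R.
  rewrite /c1 -natrX -natrM -(@sum_card_setI n.+1 v)//; last exact: ltnW.
  by rewrite natr_sum; apply: eq_bigr => A _; rewrite natr_sum.
have -> : n.+1%:R * n%:R * c2 ^+ 2 = \sum_(A : {set 'I_n.+1} | #|A| == v) \sum_(B : {set 'I_n.+1} | #|B| == v) (#|A :&: B|%SET * #|A :&: B|%SET.-1)%:R.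
  rewrite /c2 -natrX -!natrM -(@sum_card_setI_pairs n.+1 v)//.
  by rewrite natr_sum; apply: eq_bigr => A _; rewrite natr_sum.
rewrite !mulr_sumr -big_split /=; apply: ler_sum => A /eqP cA.
rewrite !mulr_sumr -big_split /=; apply: ler_sum => B /eqP cB.
exact: sample_psi_cov.
Qed.

Let EUkUk k : Ex P (fun w => Uk k w * Uk k w) <= s2 * c1 ^+ 2 + C * (n%:R * c2 ^+ 2).
Proof.
rewrite [leLHS](Ex_sum_sum _ _ _ _ lpsi lpsi).
have c1E : c1 = \sum_(A : {set 'I_n.+1} | (#|A| == v) && (k \in A)) 1.
  rewrite /c1 -(@sum_sets1 n.+1 v k); last exact: ltnW.
  by rewrite natr_sum [RHS]big_mkcondr; apply: eq_bigr => A _; case: (k \in A).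
have -> : c1 ^+ 2 = \sum_(A : {set 'I_n.+1} | (#|A| == v) && (k \in A)) \sum_(B : {set 'I_n.+1} | (#|B| == v) && (k \in B)) 1.
  by rewrite expr2 {1}c1E mulr_suml; apply: eq_bigr => A _; rewrite mul1r c1E.
have -> : n%:R * c2 ^+ 2 = \sum_(A : {set 'I_n.+1} | (#|A| == v) && (k \in A)) \sum_(B : {set 'I_n.+1} | (#|B| == v) && (k \in B)) (#|A :&: B|%SET.-1)%:R.
  rewrite /c2 -natrX -!natrM -(@sum_card_setI_through n.+1 v k)//.
  by rewrite natr_sum; apply: eq_bigr => A _; rewrite natr_sum.
rewrite !mulr_sumr -big_split /=; apply: ler_sum => A /andP[/eqP cA kA].
rewrite !mulr_sumr -big_split /=; apply: ler_sum => B /andP[/eqP cB kB].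
by rewrite [s2 * 1]mulr1; exact: sample_psi_cov_through cA cB kA kB.
Qed.

Let EUG (k : 'I_n.+1) : Ex P (fun w => U w * G (Xs (val k) w)) = c1 * s2.
Proof.
rewrite [LHS](Ex_sum_mul _ _ lpsi (lG k)) /c1 -(@sum_sets1 n.+1 v k); last exact: ltnW.
rewrite natr_sum mulr_suml; apply: eq_bigr => A /eqP cA.
rewrite [LHS]sample_psi_proj//.
by case: (k \in A); rewrite ?mul1r ?mul0r.
Qed.

Let EUkG k : Ex P (fun w => Uk k w * G (Xs (val k) w)) = c1 * s2.
Proof.
rewrite [LHS](Ex_sum_mul _ _ lpsi (lG k)) /c1 -(@sum_sets1 n.+1 v k); last exact: ltnW.
rewrite natr_sum mulr_suml big_mkcondr; apply: eq_bigr => A /eqP cA.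
case: ifPn => kA; rewrite ?mul0r// mul1r.
by rewrite [LHS]sample_psi_proj// kA.
Qed.

Let EUH : Ex P (fun w => U w * H w) = n.+1%:R * (c1 * s2).
Proof.
under eq_fun do rewrite mulrC.
rewrite [LHS](Ex_sum_mul _ _ (fun i : 'I_n.+1 => lG i) lU).
under eq_bigr => i _ do (under eq_fun => w do rewrite mulrC; rewrite EUG).
by rewrite sumr_const card_ord mulr_natl.
Qed.

Lemma Ex_sum_proj_sqr : Ex P (fun w => H w * H w) = n.+1%:R * s2.
Proof.
rewrite [LHS](Ex_sum_sum _ _ _ _ (fun i : 'I_n.+1 => lG i) (fun i : 'I_n.+1 => lG i)).
transitivity (\sum_(i < n.+1) s2); last by rewrite sumr_const card_ord mulr_natl.
apply: eq_bigr => i _; rewrite (bigD1 i)//= big1 ?addr0.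
  by rewrite [LHS]proj_cov// eqxx.
move=> j ji; rewrite [LHS]proj_cov ifN//.
by rewrite eq_sym; exact: ji.
Qed.

Let n0 : (0 < n)%N. Proof. by case: (n) vn => //; case: (v) v1 => // -[]. Qed.
Let vn' : (v <= n)%N. Proof. by move: vn v1; lia. Qed.
Let nR0 : 0 < n%:R :> R. Proof. by rewrite ltr0n. Qed.
Let c1_gt0 : 0 < c1. Proof. by rewrite ltr0n bin_gt0; move: vn'; lia. Qed.
Let c2E : n%:R * c2 = (v%:R - 1) * c1.
Proof.
rewrite /c1 /c2; case: (v) v1 => [|[|m]] // _.
by rewrite -natr1 addrK -!natrM /= mul_bin_diag.
Qed.
Let c0E : v%:R * 'C(n, v)%:R = (n.+1%:R - v%:R) * c1.
Proof.
have vn2 := vn'.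
rewrite /c1; case: (v) v1 vn2 => // m _ mn.
rewrite -!natrM mul_bin_left natrM natrB; last exact: ltnW.
by congr (_ * _); rewrite -!natr1; ring.
Qed.
Let cNE : n.+1%:R * c1 = v%:R * 'C(n.+1, v)%:R.
Proof. by rewrite /c1; case: (v) v1 => // m _; rewrite -!natrM -mul_bin_diag. Qed.

Let s20 : 0 <= s2. Proof. exact: s2_ge0. Qed.
Let C0 : 0 <= C. Proof. exact: kernel_var_ge0. Qed.

Let c2sq : c2 ^+ 2 = (v%:R - 1) ^+ 2 * c1 ^+ 2 / n%:R ^+ 2.
Proof. by rewrite -exprMn -c2E exprMn mulrAC mulfV ?mul1r// expf_neq0// gt_eqF. Qed.

Let lUc : L2 P (fun w => U w / c1). Proof. by under eq_fun do rewrite mulrC; exact: L2Z. Qed.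

Let lUkc k : L2 P (fun w => Uk k w / c1). Proof. by under eq_fun do rewrite mulrC; exact: L2Z. Qed.

(** The terms in [s2] cancel: the second moment of [U / c1] brings [n.+1 * s2], the cross term
    removes it twice and the second moment of [H] restores it once. What remains comes from overlaps
    of two or more. *)
Let EdU : Ex P (fun w => (U w / c1 - H w) ^+ 2) <= C * (v%:R - 1) ^+ 2 * n.+1%:R / n%:R.
Proof.
have -> : (fun w => (U w / c1 - H w) ^+ 2) = (fun w => c1 ^- 2 * (U w - c1 * H w) ^+ 2).
  by apply/funext => w; rewrite -exprVn -exprMn; congr (_ ^+ 2); field; rewrite gt_eqF.
have lU' := lU; have lH' := L2Z c1 lH; have [_ l] := L2B lU' lH'.
rewrite ExZ// (Ex_sqrB lU' lH').
have -> : Ex P (fun w => U w * (c1 * H w)) = c1 * Ex P (fun w => U w * H w).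
  by rewrite -ExZ; [congr (Ex P _); apply/funext => w; ring|exact: L2M].
have -> : Ex P (fun w => c1 * H w * (c1 * H w)) = c1 ^+ 2 * Ex P (fun w => H w * H w).
  by rewrite -ExZ; [congr (Ex P _); apply/funext => w; ring|exact: L2M].
rewrite EUH Ex_sum_proj_sqr ler_pdivrMl ?exprn_gt0//.
have := EUU; rewrite c2sq => h.
apply: le_trans (lerD (lerB h (lexx _)) (lexx _)) _.
by rewrite le_eqVlt; apply/orP; left; apply/eqP; field; rewrite gt_eqF.
Qed.

Let EU : Ex P (fun w => (U w / c1) ^+ 2) <= n.+1%:R * (s2 + C * (v%:R - 1) ^+ 2).
Proof.
have -> : (fun w => (U w / c1) ^+ 2) = (fun w => c1 ^- 2 * (U w * U w)).
  by apply/funext => w; field; rewrite gt_eqF.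
rewrite ExZ; last exact: L2M.
rewrite ler_pdivrMl ?exprn_gt0//; apply: le_trans EUU _; rewrite c2sq.
rewrite (_ : _ + _ = c1 ^+ 2 * (n.+1%:R * s2 + n.+1%:R * (C * (v%:R - 1) ^+ 2) / n%:R)); last by field; rewrite gt_eqF.
rewrite ler_wpM2l ?sqr_ge0// mulrDr lerD2l ler_pdivrMr// ler_peMr ?ler1n//.
by rewrite mulr_ge0// mulr_ge0// sqr_ge0.
Qed.

Let EdUk k : Ex P (fun w => (Uk k w / c1 - G (Xs (val k) w)) ^+ 2) <= C * (v%:R - 1) ^+ 2 / n%:R.
Proof.
have -> : (fun w => (Uk k w / c1 - G (Xs (val k) w)) ^+ 2) = (fun w => c1 ^- 2 * (Uk k w - c1 * G (Xs (val k) w)) ^+ 2).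
  by apply/funext => w; rewrite -exprVn -exprMn; congr (_ ^+ 2); field; rewrite gt_eqF.
have lU' := lUk k; have lG0 := lG (val k); have lH' := L2Z c1 lG0; have [_ l] := L2B lU' lH'.
rewrite ExZ// (Ex_sqrB lU' lH').
have -> : Ex P (fun w => Uk k w * (c1 * (G \o Xs (val k)) w)) = c1 * Ex P (fun w => Uk k w * G (Xs (val k) w)).
  by rewrite -ExZ; [congr (Ex P _); apply/funext => w /=; ring|exact: L2M].
have -> : Ex P (fun w => c1 * (G \o Xs (val k)) w * (c1 * (G \o Xs (val k)) w)) = c1 ^+ 2 * Ex P (fun w => G (Xs (val k) w) ^+ 2).
  by rewrite -ExZ; [congr (Ex P _); apply/funext => w /=; ring|case: lG0].
rewrite EUkG VG ler_pdivrMl ?exprn_gt0//.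
have := EUkUk k; rewrite c2sq => h.
apply: le_trans (lerD (lerB h (lexx _)) (lexx _)) _.
by rewrite le_eqVlt; apply/orP; left; apply/eqP; field; rewrite gt_eqF.
Qed.

(** One constant for both projection errors. The factor [12] is [4 * 3], from the bound
    [4 * v ^+ 2 / n.+1 ^+ 2] on [al ^+ 2] and from the square of a sum of three terms. *)
Definition hajek_cst : R := 12 * v%:R ^+ 2 * (v%:R - 1) ^+ 2 * (2 * C + 2 * s2 + C * (v%:R - 1) ^+ 2).
Let K := hajek_cst.

Lemma Ustat_hajek :
  L2 P (fun w => Ustat v (psi theta) (x w) - v%:R / n.+1%:R * H w) /\
  Ex P (fun w => (Ustat v (psi theta) (x w) - v%:R / n.+1%:R * H w) ^+ 2) <= K / n.+1%:R ^+ 2.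
Proof.
have cN0 : 'C(n.+1, v)%:R != 0 :> R.
  by rewrite pnatr_eq0 -lt0n bin_gt0 leqW// vn'.
have v0 : v%:R != 0 :> R by rewrite pnatr_eq0; case: (v) v1.
have E w : Ustat v (psi theta) (x w) - v%:R / n.+1%:R * H w = v%:R / n.+1%:R * (U w / c1 - H w).
  rewrite mulrBr; congr (_ - _); rewrite /Ustat -/(Usum v (psi theta) (x w)) -/(U w).
  apply: (mulfI cN0); apply: (mulfI v0); rewrite mulVKf//.
  by rewrite [v%:R * (_ * (_ * _))]mulrA -cNE; field; rewrite gt_eqF//= pnatr_eq0.
have lE : L2 P (fun w => U w / c1 - H w).
  exact: L2B lUc lH.
under eq_fun do rewrite E.
split; first exact: L2Z.
under eq_fun do rewrite E exprMn.
rewrite ExZ; last by case: lE.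
apply: le_trans (ler_wpM2l (sqr_ge0 _) EdU) _.
have n2 : n.+1%:R / n%:R <= 2 :> R.
  by rewrite ler_pdivrMr// -natrM ler_nat mul2n -addnn -addn1 leq_add2l n0.
have := s20; have := C0; have := sqr_ge0 (v%:R - 1 : R); have := sqr_ge0 (v%:R : R) => h1 h2 h3 h4.
rewrite expr_div_n mulrAC ler_wpM2r ?invr_ge0 ?sqr_ge0// /K /hajek_cst.
set a := v%:R ^+ 2 in h1 *; set b := (v%:R - 1) ^+ 2 in h2 *.
rewrite -(mulrA (C * b)) -[12 * _ * _]mulrA -[12 * _ * _]mulrA; apply: le_trans (_ : a * b * (C * 2) <= _).
  rewrite (_ : a * b * _ = a * (C * b * 2)); last by ring.
  by rewrite ler_wpM2l// ler_wpM2l// mulr_ge0.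
rewrite (_ : 12 * _ = a * b * (24 * C + 24 * s2 + 12 * (C * b))); last by ring.
rewrite ler_wpM2l//; first exact: mulr_ge0.
by have : 0 <= C * b by [exact: mulr_ge0]; lra.
Qed.

(** In the decomposition [al * (f + g + h)], [f] is [n] times an error of mean square [O(1 / n)],
    [g] has constant mean square and [h] has mean square [O(n)]. The factor [al], of order [1 / n],
    leaves [O(1 / n)]. *)
Lemma pseudo_value_hajek (k : 'I_n.+1) :
  L2 P (fun w => pseudo_value v (psi theta) (x w) k - v%:R * G (Xs (val k) w)) /\ Ex P (fun w => (pseudo_value v (psi theta) (x w) k - v%:R * G (Xs (val k) w)) ^+ 2) <= K / n.+1%:R.
Proof.
have c00 : 'C(n, v)%:R != 0 :> R by rewrite pnatr_eq0 -lt0n bin_gt0 vn'.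
have v0 : v%:R != 0 :> R by rewrite pnatr_eq0; case: (v) v1.
have Nv : 0 < n.+1%:R - v%:R :> R by rewrite subr_gt0 ltr_nat ltnS vn'.
pose f w := n%:R * (Uk k w / c1 - G (Xs (val k) w)).
pose g w := (v%:R - 1) * G (Xs (val k) w).
pose h w := - (v%:R - 1) * (U w / c1).
pose al : R := v%:R / (n.+1%:R - v%:R).
have E w : pseudo_value v (psi theta) (x w) k - v%:R * G (Xs (val k) w) = al * (f w + g w + h w).
  rewrite (pseudo_valueE (@psi_perm _ theta)) ?vn'// -/(Uk k w) -/(U w).
  have -> : ('C(n, v)%:R : R) = (n.+1%:R - v%:R) * c1 / v%:R by rewrite -c0E mulrAC mulfV ?mul1r.
  rewrite /al /f /g /h -(natr1 n); field.
  by rewrite natr1 v0 !gt_eqF.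
have lG0 := lG (val k).
have lf : L2 P f by apply: L2Z; exact: L2B (lUkc k) lG0.
have lg : L2 P g by exact: L2Z.
have lh : L2 P h by exact: L2Z.
under eq_fun do rewrite E.
have lfgh := L2D (L2D lf lg) lh.
split; first exact: L2Z.
under eq_fun do rewrite E exprMn.
rewrite ExZ; last by case: lfgh.
have Ef : Ex P (fun w => f w ^+ 2) <= n%:R * (C * (v%:R - 1) ^+ 2).
  under eq_fun do rewrite exprMn.
  rewrite ExZ; last by case: (L2B (lUkc k) lG0).
  apply: le_trans (ler_wpM2l (sqr_ge0 _) (EdUk k)) _.
  by rewrite le_eqVlt; apply/orP; left; apply/eqP; field; rewrite gt_eqF.
have Eg : Ex P (fun w => g w ^+ 2) = (v%:R - 1) ^+ 2 * s2.
  under eq_fun do rewrite exprMn.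
  by rewrite ExZ ?VG//; case: lG0.
have Eh : Ex P (fun w => h w ^+ 2) <= (v%:R - 1) ^+ 2 * (n.+1%:R * (s2 + C * (v%:R - 1) ^+ 2)).
  under eq_fun do rewrite exprMn sqrrN.
  by rewrite ExZ ?ler_wpM2l ?sqr_ge0//; case: lUc.
apply: le_trans (ler_wpM2l (sqr_ge0 _) (Ex_sqrD3 lf lg lh)) _.
have hal : al ^+ 2 <= 4 * v%:R ^+ 2 / n.+1%:R ^+ 2.
  rewrite /al expr_div_n -mulrA mulrCA ler_wpM2l ?sqr_ge0// ler_pdivlMr ?exprn_gt0//.
  rewrite mulrC ler_pdivrMr ?exprn_gt0// (_ : 4 * _ = (2 * (n.+1%:R - v%:R)) ^+ 2); last by ring.
  have : v.*2%:R <= n.+1%:R :> R by rewrite ler_nat.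
  rewrite -mul2n natrM => h1; rewrite lerXn2r ?nnegrE ?mulr_ge0// ?(ltW Nv)//; lra.
have := s20; have := C0; have := sqr_ge0 (v%:R - 1 : R); have := sqr_ge0 (v%:R : R) => h1 h2 h3 h4.
have hs : Ex P (fun w => f w ^+ 2) + Ex P (fun w => g w ^+ 2) + Ex P (fun w => h w ^+ 2) <=
   n.+1%:R * ((v%:R - 1) ^+ 2 * (C + 2 * s2 + C * (v%:R - 1) ^+ 2)).
  apply: le_trans (lerD (lerD Ef (lexx _)) Eh) _; rewrite Eg.
  set b := (v%:R - 1) ^+ 2 in h2 *.
  have n1 : 1 <= n.+1%:R :> R by rewrite ler1n.
  have nn : n%:R <= n.+1%:R :> R by rewrite ler_nat.
  have := ler_wpM2r (mulr_ge0 h2 h3) nn; have := ler_wpM2r (mulr_ge0 h2 h4) n1 => e1 e2.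
  rewrite (_ : n.+1%:R * _ = n.+1%:R * (b * C) + n.+1%:R * (b * s2) + b * (n.+1%:R * (s2 + C * b))); last by ring.
  rewrite lerD2r lerD//; [by rewrite (mulrC C)|by rewrite mul1r in e1].
apply: le_trans (_ : (4 * v%:R ^+ 2 / n.+1%:R ^+ 2) * (3 * (n.+1%:R * ((v%:R - 1) ^+ 2 * (C + 2 * s2 + C * (v%:R - 1) ^+ 2)))) <= _).
  apply: ler_pM => //; first exact: sqr_ge0.
    by rewrite mulr_ge0// !addr_ge0//; apply: Ex_ge0 => w; exact: sqr_ge0.
  by rewrite ler_wpM2l.
set a := v%:R ^+ 2 in h1 *; set b := (v%:R - 1) ^+ 2 in h2 *.
rewrite [leLHS](_ : _ = 12 * a * b * (C + 2 * s2 + C * b) / n.+1%:R); last first.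
  have : n.+1%:R != 0 :> R by rewrite pnatr_eq0.
  by move: (n.+1%:R : R) => N N0; field.
have h5 : 0 <= 12 * a * b by apply: mulr_ge0 h2; apply: mulr_ge0 h1.
have h6 : C + 2 * s2 + C * b <= 2 * C + 2 * s2 + C * b by lra.
by rewrite ler_wpM2r ?invr_ge0//; exact: ler_wpM2l h6.
Qed.

End sample.

(** * Limit theorems for the projection and the exceptional event *)

Hypothesis s2_gt0 : 0 < s2.

Let sg := Num.sqrt s2.
Let sg_gt0 : 0 < sg. Proof. by rewrite sqrtr_gt0. Qed.
Let sg2 : sg ^+ 2 = s2. Proof. by rewrite sqr_sqrtr// ltW. Qed.

Let fxi (x : R) := G x / sg.
Let mfxi : measurable_fun [set: R] fxi. Proof. exact: measurable_funM. Qed.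
Let xi i w := fxi (Xs i w).
Let mxi i : measurable_fun [set: T] (xi i). Proof. exact: measurableT_comp. Qed.
HB.instance Definition _ i := isMeasurableFun.Build _ _ _ _ (xi i) (mxi i).

Let fY (x : R) := G x ^+ 2.
Let mfY : measurable_fun [set: R] fY. Proof. exact: measurable_funX. Qed.
Let Y i w := fY (Xs i w).
Let mY i : measurable_fun [set: T] (Y i). Proof. exact: measurableT_comp. Qed.
HB.instance Definition _ i := isMeasurableFun.Build _ _ _ _ (Y i) (mY i).

Let same_law_comp (f : R -> R) i : measurable_fun [set: R] f -> same_law P (fun w => f (Xs i w)) (fun w => f (Xs 0%N w)).
Proof.
move=> mf B mB; apply: (hlaw i (B := f @^-1` B)).
exact: measurable_preimage mf mB.
Qed.

Definition clt_sum n w := \sum_(i < n) G (Xs i w) / sg.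

Let W n w := clt_sum n w / Num.sqrt n%:R.

Let lxi i : L2 P (xi i).
Proof.
have := L2Z sg^-1 (lG i); congr (L2 P _); apply/funext => w.
by rewrite /xi /fxi mulrC.
Qed.

Lemma clt_sum_cdf (c e : R) : 0 < e -> exists N : nat, forall n, (N <= n)%N ->
  [/\ fine (P [set w | W n w <= c]) <= Phi c + e,
      Phi c - e <= fine (P [set w | W n w <= c]),
      fine (P [set w | W n w < c]) <= Phi c + e &
      Phi c - e <= fine (P [set w | W n w < c])].
Proof.
apply: (@CLT_cdf _ _ _ P xi).
- by move=> i B mB; exact: (same_law_comp i mfxi).
- exact: lxi.
- have -> : Ex P (xi 0%N) = Ex P (fun w => sg^-1 * (G \o Xs 0%N) w).
    by congr (Ex P _); apply/funext => w; rewrite mulrC.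
  by rewrite ExZ ?EG ?mulr0//; exact: L2_L1.
- have -> : (fun w => xi 0%N w ^+ 2) = (fun w => s2^-1 * (G \o Xs 0%N) w ^+ 2).
    by apply/funext => w; rewrite /xi /fxi expr_div_n sg2 mulrC.
  by rewrite ExZ ?VG ?mulVf ?gt_eqF//; case: (lG 0%N).
- move=> k; apply: (@block_indep _ _ _ _ _ hindep _ _ _ _ (iota 0 k) [:: k]).
  + by rewrite cats1 rcons_uniq iota_uniq mem_iota ltnn andbF.
  + apply: measurable_sum => i; apply: (measurableT_comp mfxi).
    by apply: block_coord; rewrite mem_iota /=.
  + by apply: (measurableT_comp mfxi); apply: block_coord; rewrite mem_head.
Qed.

Lemma weak_law_proj (e : R) : 0 < e -> exists N, forall n, (N <= n)%N ->
  Ex P (fun w => `|(\sum_(i < n) G (Xs i w) ^+ 2) / n%:R - s2|) <= e.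
Proof.
have := @weak_law_L1 _ _ _ P Y (fun i => same_law_comp i mfY).
rewrite [Ex P (Y 0%N)](VG 0); apply.
- by move=> i j ij; exact: (indep_comp mfY mfY (Xs_indep ij)).
- by case: (lG 0%N).
- by move=> i w; exact: sqr_ge0.
Qed.

Lemma tail_average_proj (t e : R) : 0 < t -> 0 < e -> exists N, forall n, (N <= n)%N ->
  L1 P (fun w => (\sum_(i < n) if t * n%:R < G (Xs i w) ^+ 2 then G (Xs i w) ^+ 2 else 0) / n%:R) /\
  Ex P (fun w => (\sum_(i < n) if t * n%:R < G (Xs i w) ^+ 2 then G (Xs i w) ^+ 2 else 0) / n%:R) <= e.
Proof.
apply: (@tail_average _ _ _ P Y (fun i => same_law_comp i mfY)).
- by case: (lG 0%N).
- by move=> i w; exact: sqr_ge0.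
Qed.

Let V n w := pseudo_value v (psi theta) (fun i : 'I_n => Xs i w).
Arguments V : clear implicits.

Let K := hajek_cst.

(** Five errors receive [e / 5] each: the projection error of the statistic, that of the
    pseudo-values, the weak law for the squares, the truncated average behind the maximum, and the
    size of [W]. *)
Lemma log_ratio_expansion_prob (t e : R) : 0 < t -> 0 < e -> exists N : nat, forall n, (N <= n)%N ->
  exists B, [/\ measurable B, fine (P B) <= e &
    forall w, ~ B w -> 0 < EL_ratio (V n w) /\ `|- 2 * ln (EL_ratio (V n w)) - W n w ^+ 2| <= t].
Proof.
move=> t0 e0.
have v0 : 0 < v%:R :> R by rewrite ltr0n ltnW.
(* Chebyshev's level for [W], whose second moment is one. *)
pose M := 5 / e + 1.
have M0 : 0 < M by rewrite addr_gt0// divr_gt0.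
have M2 : M ^- 2 <= e / 5.
  rewrite -[leRHS]invrK lef_pV2 ?posrE ?exprn_gt0 ?invr_gt0 ?divr_gt0// invf_div.
  by rewrite expr2; apply: le_trans (_ : M * 1 <= _); [rewrite mulr1 lerDl|rewrite ler_wpM2l ?(ltW M0)// lerDr divr_ge0// ltW].
have [h h0 hexp] := EL_ratio_expansion (mulr_gt0 v0 sg_gt0) M0 t0.
pose Den := 3 + v%:R + v%:R ^+ 2 * (s2 + 2).
have Den0 : 0 < Den.
  by rewrite /Den addr_gt0// ?addr_gt0// mulr_gt0 ?exprn_gt0// addr_gt0.
pose de := Num.min 1 (h / Den).
have de0 : 0 < de by rewrite lt_min ltr01 divr_gt0.
have de1 : de <= 1 by rewrite ge_min lexx.
have deh : de * Den <= h by rewrite -ler_pdivlMr// ge_min lexx orbT.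
have e5 : 0 < e / 5 by rewrite divr_gt0.
have d2 : 0 < de ^+ 2 by rewrite exprn_gt0.
have [N1 h1] := weak_law_proj (mulr_gt0 de0 e5).
have [N2 h2] := tail_average_proj d2 (mulr_gt0 d2 e5).
(* The sign is read off the projection bound itself at one admissible sample size. *)
have K0 : 0 <= K.
  have [_ hK] := pseudo_value_hajek (leqnSn _ : (v.*2 <= (v.*2).+1)%N) ord0.
  rewrite -(pmulr_lge0 (x := (v.*2).+1%:R^-1)) ?invr_gt0//; apply: le_trans hK.
  by apply: Ex_ge0 => w; exact: sqr_ge0.
pose b := (h ^+ 2)^-1 + (de ^+ 2)^-1.
have b0 : 0 < b by rewrite addr_gt0// invr_gt0// exprn_gt0.
exists (maxn v.*2 (maxn (Num.truncn (K * b / (e / 5))).+1 (maxn N1 N2))) => n.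
rewrite !geq_max => /and4P[vn Nn /h1 {}h1 /h2[l2 {}h2]].
have n0 : (0 < n)%N by apply: leq_trans vn; rewrite double_gt0 ltnW.
have nR0 : 0 < n%:R :> R by rewrite ltr0n.
have nb : K * b / (e / 5) <= n%:R.
  by apply: ltW; apply: lt_le_trans (truncnS_gt _) _; rewrite ler_nat.
have Kn (z : R) : 0 < z -> z^-1 <= b -> K / n%:R / z <= e / 5.
  move=> z0 zb; rewrite mulrAC ler_pdivrMr// [leRHS]mulrC -ler_pdivrMr//.
  apply: le_trans nb; rewrite ler_wpM2r ?invr_ge0 ?(ltW e5)// ler_wpM2l//.
have [lU hU] : L2 P (fun w => Ustat v (psi theta) (fun i : 'I_n => Xs i w) - v%:R / n%:R * \sum_(i < n) G (Xs i w)) /\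
  Ex P (fun w => (Ustat v (psi theta) (fun i : 'I_n => Xs i w) - v%:R / n%:R * \sum_(i < n) G (Xs i w)) ^+ 2) <= K / n%:R ^+ 2.
  by case: (n) n0 vn => // m _ vm; exact: (Ustat_hajek vm).
have hV k : L2 P (fun w => V n w k - v%:R * G (Xs (val k) w)) /\
  Ex P (fun w => (V n w k - v%:R * G (Xs (val k) w)) ^+ 2) <= K / n%:R.
  rewrite /V; case: (n) k n0 vn => // m k _ vm.
  exact: (pseudo_value_hajek vm).
have hmean w : (\sum_k V n w k) / n%:R = Ustat v (psi theta) (fun i : 'I_n => Xs i w).
  rewrite /V; case: (n) n0 vn => // m _ vm; apply: mean_pseudo_value; first exact: psi_perm.
  by move: vm v1; rewrite -addnn; case: (v) => [|[|u]]//; rewrite addnS ltnS => h3 _; apply: leq_trans h3; rewrite addSn ltnS leq_addr.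
pose f1 w : R := (Ustat v (psi theta) (fun i : 'I_n => Xs i w) - v%:R / n%:R * \sum_(i < n) G (Xs i w)) ^+ 2.
pose f2 w : R := \sum_k (V n w k - v%:R * G (Xs (val k) w)) ^+ 2.
pose f3 w : R := `|(\sum_(i < n) G (Xs i w) ^+ 2) / n%:R - s2|.
pose f4 w : R := (\sum_(i < n) if de ^+ 2 * n%:R < G (Xs i w) ^+ 2 then G (Xs i w) ^+ 2 else 0) / n%:R.
pose f5 w : R := (\sum_(i < n) G (Xs i w)) ^+ 2.
have l1 : L1 P f1 by case: lU.
have l2' : L1 P f2 by apply: L1_sum => k _; case: (hV k) => -[].
have l3 : L1 P f3.
  apply: L1_norm; apply: L1B; last exact: L1_cst.
  under eq_fun do rewrite mulrC; apply/L1Z/L1_sum => i _; by case: (lG i).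
have l5 : L1 P f5 by have [] : L2 P (fun w => \sum_(i < n) G (Xs i w)) by apply: L2_sum => i _; exact: lG.
have E5 : Ex P f5 = n%:R * s2.
  rewrite /f5; case: (n) n0 => // m _.
  by have := Ex_sum_proj_sqr m => <-; congr (Ex P _).
have E2 : Ex P f2 <= n%:R * (K / n%:R).
  rewrite /f2 Ex_sum; last by move=> k _; case: (hV k) => -[].
  apply: le_trans (_ : \sum_(k < n) K / n%:R <= _).
    by apply: ler_sum => k _; case: (hV k).
  by rewrite sumr_const card_ord mulr_natl.
(* Reciprocals of the thresholds below which [f1], [f2] and [f5] meet the hypotheses of
   [EL_ratio_expansion] and [pseudo_value_control]. *)
pose c1 : R := n%:R / h ^+ 2; pose c2 : R := (n%:R * de ^+ 2)^-1; pose c5 : R := (s2 * n%:R * M ^+ 2)^-1.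
(* [F] is at least [1] on each exceptional event, so that one application of
   Markov's inequality excludes all of them. *)
pose F w : R := c1 * f1 w + c2 * f2 w + de^-1 * f3 w + (de ^+ 2)^-1 * f4 w + c5 * f5 w.
have c10 : 0 < c1 by rewrite divr_gt0// exprn_gt0.
have c20 : 0 < c2 by rewrite invr_gt0 mulr_gt0.
have c50 : 0 < c5 by rewrite invr_gt0 !mulr_gt0// exprn_gt0.
have p1 w : 0 <= c1 * f1 w by rewrite mulr_ge0 ?sqr_ge0// ltW.
have p2 w : 0 <= c2 * f2 w by rewrite mulr_ge0 ?(ltW c20)//; apply: sumr_ge0 => k _; exact: sqr_ge0.
have p3 w : 0 <= de^-1 * f3 w by apply: mulr_ge0; [rewrite invr_ge0 ltW|exact: normr_ge0].
have p4 w : 0 <= (de ^+ 2)^-1 * f4 w.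
  rewrite mulr_ge0 ?invr_ge0 ?(ltW d2)// divr_ge0//; apply: sumr_ge0 => i _.
  by case: ifP => // _; exact: sqr_ge0.
have p5 w : 0 <= c5 * f5 w by rewrite mulr_ge0 ?sqr_ge0// ltW.
have L1' := L1Z c1 l1; have L2' := L1Z c2 l2'; have L3' := L1Z de^-1 l3.
have L4' := L1Z (de ^+ 2)^-1 l2; have L5' := L1Z c5 l5.
have lF : L1 P F := L1D (L1D (L1D (L1D L1' L2') L3') L4') L5'.
have F0 w : 0 <= F w by rewrite !addr_ge0.
have EF : Ex P F <= e.
  rewrite [Ex P F](ExD (L1D (L1D (L1D L1' L2') L3') L4') L5') (ExD (L1D (L1D L1' L2') L3') L4').
  rewrite (ExD (L1D L1' L2') L3') (ExD L1' L2') (ExZ _ l1) (ExZ _ l2') (ExZ _ l3) (ExZ _ l2) (ExZ _ l5) E5.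
  have q1 : c1 * Ex P f1 <= e / 5.
    apply: le_trans (ler_wpM2l (ltW c10) hU) _.
    rewrite [leLHS](_ : _ = K / n%:R / h ^+ 2); last by rewrite /c1; field; rewrite !gt_eqF.
    by apply: Kn; [rewrite exprn_gt0|rewrite lerDl invr_ge0 ltW].
  have q2 : c2 * Ex P f2 <= e / 5.
    apply: le_trans (ler_wpM2l (ltW c20) E2) _.
    rewrite [leLHS](_ : _ = K / n%:R / de ^+ 2); last by rewrite /c2; field; rewrite !gt_eqF.
    by apply: Kn => //; rewrite lerDr invr_ge0 sqr_ge0.
  have q3 : de^-1 * Ex P f3 <= e / 5 by rewrite ler_pdivrMl.
  have q4 : (de ^+ 2)^-1 * Ex P f4 <= e / 5 by rewrite ler_pdivrMl.
  have q5 : c5 * (n%:R * s2) <= e / 5.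
    by rewrite [leLHS](_ : _ = M ^- 2)// /c5; field; rewrite !gt_eqF.
  have -> : e = e / 5 + e / 5 + e / 5 + e / 5 + e / 5 by field.
  by rewrite !lerD.
have mB : measurable [set w | 1 <= F w] := measurable_superlevel (L1_measurable lF) 1.
exists [set w | 1 <= F w]; split => //.
  have := markov_L1 lF F0 ltr01; rewrite divr1 => hm.
  by apply: le_trans EF; rewrite -lee_fin fineK ?fin_num_measure.
move=> w /negP; rewrite /= -ltNge => Fw.
have [g1 g2 g3 g4 g5] : [/\ c1 * f1 w < 1, c2 * f2 w < 1, de^-1 * f3 w < 1, (de ^+ 2)^-1 * f4 w < 1 & c5 * f5 w < 1].
  exact: sum5_lt1 (p1 w) (p2 w) (p3 w) (p4 w) (p5 w) Fw.
have k2 : (\sum_k (V n w k - v%:R * G (Xs (val k) w)) ^+ 2) / n%:R < de ^+ 2.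
  by rewrite -/(f2 w) ltr_pdivrMr// -[ltRHS]mulr1 -ltr_pdivrMl ?mulr_gt0// [de ^+ 2 * _]mulrC.
have k3 : f3 w < de by rewrite -[ltRHS]mulr1 -ltr_pdivrMl.
have k4 : f4 w < de ^+ 2 by rewrite -[ltRHS]mulr1 -ltr_pdivrMl.
have [hV2 hmax] := pseudo_value_control n0 (ltW v0) (ltW s2_gt0) de0 de1 deh k2 k3 k4.
have r0 : 0 < Num.sqrt n%:R :> R by rewrite sqrtr_gt0.
have r2 : Num.sqrt n%:R ^+ 2 = n%:R :> R by rewrite sqr_sqrtr.
have WE : W n w = (\sum_(i < n) G (Xs i w)) / (sg * Num.sqrt n%:R).
  by rewrite /W /clt_sum -mulr_suml invfM mulrA.
apply: hexp => //.
- apply: norm_le_sqr; first exact: ltW.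
  rewrite WE expr_div_n exprMn sg2 r2 -/(f5 w) ler_pdivrMr ?mulr_gt0// ltW//.
  rewrite -[ltRHS]mulr1 -ltr_pdivrMl ?mulr_gt0 ?exprn_gt0//.
  by rewrite [M ^+ 2 * _]mulrC.
- apply: norm_le_sqr; first exact: ltW.
  rewrite hmean (_ : _ - _ = Num.sqrt n%:R * (Ustat v (psi theta) (fun i : 'I_n => Xs i w) - v%:R / n%:R * \sum_(i < n) G (Xs i w))).
    rewrite exprMn r2 -/(f1 w) ltW// -[ltRHS]mulr1 -ltr_pdivrMl ?exprn_gt0//.
    by rewrite mulrA [_^-1 * _]mulrC.
  have E (r N H : R) : r != 0 -> r ^+ 2 = N -> v%:R * sg * (H / (sg * r)) = r * (v%:R / N * H).
    by move=> rn0 <-; field; rewrite rn0 gt_eqF.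
  by rewrite WE mulrBr; congr (_ - _); apply: E => //; rewrite gt_eqF.
- by rewrite exprMn sg2.
Qed.

End asymptotics.

(** * Measurability of the log-likelihood ratio *)

Section measurability.
Context {d : measure_display} {T : measurableType d} {R : realType}.
Variable P : probability T R.
Variable Xs : nat -> {RV P >-> R}.
Variables (theta : R) (v : nat).

(** The index map [f] covers both the full sample and the samples with one observation deleted. *)
Lemma measurable_Ustat_psi n (f : 'I_n -> nat) :
  measurable_fun [set: T] (fun w => Ustat v (psi theta) (fun i => Xs (f i) w)).
Proof.
apply: measurable_funM => //.
rewrite (_ : (fun w => _) = (fun w => \sum_(A : {set 'I_n})
    if #|A| == v then psi theta [seq Xs (f i) w | i <- enum A] else 0)); last first.
  by apply/funext => w; rewrite big_mkcond.
apply: measurable_sum => A; case: (#|A| == v); last exact: measurable_cst.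
have -> : (fun w => psi theta [seq Xs (f i) w | i <- enum A]) =
    (fun w => psi theta (obs Xs [seq f i | i <- enum A] w)).
  by apply/funext => w; rewrite /obs -map_comp.
exact: measurable_psi_obs.
Qed.

Lemma measurable_JEL n :
  measurable_fun [set: T] (fun w => JEL_logratio v (psi theta) (fun i : 'I_n => Xs i w)).
Proof.
(* With no observation the ratio does not depend on [w]; [EL_ratio_ge0] needs a non-empty sample. *)
rewrite /JEL_logratio; case: n => [|n].
  have E w w' : EL_ratio (pseudo_value v (psi theta) (fun i : 'I_0 => Xs i w)) =
     EL_ratio (pseudo_value v (psi theta) (fun i : 'I_0 => Xs i w')).
    by congr EL_ratio; apply/funext => -[].
  have -> : (fun w => lne (EL_ratio (pseudo_value v (psi theta) (fun i : 'I_0 => Xs i w)))%:E) =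
      cst (lne (EL_ratio (pseudo_value v (psi theta) (fun i : 'I_0 => Xs i point)))%:E).
    by apply/funext => w; rewrite (E w point).
  exact: measurable_cst.
apply: measurable_lne_ge0 => [w|]; first exact: EL_ratio_ge0.
apply: measurable_EL_ratio => k; apply: measurable_funB; apply: measurable_funM => //.
  exact: measurable_Ustat_psi.
exact: (measurable_Ustat_psi (fun i : 'I_n => lift k i : 'I_n.+1)).
Qed.

End measurability.

Unset Implicit Arguments.

Theorem theorem5 (R : realType) (d : measure_display) (T : measurableType d)
  (P : probability T R) (v : nat) (F : R -> R)
  (X : {RV P >-> R}) (Xs : nat -> {RV P >-> R}) (theta : R)
  (g : R -> R) (sigma2_g : R)
  (hv : (1 < v)%N)
  (hF : abs_continuous_df F)
  (hXF : forall x : R, cdf X x = (F x)%:E)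
  (hX0 : forall w : T, 0 <= X w)
  (hXfin : ('E_P[X] < +oo)%E)
  (hindep : mutually_independent Xs)
  (hident : forall (i : nat) (x : R), cdf (Xs i) x = (F x)%:E)
  (htheta : theta = GIM P Xs v)
  (hpsi : ('E_P[fun w => psi theta (first_obs Xs v w)] < +oo)%E)
  (hg : is_cond_expectation (fun w => psi theta (first_obs Xs v w)) (Xs 0%N) g)
  (hsigma2 : ('V_P[g \o X] = sigma2_g%:E)%E)
  (hsigma2_gt0 : 0 < sigma2_g) :
  cvg_in_distribution P
    (fun n w => (- 2%:E * JEL_logratio v (psi theta) (fun i : 'I_n => Xs i w))%E)
    (chi_square1 R).
Proof.
have hlaw i : same_law P (Xs i) (Xs 0%N) by apply: cdf_same_law => x; rewrite !hident.
have hX i : same_law P X (Xs i) by apply: cdf_same_law => x; rewrite hXF hident.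
have lX : L1 P X.
  apply/integrableP; split; first by apply/measurable_EFinP; exact: measurable_funPT.
  move: hXfin; rewrite unlock; congr (_ < _)%E; apply: eq_integral => w _.
  by rewrite /= ger0_norm.
have lXs i : L1 P (Xs i) := same_law_L1 (hX i) (@measurable_id _ R setT) lX.
have [H Epsi0] := proj_moments hindep hlaw hv lXs hX0 (hX 0%N) htheta hg hsigma2 hsigma2_gt0.
have l2 i : L2 P (Xs i) by case: (H i).
have lG i : L2 P (proj_kernel Xs theta v \o Xs i) by case: (H i).
have EG i : Ex P (proj_kernel Xs theta v \o Xs i) = 0 by case: (H i).
have VG i : Ex P (fun w => proj_kernel Xs theta v (Xs i w) ^+ 2) = sigma2_g by case: (H i).
apply: (cvg_chi_square1 (W := fun n w => clt_sum Xs theta v sigma2_g n w / Num.sqrt n%:R)).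
- by move=> n; apply: emeasurable_funM => //; exact: measurable_JEL.
- move=> n; apply: measurable_funM => //; apply: measurable_sum => i; apply: measurable_funM => //.
  by case: (lG i).
- exact: (clt_sum_cdf hindep hlaw l2 lG EG VG hsigma2_gt0).
- move=> t e t0 e0.
  have [N hN] := log_ratio_expansion_prob hindep hlaw hv l2 lG EG VG Epsi0 hsigma2_gt0 t0 e0.
  exists N => n /hN[B [mB PB hB]]; exists B; split => // w /hB[EL0 hw].
  exists (- 2 * ln (EL_ratio (pseudo_value v (psi theta) (fun i : 'I_n => Xs i w)))) => //.
  (* Outside [B] the ratio is positive, so the extended logarithm is the real one. *)
  by rewrite /JEL_logratio lne_EFin// EFinM.
Qed.
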